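(* Let $\sigma\in(0,2)$ and either $d\ge2$, or $d=1$ and $\sigma\in(0,1)$. Write $x=(x_1,x')\in\mathbb{R}\times\mathbb{R}^{d-1}$ and let $L$ be the (time-independent) operator associated with the Lévy measure $$\nu(dy)=\sum_{k\in\mathbb{Z}}2^{-k\sigma}\big(\delta_{2^k}(dy_1)+\delta_{-2^k}(dy_1)\big)\otimes\delta_0^{d-1}(dy')+|y'|^{1-d-\sigma}dy'\otimes\delta_0(dy_1)$$ (for $d=1$ only the first sum is present, without the factor $\delta_0^{d-1}$). Then: (a) If $p\in(1,\infty)$ and $l\in[\sigma p,d(p-1))$ (a range which is nonempty for large $p$), then $\omega(x)=|x|^l$ belongs to $A_p(\mathbb{R}^d)$ and $L$ is not bounded from $H_{p,\omega}^\sigma(\mathbb{R}^d)$ to $L_{p,\omega}(\mathbb{R}^d)$. (b) Consequently, for every $p\in(1,\infty)$ there exists a weight $\omega\in A_p(\mathbb{R}^d)$ such that $L$ is not bounded from $H_{p,\omega}^\sigma(\mathbb{R}^d)$ to $L_{p,\omega}(\mathbb{R}^d)$.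
   Context: The operator associated with a Lévy measure $\nu$ is $Lu(x)=\int_{\mathbb{R}^d}(u(x+y)-u(x)-\nabla u(x)\cdot y^{(\sigma)})\,\nu(dy)$ for $u\in C_c^\infty(\mathbb{R}^d)$, where $y^{(\sigma)}:=(1_{\sigma\in(1,2)}+1_{\sigma=1}1_{|y|\le1})\,y$. Here $\delta_a$ is the one-dimensional Dirac mass at $a$ and $\delta_0^{d-1}$ the $(d-1)$-dimensional Dirac mass at the origin. For $p\in(1,\infty)$, a locally integrable nonnegative $\omega$ on $\mathbb{R}^d$ belongs to $A_p(\mathbb{R}^d)$ if $$\sup_{r>0,x_0\in\mathbb{R}^d}\Big(\frac1{|B_r|}\int_{B_r(x_0)}\omega\,dx\Big)\Big(\frac1{|B_r|}\int_{B_r(x_0)}\omega^{1/(1-p)}\,dx\Big)^{p-1}<\infty.$$ $L_{p,\omega}(\mathbb{R}^d):=L_p(\mathbb{R}^d,\omega\,dx)$ and $H_{p,\omega}^\sigma(\mathbb{R}^d)=\{u\in L_{p,\omega}(\mathbb{R}^d):(1-\Delta)^{\sigma/2}u\in L_{p,\omega}(\mathbb{R}^d)\}$ with norm $\|(1-\Delta)^{\sigma/2}u\|_{L_{p,\omega}(\mathbb{R}^d)}$. ''$L$ is not bounded from $H_{p,\omega}^\sigma$ to $L_{p,\omega}$'' means that there is no constant $N$ with $\|Lv\|_{L_{p,\omega}(\mathbb{R}^d)}\le N\|v\|_{H_{p,\omega}^\sigma(\mathbb{R}^d)}$ for all $v\in C_c^\infty(\mathbb{R}^d)$. *)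

(* Defs.v *)
From HB Require Import structures.
From mathcomp Require Import all_boot all_order all_algebra.
From mathcomp Require Import complex.
From mathcomp Require Import all_classical all_reals all_analysis.
From mathcomp Require Import measurable_realfun.

Set Implicit Arguments.
Unset Strict Implicit.
Unset Printing Implicit Defensive.

Import Order.TTheory GRing.Theory Num.Theory.
Import numFieldNormedType.Exports.

Local Open Scope classical_set_scope.
Local Open Scope ring_scope.

(* R^n is 'rV[R]_n.  The library provides its topology and differential        *)
(* calculus through the sup norm `|x|; enorm is the Euclidean norm, and the    *)
(* balls of the A_p condition are Euclidean.                                   *)

Section euclidean.
Context {R : realType} {n : nat}.
Implicit Types x y : 'rV[R]_n.

Definition dotv x y : R := \sum_(i < n) x ord0 i * y ord0 i.

Definition enorm x : R := Num.sqrt (dotv x x).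

Definition eball x (r : R) : set 'rV[R]_n := [set y | enorm (y - x) < r].

End euclidean.

(* The product (Borel) sigma-algebra of R^n, generated by the coordinates.     *)

Definition coord_rV {R : realType} {n : nat} (i : 'I_n) (x : 'rV[R]_n) :
  measurableTypeR R := x ord0 i.

Definition measure_rV_display : measure_display.
Proof. exact: default_measure_display. Qed.

Section measurable_rV.
Context (R : realType) (n : nat).

Let rV0 : g_sigma_preimage (@coord_rV R n) set0.
Proof. exact: sigma_algebra0. Qed.

Let rVC A : g_sigma_preimage (@coord_rV R n) A ->
  g_sigma_preimage (@coord_rV R n) (~` A).
Proof. exact: sigma_algebraC. Qed.

Let rV_bigcup (F : _^nat) : (forall i, g_sigma_preimage (@coord_rV R n) (F i)) ->
  g_sigma_preimage (@coord_rV R n) (\bigcup_i F i).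
Proof. exact: sigma_algebra_bigcup. Qed.

HB.instance Definition _ := @isMeasurable.Build measure_rV_display
  'rV[R]_n (g_sigma_preimage (@coord_rV R n)) rV0 rVC rV_bigcup.

End measurable_rV.

Section lebesgue.
Context {R : realType}.

(* The identification (x_1, x') |-> x of R x R^n with R^(n+1).                 *)
Definition rv_cons {n : nat} (z : measurableTypeR R * 'rV[R]_n) : 'rV[R]_n.+1 :=
  row_mx (z.1 : R)%:M z.2.

Lemma measurable_coord_rV n (i : 'I_n) :
  measurable_fun [set: 'rV[R]_n] (coord_rV i).
Proof.
move=> _ Y mY; rewrite setTI; apply: sub_sigma_algebra => /=.
rewrite -bigcup_seq/=; exists i => /=; first by rewrite mem_index_enum.
by exists Y => //; rewrite setTI.
Qed.

Lemma measurable_fun_rVP d (T : measurableType d) n (f : T -> 'rV[R]_n) :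
  (forall i, measurable_fun [set: T] (coord_rV i \o f)) ->
  measurable_fun [set: T] f.
Proof.
move=> mf; have sub : g_sigma_preimage (fun i => coord_rV i \o f) `<=` measurable.
  apply: smallest_sub; first exact: sigma_algebra_measurable.
  rewrite -bigcup_seq => A [/= i _ [B mB <-]].
  by rewrite setTI -[X in measurable X]setTI; exact: mf.
rewrite g_sigma_preimage_comp in sub => _ A mA.
by apply: sub; exists A.
Qed.

Lemma measurable_rv_cons n : measurable_fun setT (@rv_cons n).
Proof.
apply: measurable_fun_rVP => i.
case: (@split_ordP 1 n i) => [j ->|j ->].
- rewrite (_ : _ \o _ = fst); first exact: measurable_fst.
  by apply/funext => z; rewrite /comp /coord_rV /rv_cons (@row_mxEl _ 1 1 n) mxE !ord1 eqxx.
- rewrite (_ : _ \o _ = coord_rV j \o snd).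
    exact: measurableT_comp (measurable_coord_rV j) measurable_snd.
  by apply/funext => z; rewrite /comp /coord_rV /rv_cons (@row_mxEr _ 1 1 n).
Qed.

Definition rv_uncons {n : nat} (x : 'rV[R]_n.+1) : measurableTypeR R * 'rV[R]_n :=
  (x ord0 ord0, \row_j x ord0 (lift ord0 j)).

Lemma rv_consK n : cancel (@rv_cons n) rv_uncons.
Proof.
move=> [t v]; rewrite /rv_uncons /rv_cons; congr pair.
  have -> : ord0 = lshift n (ord0 : 'I_1) by exact/val_inj.
  by rewrite (@row_mxEl _ 1 1 n) mxE ord1 eqxx.
apply/rowP => j; rewrite mxE.
have -> : lift ord0 j = rshift 1 j by exact/val_inj.
by rewrite (@row_mxEr _ 1 1 n).
Qed.

Lemma measurable_rv_uncons n : measurable_fun setT (@rv_uncons n).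
Proof.
apply/measurable_fun_pairP; split; first exact: (measurable_coord_rV ord0).
apply: measurable_fun_rVP => j.
rewrite (_ : _ \o _ = coord_rV (lift ord0 j)); first exact: measurable_coord_rV.
by apply/funext => x /=; rewrite /coord_rV mxE.
Qed.

Lemma measurable_enorm n : measurable_fun setT (@enorm R n).
Proof.
have mc (i : 'I_n) : measurable_fun setT (fun x : 'rV[R]_n => x ord0 i : R).
  exact: measurable_coord_rV.
have ms := continuous_measurable_fun (@sqrt_continuous R).
apply: (@measurableT_comp _ _ _ _ _ _ _ _ _ ms).
by apply: measurable_sum => i; exact: measurable_funM.
Qed.

(* The measure on R^(n+1) corresponding to a measure m on R x R^n.             *)
Definition rv_measure {n : nat}
    (m : {measure set (measurableTypeR R * 'rV[R]_n)%type -> \bar R}) :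
  set 'rV[R]_n.+1 -> \bar R := pushforward m rv_cons.

Section rv_measure.
Context (n : nat) (m : {measure set (measurableTypeR R * 'rV[R]_n)%type -> \bar R}).
Local Open Scope ereal_scope.

Let rv_measure0 : rv_measure m set0 = 0.
Proof. by rewrite /rv_measure /pushforward preimage_set0 measure0. Qed.

Let rv_measure_ge0 A : 0 <= rv_measure m A.
Proof. by rewrite /rv_measure /pushforward; exact: measure_ge0. Qed.

Let rv_measure_sigma_additive : semi_sigma_additive (rv_measure m).
Proof.
pose m' := measure_function_pushforward__canonical__measure_function_Measure
  m (@measurable_rv_cons n).
exact: (@measure_semi_sigma_additive _ _ _ m').
Qed.

HB.instance Definition _ := isMeasure.Build _ _ _ (rv_measure m)
  rv_measure0 rv_measure_ge0 rv_measure_sigma_additive.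

End rv_measure.

(* One step of the construction of Lebesgue measure: dx = dx_1 dx'.            *)
Definition lebesgue_step {n : nat}
    (m : {sigma_finite_measure set 'rV[R]_n -> \bar R}) :
  set 'rV[R]_n.+1 -> \bar R := rv_measure (@lebesgue_measure R \x m)%E.

Section lebesgue_step.
Context (n : nat) (m : {sigma_finite_measure set 'rV[R]_n -> \bar R}).
Local Open Scope ereal_scope.

HB.instance Definition _ := Measure.on (lebesgue_step m).

Let lebesgue_step_sigma_finite : sigma_finite setT (lebesgue_step m).
Proof.
have /sigma_finiteP[F [TF ndF Foo]] := sigma_finiteT (@lebesgue_measure R).
have /sigma_finiteP[G [TG ndG Goo]] := sigma_finiteT m.
exists (fun k => rv_uncons @^-1` (F k `*` G k)).
  apply/esym; rewrite -subTset => x _.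
  have : [set: measurableTypeR R] (rv_uncons x).1 by [].
  rewrite TF => -[i _ Fi].
  have : [set: 'rV[R]_n] (rv_uncons x).2 by [].
  rewrite TG => -[j _ Gj].
  exists (maxn i j) => //; split.
  - by move: Fi; exact/subsetPset/ndF/leq_maxl.
  - by move: Gj; exact/subsetPset/ndG/leq_maxr.
move=> k; have [mF Fk] := Foo k; have [mG Gk] := Goo k; split.
  rewrite -[X in measurable X]setTI; apply: measurable_rv_uncons => //.
  exact: measurableX.
rewrite /lebesgue_step /rv_measure /pushforward -comp_preimage.
rewrite (_ : rv_uncons \o rv_cons = idfun); last exact/funext/rv_consK.
rewrite preimage_id/= product_measure1E//.
by apply: lte_mul_pinfty => //; rewrite ge0_fin_numE.
Qed.

HB.instance Definition _ := Measure_isSigmaFinite.Build _ _ _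
  (lebesgue_step m) lebesgue_step_sigma_finite.

End lebesgue_step.

(* Lebesgue measure on the Borel sets of R^n.                                  *)
Fixpoint lebesgue_rV (n : nat) :
    {sigma_finite_measure set 'rV[R]_n -> \bar R} :=
  match n with
  | 0%N => \d_(0 : 'rV[R]_0)
  | k.+1 => lebesgue_step (lebesgue_rV k)
  end.

End lebesgue.

Section levy.
Context {R : realType} (sigma : R).

(* y^(sigma) = (1_{sigma in (1,2)} + 1_{sigma = 1} 1_{|y| <= 1}) y.            *)
Definition levy_cutoff {n : nat} (y : 'rV[R]_n) : 'rV[R]_n :=
  ((1 < sigma < 2)%R%:R + (sigma == 1)%R%:R * (enorm y <= 1)%R%:R) *: y.

Definition gradv {n : nat} (u : 'rV[R]_n -> R) (x : 'rV[R]_n) : 'rV[R]_n :=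
  \row_(i < n) 'D_(delta_mx ord0 i) u x.

Definition levy_op {n : nat} (nu : {measure set 'rV[R]_n -> \bar R})
    (u : 'rV[R]_n -> R) (x : 'rV[R]_n) : R :=
  \int[nu]_y (u (x + y) - u x - dotv (gradv u x) (levy_cutoff y)).

(* 2^(-k sigma) (delta_{2^k} + delta_{-2^k}) on R, for k in Z.                 *)
Definition levy_atom (k : int) : {measure set (measurableTypeR R) -> \bar R} :=
  mscale (NngNum (powR_ge0 2 (- (k%:~R * sigma))))
    (measure_add (\d_((2 : R) ^ k : measurableTypeR R))
                 (\d_(- (2 : R) ^ k : measurableTypeR R))).

(* The sum over k in Z, split into k >= 0 and k = Negz j = - (j + 1).          *)
Definition levy_axis : {measure set (measurableTypeR R) -> \bar R} :=
  measure_add (mseries (fun j : nat => levy_atom (Posz j)) 0)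
              (mseries (fun j : nat => levy_atom (Negz j)) 0).

(* |y'|^(1 - d - sigma) dy' on R^n, with d = n + 1; absent if n = 0.  The      *)
(* density is 0 rather than +oo at y' = 0, a null set.                         *)
Definition levy_tail (n : nat) : set 'rV[R]_n -> \bar R :=
  match n with
  | 0%N => mzero
  | k.+1 => fun A => (\int[lebesgue_rV k.+1]_(y in A)
      (enorm y `^ (1 - k.+2%:R - sigma))%:E)%E
  end.
Arguments levy_tail n A : clear implicits.

Section levy_tail.
Context (n : nat).
Local Open Scope ereal_scope.

Let levy_tail0 : levy_tail n set0 = 0.
Proof. by case: n => [|k] //=; rewrite integral_set0. Qed.

Let levy_tail_ge0 A : 0 <= levy_tail n A.
Proof.
case: n A => [|k] A //=; apply: integral_ge0 => y _.
by rewrite lee_fin powR_ge0.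
Qed.

Let levy_tail_sigma_additive : semi_sigma_additive (levy_tail n).
Proof.
case: n => [|k]; first exact: (@measure_semi_sigma_additive _ _ _ mzero).
apply: semi_sigma_additive_nng_induced => [|y]; last by rewrite lee_fin powR_ge0.
apply/measurable_EFinP.
pose a : R := (1 - k.+2%:R - sigma)%R.
have := measurableT_comp (measurable_powR a) (@measurable_enorm R k.+1).
by apply.
Qed.

HB.instance Definition _ := isMeasure.Build _ _ _ (levy_tail n)
  levy_tail0 levy_tail_ge0 levy_tail_sigma_additive.

End levy_tail.

(* The Levy measure nu on R^d, d = n + 1, in the coordinates y = (y_1, y').    *)
Definition levy_measure (n : nat) : {measure set 'rV[R]_n.+1 -> \bar R} :=
  rv_measure (measure_add (levy_axis \x \d_(0%R : 'rV[R]_n))%E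
                          (\d_(0%R : measurableTypeR R) \x^ levy_tail n)%E).

End levy.
Arguments levy_tail {R} sigma n A.

Section test_functions.
Context {R : realType} {n : nat}.
Implicit Types f : 'rV[R]_n -> R.

Definition partial (i : 'I_n) f : 'rV[R]_n -> R :=
  fun x => 'D_(delta_mx ord0 i) f x.

(* C^oo: every iterated partial derivative is differentiable everywhere.       *)
Definition smooth f : Prop :=
  forall (s : seq 'I_n) (x : 'rV[R]_n), differentiable (foldr partial f s) x.

Definition test_function f : Prop :=
  smooth f /\ compact (closure [set x | f x != 0]).

End test_functions.

Section bessel.
Context {R : realType} {n : nat}.
Local Open Scope complex_scope.

Definition cis (t : R) : R[i] := cos t +i* sin t.

Definition cintegral (f : 'rV[R]_n -> R[i]) : R[i] :=
  (\int[lebesgue_rV n]_x complex.Re (f x)) +i*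
  (\int[lebesgue_rV n]_x complex.Im (f x)).

Definition fourier (f : 'rV[R]_n -> R[i]) (xi : 'rV[R]_n) : R[i] :=
  cintegral (fun x => f x * cis (- dotv x xi)).

Definition inv_fourier (g : 'rV[R]_n -> R[i]) (x : 'rV[R]_n) : R[i] :=
  ((2 * pi) ^- n)%:C * cintegral (fun xi => g xi * cis (dotv x xi)).

(* (1 - Delta)^(sigma/2), the Fourier multiplier (1 + |xi|^2)^(sigma/2).       *)
Definition bessel (sigma : R) (u : 'rV[R]_n -> R) : 'rV[R]_n -> R[i] :=
  inv_fourier (fun xi => ((1 + enorm xi ^+ 2) `^ (sigma / 2))%:C
                         * fourier (fun x => (u x)%:C) xi).

End bessel.

Section weights.
Context {R : realType} {n : nat}.
Local Open Scope ereal_scope.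
Implicit Types (w : 'rV[R]_n -> R) (p : R).

Definition mean (x0 : 'rV[R]_n) (r : R) (f : 'rV[R]_n -> \bar R) : \bar R :=
  (lebesgue_rV n (eball x0 r))^-1 * \int[lebesgue_rV n]_(x in eball x0 r) f x.

(* w^(1/(1-p)) is written as the extended-real inverse of w^(1/(p-1)), so that *)
(* it is +oo where w vanishes (the real power 0 `^ a is 0 for a < 0).  As      *)
(* 0 * +oo = 0 in \bar R, w = 0 a.e. is not excluded.                          *)
Definition Ap p w : Prop :=
  [/\ measurable_fun setT w,
      forall K, compact K -> \int[lebesgue_rV n]_(x in K) `|w x|%:E < +oo,
      forall x, (0 <= w x)%R &
      ereal_sup [set mean z.1 z.2 (EFin \o w)
                     * (mean z.1 z.2 (fun x => ((w x `^ (p - 1)^-1)%R%:E)^-1))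
                         `^ (p - 1)
                | z in [set z : 'rV[R]_n * R | (0 < z.2)%R]] < +oo].

(* The norm of L_p(R^n, w dx).                                                 *)
Definition wLnorm p w (f : 'rV[R]_n -> R) : \bar R :=
  (\int[lebesgue_rV n]_x ((`|f x| `^ p * w x)%R%:E)) `^ p^-1.

(* The norm of H^sigma_{p,w}, on test functions; bessel sigma u is a priori    *)
(* complex-valued and enters through its modulus.                              *)
Definition wHnorm sigma p w (u : 'rV[R]_n -> R) : \bar R :=
  wLnorm p w (fun x => Normc.normc (bessel sigma u x)).

Definition bounded_HL sigma p w (T : ('rV[R]_n -> R) -> 'rV[R]_n -> R) : Prop :=
  exists N : R, forall v, test_function v ->
    wLnorm p w (T v) <= N%:E * wHnorm sigma p w v.

End weights.

(* Main.v *)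
Require Import Defs.
From mathcomp Require Import all_boot all_order all_algebra.
From mathcomp Require Import complex.
From mathcomp Require Import all_classical all_reals all_analysis.
From mathcomp Require Import measurable_realfun.
From mathcomp Require Import ring lra.
Import Order.TTheory GRing.Theory Num.Theory.
Import numFieldNormedType.Exports.
Set Implicit Arguments.
Unset Strict Implicit.
Unset Printing Implicit Defensive.
Local Open Scope classical_set_scope.
Local Open Scope ring_scope.

(* One test function suffices: a product v of one-dimensional bumps.  For k >= 2
   and x near 2^k e_1 the point x lies off the support of v and of its
   translates by the vectors (0, y'), so Lv(x) = 2^(-k sigma) v(x - 2^k e_1).
   Hence Lv has infinite L_p(w)-norm as soon as w >= c 2^(k sigma p) on unit
   boxes around the points 2^k e_1, while (1 - Delta)^(sigma/2) v decays faster
   than any power, so that its L_p(w)-norm is finite for w of polynomial growth.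

   Both weights have the form |x|^a u(x) with 0 <= a < d (p - 1) and u in A_1,
   which is an A_p weight.  For (a), a = l and u = 1.  For (b), no extrapolation
   is needed: as sigma < d one can take a = sigma (p - 1) and the spiked weight
   u(x) = sum_k 2^(k sigma) (1 + |x - 2^k e_1|)^(-b) with sigma < b < d; it is
   in A_1 because (1 + |x - z|)^(-b) is, with a constant independent of z.

   For the decay, (1 + |xi|^2)^(sigma/2) = (1 + |xi|^2) (1 + |xi|^2)^(-s) with
   s = 1 - sigma/2 > 0.  The first factor is absorbed by second derivatives of
   v, and the second one is a superposition of the Gaussians exp (- t |xi|^2),
   for which everything factors into one-dimensional integrals. *)

(** * Integration over R^n *)

(** The factor 2^(-k sigma) in Lv costs 2^(-k sigma p) in the p-th power; a weight of size 2^(k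
    sigma p) near 2^k e_1 just compensates it, so that each of infinitely many disjoint boxes
    contributes at least a fixed amount. A pure power of |x| has this size within A_p only if sigma
    p < d (p - 1), which fails for p close to 1. The spiked weight splits the exponent: |x|^(sigma
    (p - 1)) is admissible because sigma < d, and the missing 2^(k sigma) is needed only on the
    boxes, where the k-th spike supplies it. The bound b > sigma makes the sum of the spikes
    converge with polynomial growth, and b < d makes each spike an A_1 weight; both alternatives on
    d and sigma give sigma < d, which leaves room for b.

    Measurability of Lv and of the Bessel potential is never established. Their weighted norms are
    integrals of nonnegative functions, that is, suprema over simple functions, and are only
    compared with integrals of explicit functions, from below for Lv and from above for the
    potential; monotonicity is enough for that. *)

Section integral_nonmeasurable.
Context d (T : measurableType d) (R : realType).
Variable mu : {measure set T -> \bar R}.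
Local Open Scope ereal_scope.

(* The integral of a nonnegative function is a supremum over the simple
   functions below it, so monotonicity needs no measurability. *)
Lemma ge0_le_integral_nonmeas (D : set T) (f g : T -> \bar R) :
  (forall x, D x -> 0 <= f x) -> (forall x, D x -> f x <= g x) ->
  \int[mu]_(x in D) f x <= \int[mu]_(x in D) g x.
Proof.
move=> f0 fg; have g0 x : D x -> 0 <= g x.
  by move=> Dx; apply: le_trans (f0 _ Dx) (fg _ Dx).
rewrite !ge0_integralE//; apply: ereal_sup_le => _ [h hf <-].
exists h => // x; apply: le_trans (hf x) _; rewrite /patch; case: ifPn => //.
by rewrite inE => /fg.
Qed.

Lemma ge0_integral_subset_nonmeas (A B : set T) (f : T -> \bar R) :
  (forall x, B x -> 0 <= f x) -> A `<=` B ->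
  \int[mu]_(x in A) f x <= \int[mu]_(x in B) f x.
Proof.
move=> f0 AB; rewrite (integral_mkcond A) (integral_mkcond B).
apply: ge0_le_integral_nonmeas => x _; rewrite /patch.
  by case: ifPn => //; rewrite inE => /AB; exact: f0.
case: ifPn => [|_]; first by rewrite inE => /AB xB; rewrite mem_set.
by case: ifPn => //; rewrite inE; exact: f0.
Qed.

End integral_nonmeasurable.

Section rV_coordinates.
Context {R : realType} {n : nat}.

Lemma rv_cons0 (t : R) (x : 'rV[R]_n) : rv_cons (t, x) ord0 ord0 = t.
Proof. by have [] := congr1 fst (rv_consK (t, x)). Qed.

Lemma rv_consS (t : R) (x : 'rV[R]_n) j : rv_cons (t, x) ord0 (lift ord0 j) = x ord0 j.
Proof. by have /rowP/(_ j) := congr1 snd (rv_consK (t, x)); rewrite mxE. Qed.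

End rV_coordinates.

Section integral_rV.
Context {R : realType}.
Local Open Scope ereal_scope.
Local Notation mu1 := (@lebesgue_measure R).

Lemma ge0_integral_rV n (f : 'rV[R]_n.+1 -> \bar R) :
  measurable_fun setT f -> (forall x, 0 <= f x) ->
  \int[lebesgue_rV n.+1]_x f x =
  \int[mu1]_t \int[lebesgue_rV n]_x f (rv_cons (t, x)).
Proof.
move=> mf f0.
rewrite -(@fubini_tonelli1 _ _ _ _ R mu1 (lebesgue_rV n) (f \o rv_cons))//=; last first.
  exact: measurableT_comp mf (@measurable_rv_cons R n).
have := @ge0_integral_pushforward _ _ _ _ R _ (@measurable_rv_cons R n) (mu1 \x lebesgue_rV n) setT f.
by rewrite preimage_setT; apply.
Qed.

Lemma integral_rV n (f : 'rV[R]_n.+1 -> \bar R) :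
  measurable_fun setT f ->
  (mu1 \x lebesgue_rV n).-integrable setT (f \o rv_cons) ->
  \int[lebesgue_rV n.+1]_x f x = \int[mu1 \x lebesgue_rV n]_z f (rv_cons z).
Proof.
move=> mf intf.
have := @integral_pushforward _ _ _ _ R _ (@measurable_rv_cons R n) (mu1 \x lebesgue_rV n) setT f mf.
by rewrite preimage_setT => /(_ intf measurableT).
Qed.

Lemma integral_rV0 (f : 'rV[R]_0 -> \bar R) :
  \int[lebesgue_rV 0]_x f x = f 0%R.
Proof.
(* The space has a single point, so each of its subsets is empty or full and every function on it is
   measurable. *)
have mf : measurable_fun setT f.
  have mT (A : set 'rV[R]_0) : measurable A.
    have [->|/set0P[x Ax]] := eqVneq A set0; first exact: measurable0.
    rewrite (_ : A = setT)//; apply/seteqP; split => // y _.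
    by rewrite (_ : y = x)//; apply/rowP => -[].
  by move=> _ B mB; rewrite setTI; exact: mT.
by rewrite [LHS]integral_dirac// diracT mul1e.
Qed.

(** The ring is abstract because both real factors (bumps, majorants) and complex ones (their
    Fourier transforms) occur. Integrals of such products over R^n reduce to one-dimensional
    integrals. *)
Definition tens {T : comPzRingType} {n} (F : 'I_n -> R -> T) (x : 'rV[R]_n) : T :=
  (\prod_(i < n) F i (x ord0 i))%R.

Lemma tens_rv_cons {T : comPzRingType} n (F : 'I_n.+1 -> R -> T) t x :
  tens F (rv_cons (t, x)) = (F ord0 t * tens (fun j => F (lift ord0 j)) x)%R.
Proof.
rewrite /tens big_ord_recl rv_cons0; congr (_ * _)%R.
by apply: eq_bigr => j _; rewrite rv_consS.
Qed.

Lemma measurable_tens n (F : 'I_n -> R -> R) :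
  (forall i, measurable_fun setT (F i)) -> measurable_fun setT (tens F).
Proof.
move=> mF; apply: (@measurable_prod _ _ R setT _ (index_enum 'I_n)
  (fun i (x : 'rV[R]_n) => F i (x ord0 i))) => i _.
exact: measurableT_comp (mF i) (measurable_coord_rV i).
Qed.

Lemma ge0_integral_tens n (F : 'I_n -> R -> R) :
  (forall i, measurable_fun setT (F i)) -> (forall i t, 0 <= F i t)%R ->
  \int[lebesgue_rV n]_x (tens F x)%:E = \prod_(i < n) \int[mu1]_t (F i t)%:E.
Proof.
elim: n F => [|n IH] F mF F0.
  by rewrite integral_rV0 big_ord0 /tens big_ord0.
have t0 m (G : 'I_m -> R -> R) : (forall i t, 0 <= G i t)%R -> forall x, (0 <= tens G x)%R.
  by move=> G0 x; apply: prodr_ge0.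
rewrite ge0_integral_rV; last 2 first.
- by apply/measurable_EFinP; exact: measurable_tens.
- by move=> x; rewrite lee_fin t0.
rewrite big_ord_recl -IH//.
rewrite [RHS]muleC -ge0_integralZl//; last 3 first.
- by apply/measurable_EFinP; exact: (mF ord0).
- by move=> x _; rewrite lee_fin.
- by apply: integral_ge0 => x _; rewrite lee_fin t0.
apply: eq_integral => t _; rewrite muleC -ge0_integralZl_EFin//; last 2 first.
- by move=> x _; rewrite lee_fin t0.
- by apply/measurable_EFinP; exact: measurable_tens.
by apply: eq_integral => x _; rewrite tens_rv_cons EFinM.
Qed.

Lemma integrable_tens n (F : 'I_n -> R -> R) :
  (forall i, mu1.-integrable setT (EFin \o F i)) ->
  (lebesgue_rV n).-integrable setT (EFin \o tens F).
Proof.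
move=> iF; have mF i : measurable_fun setT (F i).
  by have /measurable_int/measurable_EFinP := iF i.
apply/integrableP; split; first by apply/measurable_EFinP; exact: measurable_tens.
rewrite (eq_integral (fun x => (tens (fun i t => `|F i t|%R) x)%:E)); last first.
  by move=> x _ /=; rewrite /tens normr_prod.
rewrite ge0_integral_tens//; last by move=> i; exact: measurableT_comp.
have : forall i, (\int[mu1]_t (`|F i t|%R)%:E) \is a fin_num.
  move=> i; have /integrableP[_] := iF i.
  by rewrite ge0_fin_numE//; apply: integral_ge0 => t _; rewrite lee_fin.
move=> fn; rewrite (eq_bigr (fun i => (fine (\int[mu1]_t (`|F i t|%R)%:E))%:E)).
  by rewrite prodEFin ltry.
by move=> i _; rewrite fineK.
Qed.

End integral_rV.

(** * Complex-valued integrals *)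

Section integrable_dominated.
Context d (T : measurableType d) (R : realType).
Variable mu : {measure set T -> \bar R}.

Lemma integrable_dom (f g : T -> R) : measurable_fun setT f ->
  mu.-integrable setT (EFin \o g) -> (forall x, `|f x| <= g x) ->
  mu.-integrable setT (EFin \o f).
Proof.
move=> mf ig fg; apply: le_integrable ig => //; first exact/measurable_EFinP.
by move=> x _ /=; rewrite lee_fin (le_trans (fg x))// ler_norm.
Qed.

Lemma EFin_Rintegral (f : T -> R) : mu.-integrable setT (EFin \o f) ->
  (\int[mu]_x f x)%:E = (\int[mu]_x (f x)%:E)%E.
Proof. by move=> intf; rewrite /Rintegral fineK//; exact: integrable_fin_num. Qed.

Lemma le_norm_Rintegral_dom (f g : T -> R) :
  measurable_fun setT f -> mu.-integrable setT (EFin \o g) ->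
  (forall x, `|f x| <= g x) -> `|\int[mu]_x f x| <= \int[mu]_x g x.
Proof.
move=> mf ig fg; have intf := integrable_dom mf ig fg.
apply: le_trans (le_normr_Rintegral _ intf) _ => //.
by apply: le_Rintegral => //; exact: integrable_norm.
Qed.

End integrable_dominated.

Section Rfubini.
Context d1 d2 (T1 : measurableType d1) (T2 : measurableType d2) (R : realType).
Variable m1 : {sigma_finite_measure set T1 -> \bar R}.
Variable m2 : {sigma_finite_measure set T2 -> \bar R}.
Variables (f : T1 * T2 -> R) (a : T1 -> R) (b : T2 -> R).
Hypothesis mf : measurable_fun setT f.
Hypothesis ia : m1.-integrable setT (EFin \o a).
Hypothesis ib : m2.-integrable setT (EFin \o b).
Hypothesis fab : forall x y, `|f (x, y)| <= a x * b y.

Let mfx x : measurable_fun setT (fun y => f (x, y)).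
Proof. exact: measurableT_comp mf (pair1_measurable x). Qed.

Let mfy y : measurable_fun setT (fun x => f (x, y)).
Proof. exact: measurableT_comp mf (pair2_measurable y). Qed.

(** Domination by a product makes every section integrable, not just almost every one, so that the
    real-valued inner integral agrees everywhere with the extended one. *)
Lemma Rfubini_integrable_fst x : m2.-integrable setT (EFin \o (fun y => f (x, y))).
Proof.
apply: (integrable_dom _ (g := fun y => a x * b y)) => //.
exact: (integrableZl measurableT (a x) ib).
Qed.

Lemma Rfubini_integrable_snd y : m1.-integrable setT (EFin \o (fun x => f (x, y))).
Proof.
apply: (integrable_dom _ (g := fun x => a x * b y)) => //.
rewrite (_ : _ \o _ = fun x => ((b y)%:E * (EFin \o a) x)%E); first exact: integrableZl.
by apply/funext => x /=; rewrite -EFinM mulrC.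
Qed.

Lemma Rfubini_integrable : (m1 \x m2)%E.-integrable setT (EFin \o f).
Proof.
apply/integrable12ltyP; first exact/measurable_EFinP.
apply: (@le_lt_trans _ _ (\int[m1]_x ((`|a x| * \int[m2]_y `|b y|)%:E))%E).
  apply: ge0_le_integral_nonmeas => x _; first exact: integral_ge0.
  rewrite -RintegralZl//; last exact: integrable_norm.
  rewrite EFin_Rintegral//; last first.
    exact: (integrableZl measurableT `|a x| (integrable_norm ib)).
  apply: ge0_le_integral_nonmeas => y _ //=.
  by rewrite lee_fin (le_trans (fab _ _))// -normrM ler_norm.
have /integrable_norm ia' := ia.
rewrite (eq_integral (fun x => (\int[m2]_y `|b y|)%:E * (`|a x|)%:E)%E); last first.
  by move=> x _; rewrite EFinM muleC.
rewrite integralZl//; rewrite lte_mul_pinfty//; first by rewrite lee_fin Rintegral_ge0.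
by have /integrableP[_] := ia.
Qed.

Lemma Rfubini1 : \int[m1]_x \int[m2]_y f (x, y) = \int[(m1 \x m2)%E]_z f z.
Proof.
rewrite /Rintegral -integral12_prod_meas1; last exact: Rfubini_integrable.
congr fine; apply: eq_integral => x _.
exact: EFin_Rintegral (Rfubini_integrable_fst x).
Qed.

Lemma Rfubini2 : \int[m2]_y \int[m1]_x f (x, y) = \int[(m1 \x m2)%E]_z f z.
Proof.
rewrite /Rintegral -integral21_prod_meas1; last exact: Rfubini_integrable.
congr fine; apply: eq_integral => y _.
exact: EFin_Rintegral (Rfubini_integrable_snd y).
Qed.

Lemma measurable_Rfubini_fst : measurable_fun setT (fun x => \int[m2]_y f (x, y)).
Proof.
apply/measurable_EFinP; apply: eq_measurable_fun (measurable_fubini_F Rfubini_integrable) => x _.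
by rewrite /= EFin_Rintegral//; exact: Rfubini_integrable_fst.
Qed.

End Rfubini.

Section complex_integral.
Local Open Scope complex_scope.
Context d (T : measurableType d) (R : realType).
Variable mu : {measure set T -> \bar R}.
Implicit Types (f : T -> R[i]) (g : T -> R).

(** [cintegral] is, up to conversion, the case of [lebesgue_rV n]; integrals over the line and over
    product spaces are needed as well. *)
Definition cint f : R[i] :=
  (\int[mu]_x complex.Re (f x)) +i* (\int[mu]_x complex.Im (f x)).

Definition cmeasurable f := measurable_fun setT (@complex.Re R \o f) /\
  measurable_fun setT (@complex.Im R \o f).

Definition cintegrable f := mu.-integrable setT (EFin \o (@complex.Re R \o f)) /\
  mu.-integrable setT (EFin \o (@complex.Im R \o f)).

Lemma cmeasurableM f1 f2 : cmeasurable f1 -> cmeasurable f2 ->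
  cmeasurable (fun x => f1 x * f2 x).
Proof.
move=> [m1 m2] [m3 m4]; split.
  rewrite (_ : _ \o _ = (@complex.Re R \o f1) \* (@complex.Re R \o f2) \- (@complex.Im R \o f1) \* (@complex.Im R \o f2)).
    by apply: measurable_funB; apply: measurable_funM.
  by apply/funext => x /=; case: (f1 x) (f2 x) => [a b] [c e].
rewrite (_ : _ \o _ = (@complex.Re R \o f1) \* (@complex.Im R \o f2) \+ (@complex.Im R \o f1) \* (@complex.Re R \o f2)).
  by apply: measurable_funD; apply: measurable_funM.
by apply/funext => x /=; case: (f1 x) (f2 x) => [a b] [c e].
Qed.

Lemma cmeasurable_real g : measurable_fun setT g -> cmeasurable (fun x => (g x)%:C).
Proof. by move=> mg; split => //=; exact: measurable_cst. Qed.

Lemma cmeasurable_cst (c : R[i]) : cmeasurable (fun=> c).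
Proof. by split; exact: measurable_cst. Qed.

Lemma cmeasurable_cis g : measurable_fun setT g -> cmeasurable (fun x => cis (g x)).
Proof.
move=> mg; split.
  exact: (measurableT_comp (continuous_measurable_fun (@continuous_cos R)) mg).
exact: (measurableT_comp (continuous_measurable_fun (@continuous_sin R)) mg).
Qed.

End complex_integral.

Section normc.
Local Open Scope complex_scope.
Context {R : realType}.
Implicit Types z : R[i].

Lemma normc_ge0 z : 0 <= Normc.normc z.
Proof. by case: z => a b; rewrite sqrtr_ge0. Qed.

Lemma normRe_le_normc z : `|complex.Re z| <= Normc.normc z.
Proof.
case: z => a b /=; rewrite -(sqrtr_sqr a) ler_wsqrtr// lerDl sqr_ge0//.
Qed.

Lemma normIm_le_normc z : `|complex.Im z| <= Normc.normc z.
Proof.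
case: z => a b /=; rewrite -(sqrtr_sqr b) ler_wsqrtr// lerDr sqr_ge0//.
Qed.

Lemma normc_real (x : R) : Normc.normc x%:C = `|x|.
Proof. by rewrite /= expr0n addr0 sqrtr_sqr. Qed.

Lemma normc_cis (t : R) : Normc.normc (cis t) = 1.
Proof. by rewrite /= cos2Dsin2 sqrtr1. Qed.

Lemma normc_le_ReIm z : Normc.normc z <= `|complex.Re z| + `|complex.Im z|.
Proof.
case: z => a b /=; rewrite -ler_sqr ?nnegrE ?sqrtr_ge0 ?addr_ge0//.
rewrite sqr_sqrtr ?addr_ge0 ?sqr_ge0// sqrrD !real_normK ?num_real//.
by rewrite lerD2r lerDl mulrn_wge0// mulr_ge0.
Qed.

Lemma normc_prod I (s : seq I) (F : I -> R[i]) :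
  Normc.normc (\prod_(i <- s) F i) = \prod_(i <- s) Normc.normc (F i).
Proof.
elim: s => [|i s IH]; first by rewrite !big_nil Normc.normc1.
by rewrite !big_cons Normc.normcM IH.
Qed.

Lemma normc_sum I (s : seq I) (F : I -> R[i]) :
  Normc.normc (\sum_(i <- s) F i) <= \sum_(i <- s) Normc.normc (F i).
Proof.
elim: s => [|i s IH]; first by rewrite !big_nil Normc.normc0.
by rewrite !big_cons (le_trans (le_normcD _ _))// lerD2l.
Qed.

Lemma cisD (s t : R) : cis (s + t) = cis s * cis t.
Proof. by rewrite /cis cosD sinD; congr (_ +i* _); rewrite [in RHS]addrC. Qed.

Lemma cis0 : cis 0 = 1 :> R[i].
Proof. by rewrite /cis cos0 sin0. Qed.

Lemma cis_sum I (s : seq I) (F : I -> R) :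
  cis (\sum_(i <- s) F i) = \prod_(i <- s) cis (F i).
Proof.
elim: s => [|i s IH]; first by rewrite !big_nil cis0.
by rewrite !big_cons cisD IH.
Qed.

End normc.

Section complex_integral_theory.
Local Open Scope complex_scope.
Context d (T : measurableType d) (R : realType).
Variable mu : {measure set T -> \bar R}.
Implicit Types (f : T -> R[i]) (g : T -> R).

Lemma cintegrable_dom f g : cmeasurable f -> mu.-integrable setT (EFin \o g) ->
  (forall x, Normc.normc (f x) <= g x) -> cintegrable mu f.
Proof.
move=> [mr mi] ig fg; split; (apply: integrable_dom ig _ => // x /=;
  apply: le_trans (fg x)); [exact: normRe_le_normc|exact: normIm_le_normc].
Qed.

(** Real and imaginary parts are estimated separately, which costs the factor 2. *)
Lemma normc_cint f g : cmeasurable f -> mu.-integrable setT (EFin \o g) ->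
  (forall x, Normc.normc (f x) <= g x) -> Normc.normc (cint mu f) <= 2 * \int[mu]_x g x.
Proof.
move=> [mr mi] ig fg; apply: le_trans (normc_le_ReIm _) _.
rewrite mulr2n mulrDl mul1r; apply: lerD; apply: le_norm_Rintegral_dom => // x;
  apply: le_trans (fg x); [exact: normRe_le_normc|exact: normIm_le_normc].
Qed.

Lemma cintZl (c : R[i]) f : cintegrable mu f ->
  cint mu (fun x => c * f x) = c * cint mu f.
Proof.
move=> [ir ii]; case: c => a b; rewrite /cint.
have -> : (fun x => complex.Re ((a +i* b) * f x)) =
    (fun x => a * (complex.Re (f x)) - b * complex.Im (f x)).
  by apply/funext => x; case: (f x).
have -> : (fun x => complex.Im ((a +i* b) * f x)) =
    (fun x => a * (complex.Im (f x)) + b * complex.Re (f x)).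
  by apply/funext => x; case: (f x).
have ir' k : mu.-integrable setT (EFin \o (fun x => k * complex.Re (f x))).
  exact: (integrableZl measurableT k ir).
have ii' k : mu.-integrable setT (EFin \o (fun x => k * complex.Im (f x))).
  exact: (integrableZl measurableT k ii).
rewrite (RintegralB measurableT (ir' a) (ii' b)) (RintegralD measurableT (ii' a) (ir' b)).
by rewrite !RintegralZl.
Qed.

Lemma cintegrableZl (c : R[i]) f : cintegrable mu f -> cintegrable mu (fun x => c * f x).
Proof.
move=> [ir ii]; case: c => a b; split.
  rewrite (_ : _ \o _ = (fun x => a%:E * ((EFin \o (@complex.Re R \o f)) x)) \-
     (fun x => b%:E * ((EFin \o (@complex.Im R \o f)) x)))%E.
    by apply: integrableB => //; apply: integrableZl.
  by apply/funext => x /=; case: (f x).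
rewrite (_ : _ \o _ = (fun x => a%:E * ((EFin \o (@complex.Im R \o f)) x)) \+
     (fun x => b%:E * ((EFin \o (@complex.Re R \o f)) x)))%E.
  by apply: integrableD => //; apply: integrableZl.
by apply/funext => x /=; case: (f x).
Qed.

Lemma cintD f1 f2 : cintegrable mu f1 -> cintegrable mu f2 ->
  cint mu (fun x => f1 x + f2 x) = cint mu f1 + cint mu f2.
Proof.
move=> [r1 i1] [r2 i2]; rewrite /cint.
have -> : (fun x => complex.Re (f1 x + f2 x)) =
    (fun x => complex.Re (f1 x) + complex.Re (f2 x)).
  by apply/funext => x; case: (f1 x); case: (f2 x).
have -> : (fun x => complex.Im (f1 x + f2 x)) =
    (fun x => complex.Im (f1 x) + complex.Im (f2 x)).
  by apply/funext => x; case: (f1 x); case: (f2 x).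
by rewrite !RintegralD.
Qed.

Lemma cintegrableD f1 f2 : cintegrable mu f1 -> cintegrable mu f2 ->
  cintegrable mu (fun x => f1 x + f2 x).
Proof.
move=> [r1 i1] [r2 i2]; split.
  rewrite (_ : _ \o _ = (EFin \o (@complex.Re R \o f1)) \+ (EFin \o (@complex.Re R \o f2)))%E.
    exact: integrableD.
  by apply/funext => x /=; case: (f1 x); case: (f2 x).
rewrite (_ : _ \o _ = (EFin \o (@complex.Im R \o f1)) \+ (EFin \o (@complex.Im R \o f2)))%E.
  exact: integrableD.
by apply/funext => x /=; case: (f1 x); case: (f2 x).
Qed.

Lemma cint0 : cint mu (fun=> 0) = 0.
Proof. by rewrite /cint /= /Rintegral integral0. Qed.

Lemma cintegrable0 : cintegrable mu (fun=> 0).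
Proof. by split; exact: integrable0. Qed.

(** Value and integrability are proved together: the inductive step for the first uses the
    second. *)
Lemma cint_sum I (s : seq I) (F : I -> T -> R[i]) : (forall i, cintegrable mu (F i)) ->
  cint mu (fun x => \sum_(i <- s) F i x) = \sum_(i <- s) cint mu (F i) /\
  cintegrable mu (fun x => \sum_(i <- s) F i x).
Proof.
move=> iF; elim: s => [|i s [IH1 IH2]].
  rewrite big_nil (_ : (fun x => _) = fun=> 0); last by apply/funext => x; rewrite big_nil.
  by split; [exact: cint0|exact: cintegrable0].
rewrite big_cons.
have -> : (fun x => \sum_(j <- i :: s) F j x) = (fun x => F i x + \sum_(j <- s) F j x).
  by apply/funext => x; rewrite big_cons.
by split; [rewrite cintD// IH1|exact: cintegrableD].
Qed.

End complex_integral_theory.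

Section complex_fubini.
Local Open Scope complex_scope.
Context d1 d2 (T1 : measurableType d1) (T2 : measurableType d2) (R : realType).
Variable m1 : {sigma_finite_measure set T1 -> \bar R}.
Variable m2 : {sigma_finite_measure set T2 -> \bar R}.
Variables (f : T1 * T2 -> R[i]) (a : T1 -> R) (b : T2 -> R).
Hypothesis mf : cmeasurable f.
Hypothesis ia : m1.-integrable setT (EFin \o a).
Hypothesis ib : m2.-integrable setT (EFin \o b).
Hypothesis fab : forall x y, Normc.normc (f (x, y)) <= a x * b y.

Let re_le x y : `|complex.Re (f (x, y))| <= a x * b y.
Proof. exact: le_trans (normRe_le_normc _) (fab x y). Qed.

Let im_le x y : `|complex.Im (f (x, y))| <= a x * b y.
Proof. exact: le_trans (normIm_le_normc _) (fab x y). Qed.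

Lemma cfubini1 : cint m1 (fun x => cint m2 (fun y => f (x, y))) = cint (m1 \x m2)%E f.
Proof.
have [mr mi] := mf.
have h1 := @Rfubini1 _ _ _ _ _ m1 m2 _ a b mr ia ib re_le.
have h2 := @Rfubini1 _ _ _ _ _ m1 m2 _ a b mi ia ib im_le.
by rewrite [RHS]/cint /= -h1 -h2.
Qed.

Lemma cfubini2 : cint m2 (fun y => cint m1 (fun x => f (x, y))) = cint (m1 \x m2)%E f.
Proof.
have [mr mi] := mf.
have h1 := @Rfubini2 _ _ _ _ _ m1 m2 _ a b mr ia ib re_le.
have h2 := @Rfubini2 _ _ _ _ _ m1 m2 _ a b mi ia ib im_le.
by rewrite [RHS]/cint /= -h1 -h2.
Qed.

Lemma cfubini : cint m1 (fun x => cint m2 (fun y => f (x, y))) =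
  cint m2 (fun y => cint m1 (fun x => f (x, y))).
Proof. by rewrite cfubini1 cfubini2. Qed.

Lemma cmeasurable_cfubini_fst : cmeasurable (fun x => cint m2 (fun y => f (x, y))).
Proof.
have [mr mi] := mf; split.
  exact: (@measurable_Rfubini_fst _ _ _ _ _ m1 m2 _ a b mr ia ib re_le).
exact: (@measurable_Rfubini_fst _ _ _ _ _ m1 m2 _ a b mi ia ib im_le).
Qed.

Lemma cintegrable_prod : cintegrable (m1 \x m2)%E f.
Proof.
have [mr mi] := mf; split.
  exact: (@Rfubini_integrable _ _ _ _ _ m1 m2 _ a b mr ia ib re_le).
exact: (@Rfubini_integrable _ _ _ _ _ m1 m2 _ a b mi ia ib im_le).
Qed.

End complex_fubini.

Section complex_tensor.
Local Open Scope complex_scope.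
Context {R : realType}.
Local Notation mu1 := (@lebesgue_measure R).

Lemma cmeasurable_tens n (F : 'I_n -> R -> R[i]) :
  (forall i, @cmeasurable _ (measurableTypeR R) R (F i)) -> cmeasurable (tens F).
Proof.
move=> mF; rewrite /tens.
elim: (index_enum _) => [|i s IH].
  under eq_fun do rewrite big_nil; exact: cmeasurable_cst.
under eq_fun do rewrite big_cons; apply: cmeasurableM => //.
by split; [have [h _] := mF i|have [_ h] := mF i];
  exact: (measurableT_comp h (@measurable_coord_rV R n i)).
Qed.

Lemma cint_rV n (f : 'rV[R]_n.+1 -> R[i]) :
  cmeasurable f -> cintegrable (mu1 \x lebesgue_rV n)%E (f \o rv_cons) ->
  cintegral f = cint (mu1 \x lebesgue_rV n)%E (f \o rv_cons).
Proof.
move=> [mr mi] [ir ii]; rewrite /cintegral /cint /Rintegral.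
by rewrite !integral_rV//; apply/measurable_EFinP.
Qed.

(** The bounds [b] provide the dominating product that Fubini requires at each step of the induction
    on the dimension. *)
Lemma cintegral_tens n (F : 'I_n -> R -> R[i]) (b : 'I_n -> R -> R) :
  (forall i, @cmeasurable _ (measurableTypeR R) R (F i)) ->
  (forall i, mu1.-integrable setT (EFin \o b i)) ->
  (forall i t, Normc.normc (F i t) <= b i t) ->
  cintegral (tens F) = \prod_(i < n) cint mu1 (F i).
Proof.
elim: n F b => [|n IH] F b mF ib Fb.
  rewrite /cintegral /Rintegral !integral_rV0 big_ord0 /tens /=.
  by rewrite !big_ord0.
have mT := cmeasurable_tens mF.
have it : (lebesgue_rV n).-integrable setT (EFin \o tens (fun j => b (lift ord0 j))).
  exact: integrable_tens.
have Tb t x : Normc.normc ((tens F \o rv_cons) (t, x)) <=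
    b ord0 t * tens (fun j => b (lift ord0 j)) x.
  rewrite /= tens_rv_cons Normc.normcM ler_pM ?normc_ge0//.
  rewrite /tens normc_prod ler_prod// => j _; rewrite normc_ge0/=; exact: Fb.
have mTc : cmeasurable (tens F \o rv_cons).
  by have [h1 h2] := mT; split; [exact: (measurableT_comp h1 (@measurable_rv_cons R n))|
    exact: (measurableT_comp h2 (@measurable_rv_cons R n))].
rewrite cint_rV//; last exact: cintegrable_prod (ib _) it Tb.
rewrite -(cfubini2 mTc (ib _) it Tb)/= big_ord_recl.
have E x : cint mu1 (fun t => tens F (rv_cons (t, x))) =
   cint mu1 (F ord0) * tens (fun j => F (lift ord0 j)) x.
  rewrite mulrC -cintZl; last exact: (@cintegrable_dom _ (measurableTypeR R) R mu1 _ _ (mF ord0) (ib ord0) (Fb ord0)).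
  by congr cint; apply/funext => t; rewrite tens_rv_cons mulrC.
rewrite (_ : (fun y => _) = (fun x => cint mu1 (F ord0) * tens (fun j => F (lift ord0 j)) x)); last exact/funext.
rewrite cintZl; last first.
  apply: cintegrable_dom it _; first exact: cmeasurable_tens.
  by move=> x; rewrite /tens normc_prod ler_prod// => j _; rewrite normc_ge0/=; exact: Fb.
by congr (_ * _); rewrite -(IH _ (fun j => b (lift ord0 j))).
Qed.

End complex_tensor.

(** * Flat exponentials and bump functions *)

Section exp_bounds.
Context {R : realType}.

Lemma exprn_le_expR (x : R) k : 0 <= x -> x ^+ k <= k`!%:R * expR x.
Proof.
move=> x0; case: k => [|k].
  by rewrite expr0 fact0 mul1r -expR0 ler_expR.
have := expR_ge1Dxn k x0; have f0 : (0 : R) < k.+1`!%:R by rewrite ltr0n fact_gt0.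
move=> h; rewrite mulrC -ler_pdivrMr//; apply: le_trans _ h; by rewrite lerDr.
Qed.

Lemma horner_expRN_bounded (P : {poly R}) :
  exists2 C : R, 0 <= C & forall x, 0 <= x -> `|P.[x]| * expR (- x) <= C.
Proof.
exists (\sum_(i < size P) `|P`_i| * i`!%:R).
  by apply: sumr_ge0 => i _; rewrite mulr_ge0.
move=> x x0; rewrite horner_coef expRN -/(_ / _) ler_pdivrMr ?expR_gt0//.
apply: le_trans (ler_norm_sum _ _ _) _; rewrite mulr_suml ler_sum// => i _.
rewrite normrM -mulrA ler_wpM2l// ger0_norm ?exprn_ge0//.
exact: exprn_le_expR.
Qed.

End exp_bounds.

Section flatexp.
Context {R : realType}.
Implicit Types P Q : {poly R}.

(** The classical flat functions P(1/u) exp (- 1/u), extended by 0. Allowing a polynomial P makes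
    the family stable under derivation. *)
Definition flatexp P (u : R) : R := if 0 < u then P.[u^-1] * expR (- u^-1) else 0.

Lemma flatexp_le0 P u : u <= 0 -> flatexp P u = 0.
Proof. by rewrite /flatexp ltNge => ->. Qed.

Lemma flatexp_bounded P : exists2 C : R, 0 <= C & forall u, `|flatexp P u| <= C.
Proof.
have [C C0 h] := horner_expRN_bounded P; exists C => // u; rewrite /flatexp.
case: ifPn => u0; last by rewrite normr0.
by rewrite normrM (ger0_norm (expR_ge0 _)) h// invr_ge0 ltW.
Qed.

(** The boundedness of P(1/u) exp (- 1/u) applied to X P gains a factor u. This yields continuity at
    0 of the difference quotients. *)
Lemma flatexp_le_norm P : exists2 C : R, 0 <= C & forall u, `|flatexp P u| <= C * `|u|.
Proof.
have [C C0 h] := flatexp_bounded ('X * P); exists C => // u.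
have [u0|u0] := leP u 0; first by rewrite flatexp_le0// normr0 mulr_ge0.
rewrite -ler_pdivrMr ?normr_gt0 ?gt_eqF// -normrV ?unitfE ?gt_eqF// -normrM.
apply: le_trans (h u); rewrite le_eqVlt; apply/orP; left; apply/eqP; congr `|_|.
by rewrite /flatexp u0 hornerM hornerX; ring.
Qed.

(** The derivative of P(1/u) exp (- 1/u) is u^(-2) (P - P')(1/u) exp (- 1/u). *)
Definition dflat P : {poly R} := 'X ^+ 2 * (P - P^`()).

Lemma is_derive_flatexp P (u : R) : is_derive u 1 (flatexp P) (flatexp (dflat P) u).
Proof.
have [u0|u0|->] := ltgtP u 0.
- rewrite flatexp_le0 ?ltW//; apply: (@near_eq_is_derive _ _ _ (cst 0)).
  near=> y; rewrite flatexp_le0// ltW//; near: y; exact: lt_nbhsl.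
- have nE : \near u, P.[u^-1] * expR (- u^-1) = flatexp P u.
    near=> y; rewrite /flatexp ifT//; near: y; exact: lt_nbhsr.
  have dV : is_derive u 1 (fun y : R => y^-1) (- u ^- 2).
    apply: trigger_derive (is_deriveV _ (is_derive_id u 1)) _; first by rewrite gt_eqF.
    by rewrite /GRing.scale/= mulr1.
  have dN : is_derive u 1 (fun y : R => - y^-1) (u ^- 2).
    by apply: trigger_derive (is_deriveN dV) _; rewrite opprK.
  have d1 := @is_derive1_comp R (horner P) _ u _ _ (is_derive_poly P u^-1) dV.
  have d2 := @is_derive1_comp R expR _ u _ _ (is_derive_expR (- u^-1)) dN.
  apply: near_eq_is_derive nE _; apply: trigger_derive (is_deriveM d1 d2) _.
  rewrite /flatexp u0 /dflat /GRing.scale/= hornerM hornerXn hornerD hornerN exprVn; ring.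
(* The difference quotient of P(1/u) exp (- 1/u) at 0 is the flat function of X P, which tends to
   0. *)
- apply/is_derive1_caratheodory; exists (flatexp ('X * P)); split.
  + move=> z; rewrite [flatexp P 0]flatexp_le0// !subr0 /flatexp.
    case: ifPn => [z0|_]; last by rewrite mul0r.
    by rewrite hornerM hornerX; field; rewrite gt_eqF.
  + have [C C0 h] := flatexp_le_norm ('X * P).
    suff : flatexp ('X * P) z @[z --> (0:R)] --> (0:R) by rewrite /prop_for /continuous_at (@flatexp_le0 _ 0).
    apply/cvgr0Pnorm_le => e e0; have e1 : 0 < e / (C + 1) by rewrite divr_gt0// ltr_wpDl.
    near=> z.
    apply: le_trans (h z) _.
    have : `|z| <= e / (C + 1) by near: z; exact: (@nbhs0_le R R^o).
    rewrite ler_pdivlMr ?ltr_wpDl// => /(le_trans _); apply.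
    by rewrite mulrC ler_wpM2l// lerDl.
  + by rewrite !flatexp_le0.
Unshelve. all: by end_near. Qed.

(** By the Leibniz rule the derivative of one product is a sum of two, so the class is closed under
    sums in order to be closed under derivation. All its members vanish outside ]-1, 1[. *)
Inductive bumpc : (R -> R) -> Prop :=
| Bumpc_base P Q : bumpc (fun t => flatexp P (1 - t) * flatexp Q (1 + t))
| Bumpc_add f g : bumpc f -> bumpc g -> bumpc (f \+ g).

Lemma flatexpN P u : flatexp (- P) u = - flatexp P u.
Proof. by rewrite /flatexp; case: ifP; rewrite ?oppr0// hornerN mulNr. Qed.

Lemma bumpc_derive f : bumpc f ->
  exists2 f', bumpc f' & forall t : R, is_derive t 1 f (f' t).
Proof.
elim=> [P Q|{}f g _ [f' bf' df] _ [g' bg' dg]]; last first.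
  exists (f' \+ g'); first exact: Bumpc_add.
  by move=> t; exact: is_deriveD.
exists ((fun t => flatexp (- dflat P) (1 - t) * flatexp Q (1 + t)) \+
        (fun t => flatexp P (1 - t) * flatexp (dflat Q) (1 + t))).
  by apply: Bumpc_add; exact: Bumpc_base.
move=> t.
have d1 : is_derive t 1 (fun t : R => 1 - t) (-1).
  have := is_deriveD (is_derive_cst (1 : R) t (1 : R)) (is_deriveNid t (1 : R)).
  by rewrite add0r.
have d2 : is_derive t 1 (fun t : R => 1 + t) 1.
  have := is_deriveD (is_derive_cst (1 : R) t (1 : R)) (is_derive_id t (1 : R)).
  by rewrite add0r.
have e1 := @is_derive1_comp R (flatexp P) (fun t => 1 - t) t _ _ (is_derive_flatexp P (1 - t)) d1.
have e2 := @is_derive1_comp R (flatexp Q) (fun t => 1 + t) t _ _ (is_derive_flatexp Q (1 + t)) d2.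
apply: trigger_derive (is_deriveM e1 e2) _.
by rewrite /GRing.scale/= flatexpN; ring.
Qed.

Lemma bumpc_supp f t : bumpc f -> 1 <= `|t| -> f t = 0.
Proof.
elim=> [P Q|{}f g _ + _ +] t1; last by move=> /= -> // ->//; rewrite addr0.
have [t0|t0] := leP 0 t.
  by rewrite flatexp_le0 ?mul0r// subr_le0 -(ger0_norm t0).
rewrite [flatexp Q _]flatexp_le0 ?mulr0//.
by move: t1; rewrite ltr0_norm// => ?; lra.
Qed.

Lemma bumpc_bounded f : bumpc f -> exists2 C : R, 0 <= C & forall t, `|f t| <= C.
Proof.
elim=> [P Q|{}f g _ [C C0 h] _ [D D0 k]].
  have [C C0 h] := flatexp_bounded P; have [D D0 k] := flatexp_bounded Q.
  by exists (C * D); rewrite ?mulr_ge0// => t; rewrite normrM ler_pM.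
exists (C + D); rewrite ?addr_ge0// => t.
by rewrite (le_trans (ler_normD _ _))// lerD.
Qed.

Lemma bumpc_continuous f : bumpc f -> continuous f.
Proof.
move=> /bumpc_derive[f' _ df] t.
by apply/differentiable_continuous/derivable1_diffP; have [] := df t.
Qed.

Lemma bumpc_measurable f : bumpc f -> measurable_fun setT f.
Proof. by move=> /bumpc_continuous; exact: continuous_measurable_fun. Qed.

Lemma bumpc_le_indic f : bumpc f ->
  exists2 C : R, 0 <= C & forall t, `|f t| <= C * \1_(`[-1, 1]) t.
Proof.
move=> bf; have [C C0 h] := bumpc_bounded bf; exists C => // t.
rewrite indicE; case: (boolP (t \in _)) => tI; first by rewrite mulr1.
rewrite (bumpc_supp bf) ?normr0 ?mulr0//; move: tI; rewrite notin_setE/= in_itv/=.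
by move=> /negP; apply: contraNT; rewrite -ltNge ltr_norml => /andP[/ltW -> /ltW ->].
Qed.

Lemma bumpc_integrable f : bumpc f ->
  (@lebesgue_measure R).-integrable setT (EFin \o f).
Proof.
move=> bf; have [C C0 h] := bumpc_le_indic bf.
apply: (@integrable_dom _ (measurableTypeR R) R _ _ _ _ _ h).
  exact: bumpc_measurable.
have i1 := @integrable_indic_itv R (-1) 1 true false.
exact: (integrableZl measurableT C i1).
Qed.

(** This is exp (- 2 / (1 - t^2)) on ]-1, 1[ and 0 elsewhere. *)
Definition bumpf (t : R) : R := flatexp 1 (1 - t) * flatexp 1 (1 + t).

Lemma bumpc_bump : bumpc bumpf. Proof. exact: Bumpc_base. Qed.

Lemma flatexp1_ge0 (u : R) : 0 <= flatexp 1 u.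
Proof. by rewrite /flatexp; case: ifP => // _; rewrite hornerE mul1r expR_ge0. Qed.

Lemma bump_ge0 t : 0 <= bumpf t.
Proof. by rewrite mulr_ge0// flatexp1_ge0. Qed.

(** Both 1 - t and 1 + t are at least 1/2, so each of the two factors is at least exp (- 2). *)
Lemma bump_ge_expR t : `|t| <= 1 / 2 -> expR (- 4) <= bumpf t.
Proof.
move=> /ler_normlP[t1 t2]; rewrite (_ : - 4 = - 2 + - 2); last by lra.
have h u : 1 / 2 <= u -> expR (- 2) <= flatexp 1 u.
  move=> u1; have u0 : 0 < u by lra.
  rewrite /flatexp u0 hornerE mul1r ler_expR lerN2 -[leRHS]invrK lef_pV2 ?posrE ?invr_gt0//.
  lra.
by rewrite expRD ler_pM ?expR_ge0// h//; lra.
Qed.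

End flatexp.

(** * The Fourier transform of a Gaussian *)

Section whole_line.
Context {R : realType}.
Local Notation mu1 := (@lebesgue_measure R).

Lemma oneDsqr_gt0 (x : R) : 0 < 1 + x ^+ 2.
Proof. by rewrite ltr_pwDl// sqr_ge0. Qed.

Lemma inv1Dsqr_ge0 (x : R) : 0 <= (1 + x ^+ 2)^-1.
Proof. by rewrite invr_ge0 ltW// oneDsqr_gt0. Qed.

Lemma continuous_inv1Dsqr : continuous (fun x : R => (1 + x ^+ 2)^-1).
Proof. exact: continuous_oneDsqrV. Qed.

Lemma integrable_inv1Dsqr : mu1.-integrable setT (EFin \o (fun x : R => (1 + x ^+ 2)^-1)).
Proof.
apply/integrableP; split.
  by apply/measurable_EFinP; exact: continuous_measurable_fun continuous_inv1Dsqr.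
under eq_integral do rewrite /= ger0_norm ?inv1Dsqr_ge0//.
rewrite ge0_symfun_integralT; last 3 first.
- exact: inv1Dsqr_ge0.
- exact: continuous_inv1Dsqr.
- by move=> x /=; rewrite sqrrN.
have := @integral0y_oneDsqr R; rewrite set_itvcy => ->.
by rewrite ltry.
Qed.

Lemma integrable_dom_inv1Dsqr (f : R -> R) (c : R) : measurable_fun setT f ->
  (forall x, `|f x| <= c * (1 + x ^+ 2)^-1) -> mu1.-integrable setT (EFin \o f).
Proof.
move=> mf h; apply: (@integrable_dom _ (measurableTypeR R) R _ _ _ mf _ h).
exact: (integrableZl measurableT c integrable_inv1Dsqr).
Qed.

Lemma Rintegral_derive_itv (F F' : R -> R) (a b : R) : a < b ->
  (forall x : R, is_derive x 1 F (F' x)) -> continuous F' ->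
  \int[mu1]_(x in `[a, b]) F' x = F b - F a.
Proof.
move=> ab dF cF; have cF0 : continuous F.
  by move=> x; apply/differentiable_continuous/derivable1_diffP; have [] := dF x.
rewrite /Rintegral (@continuous_FTC2 _ _ F)//.
- by apply: continuous_subspaceT.
- split.
  + by move=> x _; have [] := dF x.
  + by apply: cvg_at_right_filter; exact: cF0.
  + by apply: cvg_at_left_filter; exact: cF0.
- by move=> x _; rewrite derive1E; have [_] := dF x.
Qed.

(** On [-(n + 1), n + 1] the integral is a difference of boundary values of [F], which tend to 0;
    the bound on [F'] allows dominated convergence. Applied to a product, this is integration by
    parts on the whole line. *)
Lemma Rintegral_derive_dom (F F' : R -> R) (c : R) :
  (forall x : R, is_derive x 1 F (F' x)) -> continuous F' ->
  (forall x, `|F x| <= c * (1 + x ^+ 2)^-1) ->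
  (forall x, `|F' x| <= c * (1 + x ^+ 2)^-1) ->
  \int[mu1]_x F' x = 0.
Proof.
move=> dF cF Fc F'c.
have mF' : measurable_fun setT F' by exact: continuous_measurable_fun.
have iF' := integrable_dom_inv1Dsqr mF' F'c.
pose f_ (n : nat) (x : R) := (F' \_ `[- n.+1%:R, n.+1%:R]) x.
have mf_ n : measurable_fun setT (f_ n).
  by apply/(measurable_restrictT _ _).1 => //; exact: measurable_funTS.
have f_le n x : `|f_ n x| <= `|F' x|.
  by rewrite /f_ /patch; case: ifP => //; rewrite normr0.
have f_cvg : {ae mu1, forall x, setT x -> (EFin \o f_ n) x @[n --> \oo] --> (EFin \o F') x}.
  apply: aeW => x _; apply: cvg_near_cst; near=> n.
  rewrite /f_ /= /patch ifT// inE/= in_itv/= -ler_norml; apply: ltW.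
  rewrite (lt_le_trans (truncnS_gt `|x|))// ler_nat ltnS.
  by near: n; exact: nbhs_infty_ge.
have f_dom : {ae mu1, forall x n, setT x -> (`|(EFin \o f_ n) x| <= (EFin \o (fun x => `|F' x|%R)) x)%E}.
  by apply: aeW => x n _ /=; rewrite lee_fin f_le.
have [_ _ cv] := @dominated_convergence _ (measurableTypeR R) R mu1 setT measurableT
  (fun n => EFin \o f_ n) (EFin \o F') (EFin \o (fun x => `|F' x|))
  (fun n => (measurable_EFinP _ _).2 (mf_ n)) ((measurable_EFinP _ _).2 mF') f_cvg (integrable_norm iF') f_dom.
have E n : (\int[mu1]_x (f_ n x)%:E)%E = (F n.+1%:R - F (- n.+1%:R))%:E.
  rewrite -(Rintegral_derive_itv _ dF cF); last by rewrite ltrNl gtrN.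
  rewrite Rintegral_mkcond EFin_Rintegral//.
  exact: (@integrable_dom _ (measurableTypeR R) R _ _ _ (mf_ n) (integrable_norm iF') (f_le n)).
have {}cv : ((F n.+1%:R - F (- n.+1%:R))%:E) @[n --> \oo] --> (\int[mu1]_x (F' x)%:E)%E.
  by under eq_fun do rewrite -E; exact: cv.
rewrite /Rintegral (_ : (\int[mu1]_x (F' x)%:E)%E = 0%:E)//.
apply: (cvg_unique _ cv) => //.
apply: cvg_EFin; first exact: nearW.
have c0 : 0 <= c by have := le_trans (normr_ge0 _) (Fc 0); rewrite expr0n addr0 invr1 mulr1.
have h (n : nat) : c * (1 + n.+1%:R ^+ 2)^-1 <= c * n.+1%:R^-1 :> R.
  rewrite ler_wpM2l// lef_pV2 ?posrE ?oneDsqr_gt0// expr2.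
  by rewrite ler_wpDl// ler_peMr ?ler0n// ler1n.
apply/cvgr0Pnorm_le => e e0; near=> n.
apply: le_trans (ler_normB _ _) _.
apply: (@le_trans _ _ (c * n.+1%:R^-1 + c * n.+1%:R^-1)).
  by apply: lerD; (apply: le_trans (h n)); [exact: Fc|have := Fc (- n.+1%:R); rewrite sqrrN].
rewrite -mulrDl ler_pdivrMr//.
apply: (@le_trans _ _ (e * ((c + c) / e))); first by rewrite mulrC divfK// gt_eqF.
rewrite ler_pM2l//; apply: le_trans (ltW (truncnS_gt _)) _.
rewrite ler_nat ltnS; near: n; exact: nbhs_infty_ge.
Unshelve. all: by end_near. Qed.

End whole_line.

Section derive_under_integral.
Context {R : realType}.
Local Notation mu1 := (@lebesgue_measure R).

Lemma is_derive_under_integral (f f' : R -> R -> R) (G : R -> R) :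
  (forall z, mu1.-integrable setT (EFin \o f z)) ->
  (forall z x : R, is_derive z 1 (f ^~ x) (f' z x)) ->
  mu1.-integrable setT (EFin \o G) -> (forall z x, `|f' z x| <= G x) ->
  forall z : R, is_derive z 1 (fun z => \int[mu1]_x f z x) (\int[mu1]_x f' z x).
Proof.
move=> intf df iG f'G z.
have G0 x : 0 <= G x by apply: le_trans (f'G z x).
have Iz : `]z - 1, z + 1[%classic z by rewrite /= in_itv/= ltrBlDr ltrDl ltr01.
have pE z' x : partial1of2 f z' x = f' z' x.
  by rewrite partial1of2E; have [_] := df z' x.
have h1 : forall x, `]z - 1, z + 1[%classic x -> mu1.-integrable setT (EFin \o f x) by [].
have h2 : forall x y, `]z - 1, z + 1[%classic x -> setT y -> derivable (f ^~ y) x 1.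
  by move=> x y _ _; have [] := df x y.
have h3 : forall x y, `]z - 1, z + 1[%classic x -> setT y -> `|partial1of2 f x y| <= G y.
  by move=> x y _ _; rewrite pE.
split.
  exact: (@derivable_under_integral R _ (measurableTypeR R) mu1 f setT measurableT _ _ _ Iz h1 h2 _ G0 iG h3).
rewrite -derive1E.
rewrite (@differentiation_under_integral R _ (measurableTypeR R) mu1 f setT measurableT _ _ _ Iz h1 h2 _ G0 iG h3).
by apply: eq_Rintegral => x _; rewrite pE.
Qed.

End derive_under_integral.

Lemma is_derive_scalel (R : realType) (k x : R) (f : R -> R) (df : R) :
  is_derive x 1 f df -> is_derive x 1 (fun y => k * f y) (k * df).
Proof. exact: is_deriveZ. Qed.

Lemma is_derive_sqr (R : realType) (x : R) : is_derive x 1 (fun y : R => y ^+ 2) (2 * x).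
Proof.
rewrite (_ : (fun y : R => _) = (fun y : R => y) * (fun y : R => y)).
  apply: trigger_derive (is_deriveM (is_derive_id x (1 : R)) (is_derive_id x (1 : R))) _.
  by rewrite /GRing.scale/=; ring.
by apply/funext => y; rewrite expr2.
Qed.

Section gaussian.
Context {R : realType}.
Local Notation mu1 := (@lebesgue_measure R).
Variable t : R.
Hypothesis t0 : 0 < t.

Definition gk (x : R) : R := expR (- (t * x ^+ 2)).

Lemma gk_ge0 x : 0 <= gk x. Proof. exact: expR_ge0. Qed.

Lemma gk_le1 x : gk x <= 1.
Proof. by rewrite /gk expR_le1 oppr_le0 mulr_ge0 ?sqr_ge0 ?ltW. Qed.

Lemma is_derive_gk (x : R) : is_derive x 1 gk (- (2 * t * x) * gk x).
Proof.
have d : is_derive x 1 (fun x : R => - (t * x ^+ 2)) (- (2 * t * x)).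
  have := is_deriveN (is_derive_scalel t (is_derive_sqr x)).
  by move=> H; apply: trigger_derive H _; ring.
apply: trigger_derive (@is_derive1_comp R expR _ x _ _ (is_derive_expR _) d) _.
by rewrite mulrC.
Qed.

Lemma continuous_gk : continuous gk.
Proof.
by move=> x; apply/differentiable_continuous/derivable1_diffP; have [] := is_derive_gk x.
Qed.

Lemma gk_decay : exists2 C : R, 0 <= C &
  (forall x, gk x <= C * (1 + x ^+ 2)^-1) /\ (forall x, `|x| * gk x <= C * (1 + x ^+ 2)^-1).
Proof.
(* At t x^2 this polynomial is (1 + x^2)^2: one factor is the decay to be proved, the other one
   absorbs |x|. *)
have [C C0 h] := horner_expRN_bounded ((1 + t^-1 *: 'X) ^+ 2).
have {}h x : (1 + x ^+ 2) ^+ 2 * gk x <= C.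
  have := h (t * x ^+ 2) (mulr_ge0 (ltW t0) (sqr_ge0 x)).
  rewrite horner_exp hornerD hornerZ hornerX hornerC mulKf ?gt_eqF// ger0_norm//.
  exact: sqr_ge0.
exists C => //; split=> x; rewrite ler_pdivlMr ?oneDsqr_gt0//.
  apply: le_trans (h x); rewrite mulrC ler_wpM2r ?gk_ge0// [(1 + _) ^+ 2]expr2.
  by rewrite ler_peMr ?(ltW (oneDsqr_gt0 _))// lerDl sqr_ge0.
apply: le_trans (h x); rewrite mulrAC ler_wpM2r ?gk_ge0// [(1 + _) ^+ 2]expr2.
rewrite ler_wpM2r ?(ltW (oneDsqr_gt0 _))// -real_normK ?num_real//.
have := sqr_ge0 (`|x| - 1); have := normr_ge0 x; nra.
Qed.

Lemma integrable_gk : mu1.-integrable setT (EFin \o gk).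
Proof.
have [C C0 [h _]] := gk_decay; apply: (@integrable_dom_inv1Dsqr R _ C).
  exact: continuous_measurable_fun continuous_gk.
by move=> x; rewrite ger0_norm ?gk_ge0.
Qed.

Let gcos z := \int[mu1]_x (gk x * cos (z * x)).
Let gsin z := \int[mu1]_x (gk x * sin (z * x)).

Let dlin (z x : R) : is_derive x 1 (fun x => z * x) z.
Proof.
have := is_derive_scalel z (is_derive_id x (1 : R)).
by move=> H; apply: trigger_derive H _; rewrite mulr1.
Qed.

Let dlin' (z x : R) : is_derive z 1 (fun z => z * x) x.
Proof.
have := is_derive_scalel x (is_derive_id z (1 : R)).
by rewrite mulr1 (_ : (fun y => _) = (fun z => z * x))//; apply/funext => y; rewrite [RHS]mulrC.
Qed.

Let dcos (z x : R) : is_derive x 1 (fun x : R => cos (z * x)) (- (z * sin (z * x))).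
Proof.
have := @is_derive1_comp R cos _ x _ _ (is_derive_cos (z * x)) (dlin z x).
by move=> H; apply: trigger_derive H _; rewrite mulNr mulrC.
Qed.

Let dsin (z x : R) : is_derive x 1 (fun x : R => sin (z * x)) (z * cos (z * x)).
Proof.
have := @is_derive1_comp R sin _ x _ _ (is_derive_sin (z * x)) (dlin z x).
by move=> H; apply: trigger_derive H _; rewrite mulrC.
Qed.

Let dcos' (z x : R) : is_derive z 1 (fun z : R => cos (z * x)) (- (x * sin (z * x))).
Proof.
have := @is_derive1_comp R cos _ z _ _ (is_derive_cos (z * x)) (dlin' z x).
by move=> H; apply: trigger_derive H _; rewrite mulNr mulrC.
Qed.

Let dsin' (z x : R) : is_derive z 1 (fun z : R => sin (z * x)) (x * cos (z * x)).
Proof.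
have := @is_derive1_comp R sin _ z _ _ (is_derive_sin (z * x)) (dlin' z x).
by move=> H; apply: trigger_derive H _; rewrite mulrC.
Qed.

Let ccos z : continuous (fun x : R => cos (z * x)).
Proof.
by move=> x; apply/differentiable_continuous/derivable1_diffP; have [] := dcos z x.
Qed.

Let csin z : continuous (fun x : R => sin (z * x)).
Proof.
by move=> x; apply/differentiable_continuous/derivable1_diffP; have [] := dsin z x.
Qed.

Let ncos (x : R) : `|cos x| <= 1. Proof. by rewrite ler_norml cos_geN1 cos_le1. Qed.
Let nsin (x : R) : `|sin x| <= 1. Proof. by rewrite ler_norml sin_geN1 sin_le1. Qed.

Let continuous_id : continuous (fun x : R => x). Proof. by move=> x; exact: cvg_id. Qed.

Section trig.
Variables s : R -> R.
Hypothesis s1 : forall x, `|s x| <= 1.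
Hypothesis cs : continuous s.

Let i1 : mu1.-integrable setT (EFin \o (fun x => gk x * s x)).
Proof.
have [C C0 [h _]] := gk_decay; apply: (@integrable_dom_inv1Dsqr R _ C).
  by apply: measurable_funM; apply: continuous_measurable_fun => //; exact: continuous_gk.
move=> x; apply: le_trans (h x); rewrite normrM (ger0_norm (gk_ge0 _)).
by rewrite ler_piMr ?gk_ge0.
Qed.

Let i2 : mu1.-integrable setT (EFin \o (fun x => x * (gk x * s x))).
Proof.
have [C C0 [_ h]] := gk_decay; apply: (@integrable_dom_inv1Dsqr R _ C).
  apply: measurable_funM; first exact: continuous_measurable_fun.
  by apply: measurable_funM; apply: continuous_measurable_fun => //; exact: continuous_gk.
move=> x; apply: le_trans (h x); rewrite !normrM (ger0_norm (gk_ge0 _)).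
by rewrite ler_wpM2l// ler_piMr ?gk_ge0.
Qed.

Definition integrable_gk_trig := i1.
Definition integrable_id_gk_trig := i2.

(* Integrating the derivative of [gk * s] over the line turns the factor [x]
   coming from differentiation in the frequency into a factor [z / (2 t)]. *)
Lemma gk_by_parts (s' : R -> R) z : (forall x : R, is_derive x 1 s (z * s' x)) ->
  (forall x, `|s' x| <= 1) -> continuous s' ->
  \int[mu1]_x (x * (gk x * s x)) = z / (2 * t) * \int[mu1]_x (gk x * s' x).
Proof.
move=> ds s'1 cs'.
have i3 : mu1.-integrable setT (EFin \o (fun x => gk x * s' x)).
  have [C C0 [h _]] := gk_decay; apply: (@integrable_dom_inv1Dsqr R _ C).
    by apply: measurable_funM; apply: continuous_measurable_fun => //; exact: continuous_gk.
  move=> x; apply: le_trans (h x); rewrite normrM (ger0_norm (gk_ge0 _)).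
  by rewrite ler_piMr ?gk_ge0.
have [C C0 [h1 h2]] := gk_decay.
have D (x : R) : is_derive x 1 (fun x => gk x * s x)
    ((- (2 * t)) * (x * (gk x * s x)) + z * (gk x * s' x)).
  have := is_deriveM (is_derive_gk x) (ds x).
  by move=> H; apply: trigger_derive H _; rewrite /GRing.scale/=; ring.
have cc : continuous (fun x : R => (- (2 * t)) * (x * (gk x * s x)) + z * (gk x * s' x)).
  move=> x; apply: cvgD; apply: cvgM; try exact: cvg_cst.
    by apply: cvgM; [exact: cvg_id|apply: cvgM; [exact: continuous_gk|exact: cs]].
  by apply: cvgM; [exact: continuous_gk|exact: cs'].
have := @Rintegral_derive_dom R _ _ (C + (2 * t * C + `|z| * C)) D cc _ _.
rewrite RintegralD//; last 2 first.
- exact: (integrableZl measurableT _ i2).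
- exact: (integrableZl measurableT _ i3).
rewrite !RintegralZl// => H.
have K : - (2 * t) * \int[mu1]_x (x * (gk x * s x)) + z * \int[mu1]_x (gk x * s' x) = 0.
  apply: H => x.
    rewrite normrM (ger0_norm (gk_ge0 _)); apply: (@le_trans _ _ (gk x)).
      by rewrite ler_piMr ?gk_ge0.
    apply: le_trans (h1 x) _; rewrite ler_wpM2r ?inv1Dsqr_ge0// lerDl.
    by rewrite addr_ge0 ?mulr_ge0// ltW.
  apply: le_trans (ler_normD _ _) _.
  rewrite normrM normrN (ger0_norm (mulr_ge0 _ (ltW t0)))// [leRHS]mulrDl [(_ + `|z| * C) / _]mulrDl.
  apply: (@le_trans _ _ (2 * t * C * (1 + x ^+ 2)^-1 + `|z| * C * (1 + x ^+ 2)^-1)); last first.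
    by rewrite lerDr mulr_ge0 ?inv1Dsqr_ge0.
  apply: lerD.
    rewrite -[leRHS]mulrA ler_wpM2l ?mulr_ge0 ?(ltW t0)//; apply: le_trans (h2 x).
    by rewrite !normrM (ger0_norm (gk_ge0 _)) ler_wpM2l// ler_piMr ?gk_ge0.
  rewrite normrM -[leRHS]mulrA ler_wpM2l//; apply: le_trans (h1 x).
  by rewrite normrM (ger0_norm (gk_ge0 _)) ler_piMr ?gk_ge0.
have t2 : 2 * t != 0 by rewrite mulf_neq0 ?gt_eqF.
move/eqP: K; rewrite mulNr addrC subr_eq0 => /eqP K.
by apply: (mulfI t2); rewrite -K; field; rewrite gt_eqF.
Qed.

End trig.

Let intcos z := @integrable_gk_trig (fun x => cos (z * x)) (fun x => ncos _) (@ccos z).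
Let intsin z := @integrable_gk_trig (fun x => sin (z * x)) (fun x => nsin _) (@csin z).

Let iG : mu1.-integrable setT (EFin \o (fun x => `|x| * gk x)).
Proof.
have [C C0 [_ h]] := gk_decay; apply: (@integrable_dom_inv1Dsqr R _ C).
  apply: measurable_funM; last exact: continuous_measurable_fun continuous_gk.
  exact: continuous_measurable_fun (@norm_continuous _ R^o).
by move=> x; rewrite ger0_norm// mulr_ge0 ?gk_ge0.
Qed.

(** Differentiation in the frequency brings down a factor x, which integration by parts trades for z
    / (2 t). The result is the linear equation satisfied by exp (- z^2 / (4 t)). *)
Let dgcos (z : R) : is_derive z 1 gcos (- (z / (2 * t)) * gcos z).
Proof.
have d (y x : R) : is_derive y 1 (fun y : R => gk x * cos (y * x)) (- (x * (gk x * sin (y * x)))).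
  have H := is_derive_scalel (gk x) (dcos' y x).
  by apply: trigger_derive H _; ring.
have b (y x : R) : `|- (x * (gk x * sin (y * x)))| <= `|x| * gk x.
  by rewrite normrN !normrM (ger0_norm (gk_ge0 _)) ler_wpM2l// ler_piMr ?gk_ge0.
apply: trigger_derive (@is_derive_under_integral R _ _ _ intcos d iG b z) _.
have -> : - (z / (2 * t)) * gcos z = - \int[mu1]_x (x * (gk x * sin (z * x))).
  rewrite mulNr; congr (- _); apply/esym.
  exact: (@gk_by_parts _ (fun x => nsin _) (@csin z) _ _ (dsin z) (fun x => ncos _) (@ccos z)).
under eq_Rintegral do rewrite -mulN1r.
rewrite RintegralZl// ?mulN1r//.
exact: (@integrable_id_gk_trig (fun x => sin (z * x)) (fun x => nsin _) (@csin z)).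
Qed.

Let dgsin (z : R) : is_derive z 1 gsin (- (z / (2 * t)) * gsin z).
Proof.
have d (y x : R) : is_derive y 1 (fun y : R => gk x * sin (y * x)) (x * (gk x * cos (y * x))).
  have H := is_derive_scalel (gk x) (dsin' y x).
  by apply: trigger_derive H _; ring.
have b (y x : R) : `|x * (gk x * cos (y * x))| <= `|x| * gk x.
  by rewrite !normrM (ger0_norm (gk_ge0 _)) ler_wpM2l// ler_piMr ?gk_ge0.
apply: trigger_derive (@is_derive_under_integral R _ _ _ intsin d iG b z) _.
rewrite mulNr -mulrN.
have -> : - gsin z = \int[mu1]_x (gk x * - sin (z * x)).
  under [RHS]eq_Rintegral do rewrite mulrN -mulN1r.
  by rewrite (RintegralZl _ measurableT (intsin z)) mulN1r.
apply: (@gk_by_parts (fun x => cos (z * x)) (fun x => ncos _) (@ccos z)).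
- by move=> x; apply: trigger_derive (dcos z x) _; rewrite mulrN.
- by move=> x; rewrite normrN.
- by move=> x; apply: cvgN; exact: (@csin z).
Qed.

Let ode (g : R -> R) : (forall z : R, is_derive z 1 g (- (z / (2 * t)) * g z)) ->
  forall z, g z = g 0 * expR (- (z ^+ 2 / (4 * t))).
Proof.
move=> dg z.
have d (y : R) : is_derive y 1 (fun y : R => y ^+ 2 / (4 * t)) (y / (2 * t)).
  have := is_derive_scalel (4 * t)^-1 (is_derive_sqr y).
  rewrite (_ : (fun w : R => _ * w ^+ 2) = (fun y => y ^+ 2 / (4 * t))); last first.
    by apply/funext => w; rewrite [RHS]mulrC.
  by move=> H; apply: trigger_derive H _; field; rewrite gt_eqF.
have E : forall y : R, is_derive y 1 (fun y => g y * expR (y ^+ 2 / (4 * t))) 0.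
  move=> y; have e := @is_derive1_comp R expR _ y _ _ (is_derive_expR _) (d y).
  apply: trigger_derive (is_deriveM (dg y) e) _.
  by rewrite /GRing.scale/=; ring.
have := is_derive_0_is_cst z 0 E.
rewrite expr0n/= mul0r expR0 mulr1 expRN => <-.
by rewrite mulfK// expR_eq0.
Qed.

(** The cosine and sine integrals solve the same linear equation and are determined by their values
    at 0. The Gaussian integral is left unevaluated: the bound [Rintegral_gk_le] is enough for the
    decay estimates. *)
Lemma fourier_gk z : cint mu1 (fun x => ((gk x)%:C * cis (z * x))%C) =
  ((\int[mu1]_x gk x) * expR (- (z ^+ 2 / (4 * t))))%:C%C.
Proof.
have gcos0 : gcos 0 = \int[mu1]_x gk x.
  by apply: eq_Rintegral => x _; rewrite mul0r cos0 mulr1.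
have gsin0 : gsin 0 = 0.
  by rewrite /gsin; under eq_Rintegral do rewrite mul0r sin0 mulr0; rewrite /Rintegral integral0.
rewrite -gcos0 -(ode dgcos) /cint.
congr (_ +i* _)%C.
  by apply: eq_Rintegral => x _ /=; rewrite mul0r subr0.
(* The sine integral vanishes at 0, hence everywhere. *)
have -> : 0 = gsin z by rewrite (ode dgsin) gsin0 mul0r.
by apply: eq_Rintegral => x _ /=; rewrite mul0r addr0.
Qed.

(** Since u exp (- u) <= 1 for u = t x^2, the product of [gk t x] and 1 + x^2 is at most 1 + 1/t.
    The blow-up at small t is compensated in [heat_decay] by a positive power of t. *)
Lemma Rintegral_gk_le : 0 <= \int[mu1]_x gk x <= (1 + t^-1) * \int[mu1]_x (1 + x ^+ 2)^-1.
Proof.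
apply/andP; split; first by apply: Rintegral_ge0 => x _; exact: gk_ge0.
rewrite -RintegralZl//; last exact: integrable_inv1Dsqr.
apply: le_Rintegral => //; first exact: integrable_gk.
  exact: (integrableZl measurableT _ integrable_inv1Dsqr).
move=> x _; rewrite ler_pdivlMr ?oneDsqr_gt0//.
have := gk_le1 x; have : gk x * (t * x ^+ 2) <= 1.
  rewrite /gk expRN mulrC ler_pdivrMr ?expR_gt0// mul1r.
  have := @expR_ge1Dx R (t * x ^+ 2); lra.
move=> h1 h2; rewrite mulrDr mulr1 lerD//.
by rewrite -[leRHS]mul1r -ler_pdivrMr ?invr_gt0// invrK -mulrA [_ * t]mulrC.
Qed.

End gaussian.

(** * Fourier transforms of bump functions *)

Section fourier_bump.
Local Open Scope complex_scope.
Context {R : realType}.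
Local Notation mu1 := (@lebesgue_measure R).

Lemma mul_real_complex (a b c : R) : a%:C * (b +i* c) = (a * b) +i* (a * c).
Proof. by simpc. Qed.

Lemma bumpc_le_inv1Dsqr (f : R -> R) : bumpc f ->
  exists2 C : R, 0 <= C & forall x, `|f x| <= C * (1 + x ^+ 2)^-1.
Proof.
move=> bf; have [C C0 h] := bumpc_bounded bf; exists (2 * C) => [|x].
  by rewrite mulr_ge0.
rewrite ler_pdivlMr ?oneDsqr_gt0//.
have [x1|x1] := leP 1 `|x|; first by rewrite (bumpc_supp bf)// normr0 mul0r mulr_ge0.
rewrite mulrC ler_pM// ?(ltW (oneDsqr_gt0 _))//.
have : `|x| ^+ 2 <= 1 by rewrite expr_le1// ltW.
by rewrite real_normK ?num_real//; lra.
Qed.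

Lemma bumpc_by_parts (f f' s s' : R -> R) (D : R) : bumpc f -> bumpc f' ->
  (forall x : R, is_derive x 1 f (f' x)) ->
  (forall x : R, is_derive x 1 s (s' x)) -> (forall x, `|s x| <= 1) ->
  (forall x, `|s' x| <= D) -> continuous s' ->
  \int[mu1]_x (f' x * s x) = - \int[mu1]_x (f x * s' x).
Proof.
move=> bf bf' df ds s1 s'D cs'.
have cs : continuous s.
  by move=> x; apply/differentiable_continuous/derivable1_diffP; have [] := ds x.
have D0 : 0 <= D by apply: le_trans (s'D 0).
have [C C0 h] := bumpc_le_inv1Dsqr bf; have [C' C'0 h'] := bumpc_le_inv1Dsqr bf'.
have b1 x : `|f' x * s x| <= C' * (1 + x ^+ 2)^-1.
  by apply: le_trans (h' x); rewrite normrM ler_piMr.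
have b2 x : `|f x * s' x| <= (C * D) * (1 + x ^+ 2)^-1.
  by rewrite normrM mulrAC ler_pM.
have mf g k : bumpc g -> continuous k -> measurable_fun setT (fun x : R => g x * k x).
  move=> bg ck; apply: measurable_funM; first exact: bumpc_measurable.
  exact: continuous_measurable_fun.
have i1 := integrable_dom_inv1Dsqr (mf _ _ bf' cs) b1.
have i2 := integrable_dom_inv1Dsqr (mf _ _ bf cs') b2.
have dF (x : R) : is_derive x 1 (fun x => f x * s x) (f' x * s x + f x * s' x).
  apply: trigger_derive (is_deriveM (df x) (ds x)) _; rewrite /GRing.scale/=; ring.
have cF' : continuous (fun x : R => f' x * s x + f x * s' x).
  by move=> x; apply: cvgD; apply: cvgM; try exact: bumpc_continuous; [exact: cs|exact: cs'].
have Fb x : `|f x * s x| <= (C + (C' + C * D)) * (1 + x ^+ 2)^-1.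
  rewrite normrM; apply: le_trans (ler_piMr _ (s1 x)) _ => //.
  apply: le_trans (h x) _; rewrite ler_wpM2r ?inv1Dsqr_ge0// lerDl.
  by rewrite addr_ge0// mulr_ge0.
have F'b x : `|f' x * s x + f x * s' x| <= (C + (C' + C * D)) * (1 + x ^+ 2)^-1.
  apply: le_trans (ler_normD _ _) _; apply: le_trans (lerD (b1 x) (b2 x)) _.
  by rewrite -mulrDl ler_wpM2r ?inv1Dsqr_ge0// lerDr.
have /eqP := Rintegral_derive_dom dF cF' Fb F'b.
by rewrite RintegralD// addr_eq0 => /eqP.
Qed.

Definition hat (f : R -> R) (xi : R) : R[i] :=
  cint mu1 (fun x => (f x)%:C * cis (- (x * xi))).

Let hatE f xi : hat f xi = (\int[mu1]_x (f x * cos (- (x * xi)))) +i*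
  (\int[mu1]_x (f x * sin (- (x * xi)))).
Proof.
by rewrite /hat /cint; congr (_ +i* _); apply: eq_Rintegral => x _ /=;
  rewrite mul0r ?subr0 ?addr0.
Qed.

Lemma hat_derive2 (f f' f'' : R -> R) xi : bumpc f -> bumpc f' -> bumpc f'' ->
  (forall x : R, is_derive x 1 f (f' x)) ->
  (forall x : R, is_derive x 1 f' (f'' x)) ->
  hat f'' xi = (- xi ^+ 2)%:C * hat f xi.
Proof.
move=> bf bf' bf'' df df'.
have dl (x : R) : is_derive x 1 (fun x => - (x * xi)) (- xi).
  have := is_derive_scalel (- xi) (is_derive_id x (1 : R)); rewrite mulr1.
  by rewrite (_ : (fun y => - xi * y) = (fun x => - (x * xi)))//; apply/funext => y; ring.
have dc (x : R) : is_derive x 1 (fun x : R => cos (- (x * xi))) (xi * sin (- (x * xi))).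
  have H := @is_derive1_comp R cos _ x _ _ (is_derive_cos (- (x * xi))) (dl x).
  by apply: trigger_derive H _; ring.
have ds (x : R) : is_derive x 1 (fun x : R => sin (- (x * xi))) (- xi * cos (- (x * xi))).
  have H := @is_derive1_comp R sin _ x _ _ (is_derive_sin (- (x * xi))) (dl x).
  by apply: trigger_derive H _; ring.
have cc1 : continuous (fun x : R => cos (- (x * xi))).
  by move=> x; apply/differentiable_continuous/derivable1_diffP; have [] := dc x.
have cs1 : continuous (fun x : R => sin (- (x * xi))).
  by move=> x; apply/differentiable_continuous/derivable1_diffP; have [] := ds x.
have cc (k : R) : continuous (fun x : R => k * cos (- (x * xi))).
  by move=> x; apply: cvgM; [exact: cvg_cst|exact: cc1].
have cs (k : R) : continuous (fun x : R => k * sin (- (x * xi))).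
  by move=> x; apply: cvgM; [exact: cvg_cst|exact: cs1].
have ncos (x : R) : `|cos x| <= 1 by rewrite ler_norml cos_geN1 cos_le1.
have nsin (x : R) : `|sin x| <= 1 by rewrite ler_norml sin_geN1 sin_le1.
have kcos (k x : R) : `|k * cos x| <= `|k| by rewrite normrM ler_piMr.
have ksin (k x : R) : `|k * sin x| <= `|k| by rewrite normrM ler_piMr.
have icos g : bumpc g -> mu1.-integrable setT (EFin \o (fun x => g x * cos (- (x * xi)))).
  move=> bg; apply: (@integrable_dom _ (measurableTypeR R) R mu1 _ _ _ (integrable_norm (bumpc_integrable bg))).
    apply: measurable_funM; first exact: bumpc_measurable.
    exact: continuous_measurable_fun.
  by move=> x; rewrite normrM ler_piMr.
have isin g : bumpc g -> mu1.-integrable setT (EFin \o (fun x => g x * sin (- (x * xi)))).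
  move=> bg; apply: (@integrable_dom _ (measurableTypeR R) R mu1 _ _ _ (integrable_norm (bumpc_integrable bg))).
    apply: measurable_funM; first exact: bumpc_measurable.
    exact: continuous_measurable_fun.
  by move=> x; rewrite normrM ler_piMr.
have Pc g g' : bumpc g -> bumpc g' -> (forall x : R, is_derive x 1 g (g' x)) ->
    \int[mu1]_x (g' x * cos (- (x * xi))) = - xi * \int[mu1]_x (g x * sin (- (x * xi))).
  move=> bg bg' dg; rewrite (bumpc_by_parts bg bg' dg dc _ (fun x => ksin xi _) (cs xi))//.
  rewrite mulNr -RintegralZl//; last exact: isin.
  by congr (- _); apply: eq_Rintegral => x _; rewrite mulrCA.
have Ps g g' : bumpc g -> bumpc g' -> (forall x : R, is_derive x 1 g (g' x)) ->
    \int[mu1]_x (g' x * sin (- (x * xi))) = xi * \int[mu1]_x (g x * cos (- (x * xi))).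
  move=> bg bg' dg; rewrite (bumpc_by_parts bg bg' dg ds _ (fun x => kcos (- xi) _) (cc (- xi)))//.
  rewrite -[RHS]opprK -mulNr -RintegralZl//; last exact: icos.
  by congr (- _); apply: eq_Rintegral => x _; rewrite mulrCA.
rewrite !hatE (Pc _ _ bf' bf'' df') (Ps _ _ bf' bf'' df') (Ps _ _ bf bf' df) (Pc _ _ bf bf' df).
by rewrite mul_real_complex; congr (_ +i* _); ring.
Qed.

Lemma cmeasurable_bump_cis (f : R -> R) (xi : R) : bumpc f ->
  @cmeasurable _ (measurableTypeR R) R (fun x => (f x)%:C * cis (- (x * xi))).
Proof.
move=> bf; apply: cmeasurableM.
  by apply: cmeasurable_real; exact: bumpc_measurable.
apply: cmeasurable_cis; apply: measurableT_comp => //.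
exact: measurable_funM.
Qed.

Lemma cintegrable_bump_cis (f : R -> R) (xi : R) : bumpc f ->
  cintegrable mu1 (fun x => (f x)%:C * cis (- (x * xi))).
Proof.
move=> bf; apply: (cintegrable_dom (cmeasurable_bump_cis xi bf) (integrable_norm (bumpc_integrable bf))).
by move=> x; rewrite Normc.normcM normc_cis mulr1 normc_real.
Qed.

Lemma normc_hat_le f xi : bumpc f -> Normc.normc (hat f xi) <= 2 * \int[mu1]_x `|f x|.
Proof.
move=> bf; apply: (normc_cint (cmeasurable_bump_cis xi bf) (integrable_norm (bumpc_integrable bf))).
by move=> x; rewrite Normc.normcM normc_cis mulr1 normc_real.
Qed.

(** By [hat_derive2], (1 + xi^2) times the transform of f is the transform of f - f'', and
    transforms of bumps are bounded. *)
Lemma hat_decay f : bumpc f ->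
  exists2 C, 0 <= C & forall xi, Normc.normc (hat f xi) <= C * (1 + xi ^+ 2)^-1.
Proof.
move=> bf; have [f' bf' df] := bumpc_derive bf; have [f'' bf'' df'] := bumpc_derive bf'.
have n0 (g : R -> R) : 0 <= \int[mu1]_x `|g x| by apply: Rintegral_ge0 => x _.
exists (2 * \int[mu1]_x `|f x| + 2 * \int[mu1]_x `|f'' x|).
  by rewrite addr_ge0// mulr_ge0.
move=> xi; rewrite ler_pdivlMr ?oneDsqr_gt0//.
rewrite -[X in _ * X](ger0_norm (ltW (oneDsqr_gt0 xi))) -normc_real -Normc.normcM.
have -> : hat f xi * (1 + xi ^+ 2)%:C = hat f xi + - hat f'' xi.
  rewrite (hat_derive2 xi bf bf' bf'' df df') rmorphN mulNr opprK.
  by rewrite rmorphD rmorph1 mulrDr mulr1 [_ * (_ ^+ 2)%:C]mulrC.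
apply: le_trans (le_normcD _ _) _; rewrite normcN.
by apply: lerD; exact: normc_hat_le.
Qed.

Let mulmeas : measurable_fun setT (fun z : measurableTypeR R * measurableTypeR R => (z.2 : R) * (z.1 : R)).
Proof. by apply: measurable_funM; [exact: measurable_snd|exact: measurable_fst]. Qed.

(** The Fubini argument for measurability in a parameter requires a majorant integrable in that
    parameter too. The factor (1 + xi^2)^(-1) is inserted to provide one and divided out at the
    end. *)
Lemma cmeasurable_hat f : bumpc f -> @cmeasurable _ (measurableTypeR R) R (hat f).
Proof.
move=> bf.
pose F (z : measurableTypeR R * measurableTypeR R) : R[i] :=
  ((1 + (z.1 : R) ^+ 2)^-1)%:C * ((f z.2)%:C * cis (- ((z.2 : R) * (z.1 : R)))).
have mi : @measurable_fun _ _ (measurableTypeR R) (measurableTypeR R) setT (fun x : R => (1 + x ^+ 2)^-1).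
  exact: continuous_measurable_fun continuous_inv1Dsqr.
have mF : cmeasurable F.
  apply: cmeasurableM.
    by apply: cmeasurable_real; exact: (measurableT_comp mi measurable_fst).
  apply: cmeasurableM.
    by apply: cmeasurable_real; exact: (measurableT_comp (bumpc_measurable bf) measurable_snd).
  by apply: cmeasurable_cis; exact: (measurableT_comp (@oppr_measurable R _) mulmeas).
have Fb x y : Normc.normc (F (x, y)) <= (1 + x ^+ 2)^-1 * `|f y|.
  rewrite /F !Normc.normcM normc_cis mulr1 !normc_real ger0_norm//.
  exact: inv1Dsqr_ge0.
have := cmeasurable_cfubini_fst mF integrable_inv1Dsqr (integrable_norm (bumpc_integrable bf)) Fb.
rewrite (_ : (fun x => _) = (fun x : measurableTypeR R => ((1 + (x : R) ^+ 2)^-1)%:C * hat f x)); last first.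
  by apply/funext => xi; rewrite /F/= cintZl//; exact: cintegrable_bump_cis.
move=> H.
have m2 : @measurable_fun _ _ (measurableTypeR R) (measurableTypeR R) setT (fun x : R => (1 + x ^+ 2)).
  by apply: continuous_measurable_fun => x; exact: continuous_oneDsqr.
have := cmeasurableM (cmeasurable_real m2) H.
rewrite (_ : (fun x => _) = hat f)//; apply/funext => x.
by rewrite mulrA -rmorphM/= mulfV ?gt_eqF ?oneDsqr_gt0// mul1r.
Qed.

Lemma hat_integrable_bound f : bumpc f -> exists2 b : R -> R,
  mu1.-integrable setT (EFin \o b) & forall xi, Normc.normc (hat f xi) <= b xi.
Proof.
move=> bf; have [C C0 h] := hat_decay bf.
exists (fun x : R => C * (1 + x ^+ 2)^-1) => //.
exact: (integrableZl measurableT C integrable_inv1Dsqr).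
Qed.

(** Up to the factor 2 pi, the heat flow of f at time t, given by its Fourier multiplier exp (- t
    xi^2). *)
Definition heat (f : R -> R) (t x : R) : R[i] :=
  cint mu1 (fun xi => (gk t xi)%:C * hat f xi * cis (x * xi)).

Lemma heat_bounded f : bumpc f ->
  exists2 C, 0 <= C & forall t x, 0 < t -> Normc.normc (heat f t x) <= C.
Proof.
move=> bf; have [b ib hb] := hat_integrable_bound bf.
exists (2 * \int[mu1]_x b x).
  rewrite mulr_ge0//; apply: Rintegral_ge0 => x _.
  exact: le_trans (normc_ge0 _) (hb x).
move=> t x t0; apply: normc_cint => //.
  apply: cmeasurableM; last by apply: cmeasurable_cis; exact: measurable_funM.
  apply: cmeasurableM; last exact: cmeasurable_hat.
  by apply: cmeasurable_real; exact: continuous_measurable_fun (@continuous_gk R t).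
move=> xi; rewrite !Normc.normcM normc_cis mulr1 normc_real ger0_norm ?gk_ge0//.
by apply: le_trans (hb xi); rewrite ler_piMl ?normc_ge0// gk_le1.
Qed.

(** Exchanging the two integrals turns the multiplier into convolution with a Gaussian, a form in
    which the decay in x is visible. *)
Lemma heatE f t x : bumpc f -> 0 < t ->
  heat f t x = cint mu1 (fun y =>
    (f y * ((\int[mu1]_z gk t z) * expR (- ((x - y) ^+ 2 / (4 * t)))))%:C).
Proof.
move=> bf t0.
pose F (z : measurableTypeR R * measurableTypeR R) : R[i] :=
  ((gk t z.1)%:C * cis (x * (z.1 : R))) * ((f z.2)%:C * cis (- ((z.2 : R) * (z.1 : R)))).
have mg : @measurable_fun _ _ (measurableTypeR R) (measurableTypeR R) setT (gk t).
  exact: continuous_measurable_fun (@continuous_gk R t).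
have mx : @measurable_fun _ _ (measurableTypeR R) (measurableTypeR R) setT (fun y : R => x * y).
  exact: measurable_funM.
have mF : cmeasurable F.
  apply: cmeasurableM.
    apply: cmeasurableM.
      by apply: cmeasurable_real; exact: (measurableT_comp mg measurable_fst).
    by apply: cmeasurable_cis; exact: (measurableT_comp mx measurable_fst).
  apply: cmeasurableM.
    by apply: cmeasurable_real; exact: (measurableT_comp (bumpc_measurable bf) measurable_snd).
  by apply: cmeasurable_cis; exact: (measurableT_comp (@oppr_measurable R _) mulmeas).
have Fb y z : Normc.normc (F (y, z)) <= gk t y * `|f z|.
  by rewrite /F !Normc.normcM !normc_cis !mulr1 !normc_real ger0_norm ?gk_ge0.
have := cfubini mF (integrable_gk t0) (integrable_norm (bumpc_integrable bf)) Fb.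
have -> : cint mu1 (fun y => cint mu1 (fun z => F (y, z))) = heat f t x.
  congr cint; apply/funext => xi; rewrite /F/= cintZl; last exact: cintegrable_bump_cis.
  by rewrite -/(hat f xi) mulrAC.
move=> ->; congr cint; apply/funext => y.
have ig : cintegrable mu1 (fun z : R => (gk t z)%:C * cis ((x - y) * z)).
  apply: (cintegrable_dom _ (integrable_gk t0)).
    apply: cmeasurableM; first exact: cmeasurable_real.
    by apply: cmeasurable_cis; exact: measurable_funM.
  by move=> z; rewrite Normc.normcM normc_cis mulr1 normc_real ger0_norm ?gk_ge0.
rewrite rmorphM/= -(fourier_gk t0) -cintZl//; congr cint; apply/funext => z.
rewrite /F/= mulrACA [(gk t z)%:C * _]mulrC -cisD -mulrA; congr (_ * (_ * cis _)).
by rewrite mulrBl.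
Qed.

(** For |x| < 2 the uniform bound suffices. For |x| >= 2 and y in the support, |x - y| >= |x| / 2,
    so the Gaussian kernel is at most exp (- x^2 / (16 t)), hence at most m! (16 t / x^2)^m. The
    polynomial growth in t is harmless under subordination. *)
Lemma heat_decay f (k : nat) : bumpc f -> exists2 C, 0 <= C & forall t x, 0 < t ->
  Normc.normc (heat f t x) <= C * (1 + t) ^+ k.+1 * ((1 + x ^+ 2) ^+ k.+1)^-1.
Proof.
move=> bf; have [C C0 hC] := heat_bounded bf.
pose J := \int[mu1]_x `|f x|; pose P := \int[mu1]_x (1 + x ^+ 2)^-1.
have J0 : 0 <= J by apply: Rintegral_ge0 => x _.
have P0 : 0 <= P by apply: Rintegral_ge0 => x _; exact: inv1Dsqr_ge0.
pose A := 2 * J * P * (k.+1)`!%:R * 16 ^+ k.+1 * 2 ^+ k.+1.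
have A0 : 0 <= A by rewrite /A !mulr_ge0// exprn_ge0.
(* The first term serves |x| < 2, where 1 + x^2 <= 5, and the second one |x| >= 2. *)
exists (C * 5 ^+ k.+1 + A); first by rewrite addr_ge0// mulr_ge0// exprn_ge0.
move=> t x t0; rewrite ler_pdivlMr ?exprn_gt0 ?oneDsqr_gt0//.
have T1 : 1 <= (1 + t) ^+ k.+1 by rewrite exprn_ege1// lerDl ltW.
have [x2|x2] := ltP `|x| 2.
  apply: (@le_trans _ _ (C * 5 ^+ k.+1)).
    rewrite ler_pM ?normc_ge0 ?exprn_ge0 ?(ltW (oneDsqr_gt0 _)) ?hC//.
    rewrite lerXn2r ?nnegrE ?(ltW (oneDsqr_gt0 _))//.
    have : `|x| ^+ 2 <= 2 ^+ 2 by rewrite lerXn2r ?nnegrE// ltW.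
    by rewrite real_normK ?num_real//; lra.
  rewrite -[leLHS]mulr1 ler_pM ?mulr_ge0 ?exprn_ge0// lerDl//.
have X2 : 4 <= x ^+ 2.
  have : 2 ^+ 2 <= `|x| ^+ 2 by rewrite lerXn2r ?nnegrE.
  by rewrite real_normK ?num_real//; lra.
apply: (@le_trans _ _ (A * (1 + t) ^+ k.+1)); last first.
  by rewrite ler_wpM2r ?(le_trans ler01 T1)// lerDr mulr_ge0// exprn_ge0.
pose G := \int[mu1]_z gk t z.
have /andP[G0 GP] := Rintegral_gk_le t0.
have H1 : Normc.normc (heat f t x) <= 2 * (J * (G * expR (- (x ^+ 2 / (16 * t))))).
  rewrite heatE// mulrC [J * _]mulrC -RintegralZl//; last exact: integrable_norm (bumpc_integrable bf).
  rewrite mulrC; apply: normc_cint.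
  - apply: cmeasurable_real; apply: measurable_funM; first exact: bumpc_measurable.
    apply: measurable_funM => //; apply: measurableT_comp => //.
    apply: measurableT_comp => //; apply: measurable_funM => //.
    by apply: measurable_funX; exact: measurable_funB.
  - exact: (integrableZl measurableT _ (integrable_norm (bumpc_integrable bf))).
  move=> y; rewrite normc_real normrM [leRHS]mulrC.
  have [y1|y1] := leP 1 `|y|; first by rewrite (bumpc_supp bf)// normr0 !mul0r.
  rewrite ler_wpM2l// ger0_norm ?mulr_ge0 ?expR_ge0// ler_wpM2l// ler_expR lerN2.
  rewrite (_ : 16 * t = 4 * (4 * t)); last by ring.
  rewrite invfM mulrA ler_wpM2r ?invr_ge0 ?mulr_ge0 ?(ltW t0)//.
  have xy : `|x| / 2 <= `|x - y|.
    have := ler_distD y x 0; rewrite !subr0 => h; lra.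
  have := ler_pM _ _ xy xy; rewrite ?divr_ge0// => /(_ isT isT).
  rewrite -!expr2 exprMn !real_normK ?num_real//; lra.
set m := k.+1 in A A0 T1 *.
have S1 : expR (- (x ^+ 2 / (16 * t))) * (x ^+ 2) ^+ m <= m`!%:R * (16 * t) ^+ m.
  have t16 : 0 < 16 * t by rewrite mulr_gt0.
  have := exprn_le_expR m (divr_ge0 (sqr_ge0 x) (ltW t16)).
  rewrite expr_div_n ler_pdivrMr ?exprn_gt0// => h.
  by rewrite expRN mulrC ler_pdivrMr ?expR_gt0// mulrAC.
have S2 : (1 + x ^+ 2) ^+ m <= 2 ^+ m * (x ^+ 2) ^+ m.
  have x20 : 0 <= 2 * x ^+ 2 by rewrite mulr_ge0 ?sqr_ge0.
  have le2 : 1 + x ^+ 2 <= 2 * x ^+ 2 by lra.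
  by rewrite -exprMn; apply: lerXn2r le2; rewrite nnegrE// ltW// oneDsqr_gt0.
(* One of the m factors t cancels the 1/t in the bound on the Gaussian integral; this is why the
   exponent is a successor. *)
have S3 : G * t ^+ m <= P * (1 + t) ^+ m.
  rewrite /m !exprS !mulrA; apply: ler_pM; rewrite ?mulr_ge0 ?exprn_ge0 ?(ltW t0)//.
    rewrite -ler_pdivlMr//; apply: le_trans GP _; rewrite le_eqVlt; apply/orP; left.
    by apply/eqP; rewrite /P; field; rewrite gt_eqF.
  by rewrite lerXn2r ?nnegrE ?addr_ge0 ?(ltW t0)// lerDr.
apply: le_trans (ler_pM (normc_ge0 _) _ H1 S2) _.
  by rewrite exprn_ge0// ltW// oneDsqr_gt0.
have -> : A * (1 + t) ^+ m = 2 * J * m`!%:R * 16 ^+ m * 2 ^+ m * (P * (1 + t) ^+ m).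
  by rewrite /A; ring.
apply: (@le_trans _ _ (2 * J * m`!%:R * 16 ^+ m * 2 ^+ m * (G * t ^+ m))); last first.
  by rewrite ler_wpM2l// !mulr_ge0// exprn_ge0.
have -> : 2 * J * m`!%:R * 16 ^+ m * 2 ^+ m * (G * t ^+ m) =
   2 * J * G * 2 ^+ m * (m`!%:R * (16 * t) ^+ m).
  by rewrite exprMn; ring.
have -> : 2 * (J * (G * expR (- (x ^+ 2 / (16 * t))))) * (2 ^+ m * (x ^+ 2) ^+ m) =
   2 * J * G * 2 ^+ m * (expR (- (x ^+ 2 / (16 * t))) * (x ^+ 2) ^+ m).
  by ring.
by rewrite ler_wpM2l// !mulr_ge0// exprn_ge0.
Qed.

End fourier_bump.

(** * Subordination and decay of Bessel potentials *)

Section subordination.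
Context {R : realType}.
Local Notation mu1 := (@lebesgue_measure R).
Variable s : R.
Hypothesis s0 : 0 < s.
Hypothesis s1 : s <= 1.

(* With t = e^tau, this is the kernel t^s e^(-t) dt/t of the Gamma integral. *)
Definition gammak (tau : R) : R := expR (s * tau) * expR (- expR tau).

Lemma gammak_ge0 tau : 0 <= gammak tau.
Proof. by rewrite mulr_ge0 ?expR_ge0. Qed.

Lemma continuous_gammak : continuous gammak.
Proof.
move=> x; apply: cvgM.
  apply: (@continuous_comp _ _ _ (fun t : R => s * t) expR); last exact: continuous_expR.
  by apply: cvgM; [exact: cvg_cst|exact: cvg_id].
apply: (@continuous_comp _ _ _ (fun t : R => - expR t) expR); last exact: continuous_expR.
by apply: cvgN; exact: continuous_expR.
Qed.

(** For tau >= 0 the factor exp (- e^tau) beats every polynomial in e^tau, and e^tau >= tau. For tau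
    < 0 the moment is at most 2^N, and e^(s tau) decays because s > 0. *)
Lemma gammak_moment_le (N : nat) : exists C : R, forall tau,
  `|gammak tau * (1 + expR tau) ^+ N| <= C * (1 + tau ^+ 2)^-1.
Proof.
have [C1 C10 h1] := horner_expRN_bounded ((2 ^+ N)%:P * ('X ^+ N.+1 * (1 + 'X ^+ 2)) : {poly R}).
have [C2 C20 h2] := horner_expRN_bounded ((2 ^+ N)%:P * (1 + (s^-1 *: 'X) ^+ 2) : {poly R}).
exists (C1 + C2) => tau; have E0 := expR_ge0 tau.
rewrite ger0_norm ?mulr_ge0 ?gammak_ge0 ?exprn_ge0 ?addr_ge0//.
rewrite ler_pdivlMr ?oneDsqr_gt0//.
have [t0|t0] := leP 0 tau.
  apply: (@le_trans _ _ C1); last by rewrite lerDl.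
  have := h1 (expR tau) E0; rewrite !(hornerM, hornerD, hornerXn, horner_exp, hornerX, hornerC).
  have E1 : 1 <= expR tau by rewrite -expR0 ler_expR.
  have Et : tau <= expR tau by have := expR_ge1Dx tau; lra.
  rewrite ger0_norm; last by rewrite !mulr_ge0 ?exprn_ge0 ?addr_ge0 ?sqr_ge0.
  apply: le_trans; rewrite /gammak.
  rewrite [X in X <= _](_ : _ = (expR (s * tau) * (1 + expR tau) ^+ N * (1 + tau ^+ 2)) * expR (- expR tau)); last by ring.
  rewrite ler_wpM2r ?expR_ge0// mulrA; apply: ler_pM; rewrite ?mulr_ge0 ?expR_ge0 ?exprn_ge0 ?addr_ge0 ?sqr_ge0//.
    rewrite exprS mulrCA -exprMn; apply: ler_pM; rewrite ?expR_ge0 ?exprn_ge0 ?addr_ge0//.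
      by rewrite ler_expR ler_piMl.
    by apply: lerXn2r; rewrite ?nnegrE ?addr_ge0 ?mulr_ge0//; lra.
  by rewrite lerD2l; apply: lerXn2r.
apply: (@le_trans _ _ C2); last by rewrite lerDr.
have u0 : 0 <= - (s * tau) by rewrite -mulrN mulr_ge0 ?oppr_ge0 ?ltW.
have := h2 _ u0; rewrite !(hornerM, hornerD, horner_exp, hornerZ, hornerX, hornerC).
have -> : s^-1 * - (s * tau) = - tau by field; rewrite gt_eqF.
rewrite mulrNN -expr2 opprK ger0_norm; last by rewrite !mulr_ge0 ?exprn_ge0 ?addr_ge0 ?sqr_ge0.
apply: le_trans; rewrite /gammak.
rewrite [X in X <= _](_ : _ = expR (- expR tau) * (1 + expR tau) ^+ N * (1 + tau ^+ 2) * expR (s * tau)); last by ring.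
rewrite ler_wpM2r ?expR_ge0// ler_wpM2r ?addr_ge0 ?sqr_ge0//.
rewrite -[leRHS]mul1r ler_pM ?expR_ge0 ?exprn_ge0 ?addr_ge0//.
have E1 : expR tau <= 1 by rewrite expR_le1 ltW.
by apply: lerXn2r; rewrite ?nnegrE ?addr_ge0//; lra.
Qed.

Lemma integrable_gammak_moment (N : nat) :
  mu1.-integrable setT (EFin \o (fun tau => gammak tau * (1 + expR tau) ^+ N)).
Proof.
have [C h] := gammak_moment_le N; apply: (@integrable_dom_inv1Dsqr R _ C) => //.
apply: continuous_measurable_fun => x; apply: cvgM; first exact: continuous_gammak.
apply: (@continuous_comp _ _ _ (fun t : R => 1 + expR t) (fun u => u ^+ N)).
  by apply: cvgD; [exact: cvg_cst|exact: continuous_expR].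
exact: exprn_continuous.
Qed.

Lemma integrable_gammak : mu1.-integrable setT (EFin \o gammak).
Proof.
have := integrable_gammak_moment 0; rewrite (_ : (fun tau => _) = gammak)//.
by apply/funext => tau; rewrite expr0 mulr1.
Qed.

Definition gammac : R := \int[mu1]_tau gammak tau.

Lemma gammac_gt0 : 0 < gammac.
Proof.
(* A lower bound for [gammak s] on [-1, 0]. *)
pose m : R := expR (- s) * expR (- expR 1).
have m0 : 0 < m by rewrite mulr_gt0 ?expR_gt0.
suff : m * 1 <= gammac by rewrite mulr1; apply: lt_le_trans.
have -> : m * 1 = \int[mu1]_(x in `[(-1 : R), 0]) m.
  rewrite Rintegral_cst//= lebesgue_measure_itv/= lte_fin ltrN10/= opprK.
  by rewrite add0r.
rewrite Rintegral_mkcond; apply: le_Rintegral => //.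
- have h := integrableZl measurableT m (@integrable_indic_itv R (-1) 0 true false).
  apply: eq_integrable h => // x _ /=.
  by rewrite patchE indicE; case: (_ \in _); rewrite -EFinM ?mulr1 ?mulr0.
- exact: integrable_gammak.
move=> x _; rewrite patchE; case: ifPn => [|_]; last exact: gammak_ge0.
rewrite inE/= in_itv/= => /andP[x1 x0]; apply: ler_pM; rewrite ?expR_ge0//.
  by rewrite ler_expR -mulrN1 ler_wpM2l// ltW.
by rewrite ler_expR lerN2 ler_expR; lra.
Qed.

Lemma integrable_subordination (q : R) : 1 <= q ->
  mu1.-integrable setT (EFin \o (fun tau => expR (s * tau) * expR (- (expR tau * q)))).
Proof.
move=> q1; apply: (@integrable_dom _ (measurableTypeR R) R mu1 _ _ _ integrable_gammak).
  apply: continuous_measurable_fun => x; apply: cvgM.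
    apply: (@continuous_comp _ _ _ (fun t : R => s * t) expR); last exact: continuous_expR.
    by apply: cvgM; [exact: cvg_cst|exact: cvg_id].
  apply: (@continuous_comp _ _ _ (fun t : R => - (expR t * q)) expR); last exact: continuous_expR.
  by apply: cvgN; apply: cvgM; [exact: continuous_expR|exact: cvg_cst].
move=> x; rewrite ger0_norm ?mulr_ge0 ?expR_ge0// ler_wpM2l ?expR_ge0//.
by rewrite ler_expR lerN2 ler_peMr ?expR_ge0.
Qed.

(* Translating tau by ln q rescales t by q. *)
Lemma subordination (q : R) : 1 <= q ->
  gammac * q `^ (- s) = \int[mu1]_tau (expR (s * tau) * expR (- (expR tau * q))).
Proof.
move=> q1; have q0 : 0 < q by apply: lt_le_trans q1.
rewrite /gammac /Rintegral.
have d (x : R) : is_derive x 1 (fun y : R => y + ln q) 1.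
  have := is_deriveD (is_derive_id x (1 : R)) (is_derive_cst (ln q) x (1 : R)).
  by rewrite addr0.
have dE : derive1 (fun y : R => y + ln q) = cst 1.
  by apply/funext => x; rewrite derive1E; have [_] := d x.
rewrite (@increasing_ge0_integration_by_substitutionT R (fun y => y + ln q)).
- have -> : (\int[mu1]_x (((gammak \o (fun y => y + ln q)%R) * derive1 (fun y => y + ln q)%R) x)%R%:E)%E =
     (\int[mu1]_x ((q `^ s)%R * (expR (s * x) * expR (- (expR x * q))))%:E)%E.
    apply: eq_integral => x _; congr EFin.
    rewrite dE /GRing.mul/= mulr1 /gammak mulrDr !expRD lnK ?posrE// mulrAC mulrC; congr (_ * _).
    by rewrite /powR gt_eqF// mulrC.
  have := RintegralZl (q `^ s) measurableT (integrable_subordination q1).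
  rewrite /Rintegral => ->.
  by rewrite powRN mulrAC mulfV ?mul1r// gt_eqF// powR_gt0.
- by move=> x y xy; rewrite ltrD2r.
- by rewrite dE => x; exact: cvg_cst.
- by rewrite dE; exact: is_cvg_cst.
- by rewrite dE; exact: is_cvg_cst.
- by move=> x; have [] := d x.
- exact: cvg_addrr_Ny.
- exact: cvg_addrr.
- exact: continuous_gammak.
- exact: gammak_ge0.
Qed.

End subordination.

(** * Negative powers of 1 - Delta on products of bumps *)

Section bessel_bump.
Local Open Scope complex_scope.
Context {R : realType} {n : nat}.
Local Notation mu1 := (@lebesgue_measure R).
Implicit Types (x xi : 'rV[R]_n) (F : 'I_n -> R -> R).

Lemma cmeasurable_prod d (T : measurableType d) I (s : seq I) (G : I -> T -> R[i]) :
  (forall i, cmeasurable (G i)) -> cmeasurable (fun y => \prod_(i <- s) G i y).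
Proof.
move=> mG; elim: s => [|i s IH].
  by under eq_fun do rewrite big_nil; exact: cmeasurable_cst.
by under eq_fun do rewrite big_cons; exact: cmeasurableM.
Qed.

Lemma cint_real d (T : measurableType d) (mu : {measure set T -> \bar R}) (g : T -> R) :
  cint mu (fun y => (g y)%:C) = (\int[mu]_y g y)%:C.
Proof. by rewrite /cint /= /Rintegral integral0. Qed.

Lemma cintegrable_real d (T : measurableType d) (mu : {measure set T -> \bar R}) (g : T -> R) :
  mu.-integrable setT (EFin \o g) -> cintegrable mu (fun y => (g y)%:C).
Proof. by move=> ig; split => //; exact: integrable0. Qed.

Lemma dotvv x : dotv x x = \sum_(i < n) x ord0 i ^+ 2.
Proof. by apply: eq_bigr => i _; rewrite expr2. Qed.

Lemma enorm_sqr x : enorm x ^+ 2 = \sum_(i < n) x ord0 i ^+ 2.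
Proof. by rewrite /enorm sqr_sqrtr dotvv// sumr_ge0// => i _; exact: sqr_ge0. Qed.

Lemma enorm_ge0 x : 0 <= enorm x. Proof. exact: sqrtr_ge0. Qed.

Lemma cis_dotv x xi : cis (dotv x xi) = \prod_(i < n) cis (x ord0 i * xi ord0 i).
Proof. exact: cis_sum. Qed.

Lemma fourier_tens F xi : (forall i, bumpc (F i)) ->
  fourier (fun x => (tens F x)%:C) xi = \prod_(i < n) hat (F i) (xi ord0 i).
Proof.
move=> bF; rewrite -(@cintegral_tens R n (fun i t => (F i t)%:C * cis (- (t * xi ord0 i)))
  (fun i t => `|F i t|)).
- congr cintegral; apply/funext => x; rewrite /tens rmorph_prod.
  by rewrite /dotv -sumrN cis_sum -big_split.
- by move=> i; exact: cmeasurable_bump_cis.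
- by move=> i; exact: integrable_norm (bumpc_integrable (bF i)).
- by move=> i t; rewrite Normc.normcM normc_cis mulr1 normc_real.
Qed.

Variable s : R.
Hypothesis s0 : 0 < s.
Hypothesis s1 : s <= 1.

(** The integrand of the inverse Fourier transform for (1 - Delta)^(-s) applied to the product of
    the [F i], without the constant (2 pi)^(-n). *)
Definition negpow_term F x xi : R[i] :=
  ((1 + enorm xi ^+ 2) `^ (- s))%:C * \prod_(i < n) hat (F i) (xi ord0 i) * cis (dotv x xi).

(** The same integrand before integration over the Gaussian time e^tau: for fixed tau it is a
    product over the coordinates. The summand 1 of 1 + |xi|^2 is accounted for by the factor exp (-
    e^tau) in [gammak]. *)
Definition subordinand F x (z : measurableTypeR R * 'rV[R]_n) : R[i] := (gammak s z.1)%:C *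
  \prod_(i < n) ((gk (expR z.1) (z.2 ord0 i))%:C * hat (F i) (z.2 ord0 i) * cis (x ord0 i * z.2 ord0 i)).

Lemma q_ge1 xi : 1 <= 1 + enorm xi ^+ 2. Proof. by rewrite lerDl sqr_ge0. Qed.

Lemma measurable_coord_real i : measurable_fun setT (fun xi : 'rV[R]_n => xi ord0 i).
Proof. exact: measurable_coord_rV. Qed.

Lemma cmeasurable_hat_coord (f : R -> R) i : bumpc f ->
  cmeasurable (fun xi : 'rV[R]_n => hat f (xi ord0 i)).
Proof.
move=> bf; have [mr mi] := cmeasurable_hat bf; split.
  exact: (measurableT_comp mr (measurable_coord_rV i)).
exact: (measurableT_comp mi (measurable_coord_rV i)).
Qed.

Lemma negpow_termE F x xi :
  negpow_term F x xi = ((gammac s)^-1)%:C * cint mu1 (fun tau => subordinand F x (tau, xi)).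
Proof.
have qE := subordination s0 s1 (q_ge1 xi).
have c0 := gammac_gt0 s0 s1.
rewrite /negpow_term; have -> : (1 + enorm xi ^+ 2) `^ (- s) = (gammac s)^-1 *
    \int[mu1]_tau (expR (s * tau) * expR (- (expR tau * (1 + enorm xi ^+ 2)))).
  by rewrite -qE mulrA mulVf ?mul1r// gt_eqF.
rewrite rmorphM/= -cint_real -!mulrA; congr (_ * _).
rewrite mulrC -cintZl; last exact: cintegrable_real (integrable_subordination s0 s1 (q_ge1 xi)).
congr cint; apply/funext => tau; rewrite /subordinand/= !big_split/= cis_dotv.
have -> : expR (- (expR tau * (1 + enorm xi ^+ 2))) =
    expR (- expR tau) * \prod_(i < n) gk (expR tau) (xi ord0 i).
  rewrite mulrDr mulr1 opprD expRD; congr (_ * _).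
  by rewrite -expR_sum enorm_sqr mulr_sumr -sumrN.
rewrite mulrA rmorphM/= rmorph_prod -/(gammak s tau); ring.
Qed.

Lemma subordinand_bound F (b : 'I_n -> R -> R) x tau xi :
  (forall i t, Normc.normc (hat (F i) t) <= b i t) ->
  Normc.normc (subordinand F x (tau, xi)) <= gammak s tau * tens b xi.
Proof.
move=> hb; rewrite /subordinand Normc.normcM normc_real ger0_norm ?gammak_ge0//.
rewrite ler_wpM2l ?gammak_ge0// normc_prod /tens ler_prod// => i _.
rewrite normc_ge0 andTb !Normc.normcM normc_cis mulr1 normc_real ger0_norm ?gk_ge0//.
by apply: le_trans (hb i _); rewrite ler_piMl ?normc_ge0// gk_le1 ?expR_gt0.
Qed.

Lemma cmeasurable_subordinand F x : (forall i, bumpc (F i)) -> cmeasurable (subordinand F x).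
Proof.
move=> bF; apply: cmeasurableM.
  apply: cmeasurable_real.
  exact: (measurableT_comp (continuous_measurable_fun (@continuous_gammak R s)) measurable_fst).
have m2 i : measurable_fun setT (fun z : measurableTypeR R * 'rV[R]_n => z.2 ord0 i : R).
  exact: (measurableT_comp (measurable_coord_rV i) measurable_snd).
apply: cmeasurable_prod => i; apply: cmeasurableM; last first.
  by apply: cmeasurable_cis; apply: measurable_funM.
apply: cmeasurableM; last first.
  have [mr mi] := cmeasurable_hat_coord i (bF i); split.
    exact: (measurableT_comp mr measurable_snd).
  exact: (measurableT_comp mi measurable_snd).
apply: cmeasurable_real; apply: measurableT_comp => //.
apply: (measurableT_comp (@oppr_measurable R _)); apply: measurable_funM.
  by apply: (measurableT_comp (continuous_measurable_fun (@continuous_expR R))); exact: measurable_fst.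
exact: measurable_funX.
Qed.

End bessel_bump.

Section bessel_decay.
Local Open Scope complex_scope.
Context {R : realType} {n : nat}.
Local Notation mu1 := (@lebesgue_measure R).
Implicit Types (x xi : 'rV[R]_n) (F : 'I_n -> R -> R).

Definition poly_decay (m : nat) x : R := \prod_(i < n) ((1 + x ord0 i ^+ 2) ^+ m)^-1.

Section negpow_decay.
Variable s : R.
Hypothesis s0 : 0 < s.
Hypothesis s1 : s <= 1.

Lemma cintegrable_negpow_term F x : (forall i, bumpc (F i)) ->
  cintegrable (lebesgue_rV n) (negpow_term s F x).
Proof.
move=> bF.
have /choice[C hC] : forall i, exists C, forall t, Normc.normc (hat (F i) t) <= C * (1 + t ^+ 2)^-1.
  by move=> i; have [C C0 h] := hat_decay (bF i); exists C.
have ib i : mu1.-integrable setT (EFin \o (fun t : R => C i * (1 + t ^+ 2)^-1)).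
  exact: (integrableZl measurableT (C i) (@integrable_inv1Dsqr R)).
apply: cintegrable_dom (integrable_tens ib) _.
  rewrite /negpow_term; apply: cmeasurableM; last first.
    apply: cmeasurable_cis; apply: measurable_sum => i.
    by apply: measurable_funM => //; exact: measurable_coord_real.
  apply: cmeasurableM.
    apply: cmeasurable_real; apply: (measurableT_comp (measurable_powR (- s))).
    apply: measurable_funD => //; apply: measurable_funX; exact: measurable_enorm.
  by apply: cmeasurable_prod => i; exact: cmeasurable_hat_coord.
move=> xi; rewrite /negpow_term !Normc.normcM normc_cis mulr1 normc_real ger0_norm ?powR_ge0//.
apply: (@le_trans _ _ (1 * Normc.normc (\prod_(i < n) hat (F i) (xi ord0 i)))).
  rewrite ler_wpM2r ?normc_ge0// powRN invf_le1 ?powR_gt0//; last first.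
    by rewrite (lt_le_trans ltr01)// q_ge1.
  by rewrite -[leLHS](powRr0 (1 + enorm xi ^+ 2)) ler_powR ?q_ge1// ltW.
rewrite mul1r normc_prod /tens ler_prod// => i _.
by rewrite normc_ge0 andTb hC.
Qed.

(** Exchanging the integrals leaves, for each tau, a product of one-dimensional heat flows at time
    e^tau. Each of the n estimates loses (1 + e^tau)^(m + 1), and the total loss is absorbed by a
    moment of [gammak]. *)
Lemma negpow_term_decay F (m : nat) : (forall i, bumpc (F i)) ->
  exists2 C, 0 <= C & forall x,
    Normc.normc (cintegral (negpow_term s F x)) <= C * poly_decay m.+1 x.
Proof.
move=> bF.
have /choice[C hC] : forall i, exists C, forall t, Normc.normc (hat (F i) t) <= C * (1 + t ^+ 2)^-1.
  by move=> i; have [C C0 h] := hat_decay (bF i); exists C.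
have /choice[D hD] : forall i, exists D, 0 <= D /\ forall t u : R, 0 < t ->
    Normc.normc (heat (F i) t u) <= D * (1 + t) ^+ m.+1 * ((1 + u ^+ 2) ^+ m.+1)^-1.
  by move=> i; have [D D0 h] := heat_decay m (bF i); exists D.
have ib i : mu1.-integrable setT (EFin \o (fun t : R => C i * (1 + t ^+ 2)^-1)).
  exact: (integrableZl measurableT (C i) (@integrable_inv1Dsqr R)).
have c0 := gammac_gt0 s0 s1.
pose K := \int[mu1]_tau (gammak s tau * (1 + expR tau) ^+ (m.+1 * n)).
pose P := \prod_(i < n) D i.
have K0 : 0 <= K.
  by apply: Rintegral_ge0 => x _; rewrite mulr_ge0 ?gammak_ge0 ?exprn_ge0 ?addr_ge0 ?expR_ge0.
have P0 : 0 <= P by apply: prodr_ge0 => i _; have [] := hD i.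
exists ((gammac s)^-1 * (2 * (P * K))).
  by rewrite !mulr_ge0// invr_ge0 ltW.
move=> x.
pose W := subordinand s F x.
have mW : cmeasurable W := cmeasurable_subordinand s x bF.
have Wb tau xi : Normc.normc (W (tau, xi)) <= gammak s tau * tens (fun i t => C i * (1 + t ^+ 2)^-1) xi.
  exact: subordinand_bound.
have ig := integrable_gammak s0 s1.
have it := integrable_tens ib.
have WE xi : negpow_term s F x xi = ((gammac s)^-1)%:C * cint mu1 (fun tau => W (tau, xi)).
  exact: negpow_termE.
have iW : cintegrable (lebesgue_rV n) (fun xi => cint mu1 (fun tau => W (tau, xi))).
  have := cintegrableZl (gammac s)%:C (cintegrable_negpow_term x bF).
  rewrite (_ : (fun xi => _ * _) = (fun xi => cint mu1 (fun tau => W (tau, xi))))//.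
  by apply/funext => xi; rewrite WE mulrA -rmorphM/= mulfV ?mul1r// gt_eqF.
have -> : cintegral (negpow_term s F x) = ((gammac s)^-1)%:C *
    cint mu1 (fun tau => cint (lebesgue_rV n) (fun xi => W (tau, xi))).
  rewrite (cfubini mW ig it Wb) -cintZl//.
  by congr cint; apply/funext => xi; exact: WE.
rewrite Normc.normcM normc_real ger0_norm ?invr_ge0 ?(ltW c0)// -mulrA ler_wpM2l ?invr_ge0 ?(ltW c0)//.
have E tau : cint (lebesgue_rV n) (fun xi => W (tau, xi)) =
    (gammak s tau)%:C * \prod_(i < n) heat (F i) (expR tau) (x ord0 i).
  pose G (i : 'I_n) (t : R) : R[i] := (gk (expR tau) t)%:C * hat (F i) t * cis (x ord0 i * t).
  have mG i : @cmeasurable _ (measurableTypeR R) R (G i).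
    apply: cmeasurableM; last by apply: cmeasurable_cis; exact: measurable_funM.
    apply: cmeasurableM; last exact: cmeasurable_hat.
    by apply: cmeasurable_real; exact: (continuous_measurable_fun (@continuous_gk R (expR tau))).
  have Gb i t : Normc.normc (G i t) <= C i * (1 + t ^+ 2)^-1.
    rewrite !Normc.normcM normc_cis mulr1 normc_real ger0_norm ?gk_ge0//.
    by apply: le_trans (hC i t); rewrite ler_piMl ?normc_ge0// gk_le1 ?expR_gt0.
  rewrite /heat -(cintegral_tens mG ib Gb) /W /subordinand/= cintZl//.
  apply: cintegrable_dom it _; first exact: (cmeasurable_tens mG).
  by move=> xi; rewrite normc_prod ler_prod// => i _; rewrite normc_ge0 andTb; exact: Gb.
have hb tau : Normc.normc (cint (lebesgue_rV n) (fun xi => W (tau, xi))) <=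
    (P * poly_decay m.+1 x) * (gammak s tau * (1 + expR tau) ^+ (m.+1 * n)).
  rewrite E Normc.normcM normc_real ger0_norm ?gammak_ge0// mulrCA ler_wpM2l ?gammak_ge0//.
  rewrite normc_prod /P /poly_decay exprM -[X in _ * _ ^+ X](card_ord n) -prodr_const -!big_split.
  apply: ler_prod => i _; rewrite normc_ge0 andTb; have [_ h] := hD i.
  by apply: le_trans (h _ _ (expR_gt0 _)) _; rewrite mulrAC.
have iK := integrable_gammak_moment s0 s1 (m.+1 * n).
have := normc_cint (cmeasurable_cfubini_fst mW ig it Wb)
  (integrableZl measurableT (P * poly_decay m.+1 x) iK) hb.
move=> h; apply: le_trans h _; rewrite RintegralZl// -/K.
by rewrite le_eqVlt; apply/orP; left; apply/eqP; ring.
Qed.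

End negpow_decay.

Lemma bessel_bump_decay (sigma : R) (m : nat) : 0 < sigma < 2 ->
  exists2 C, 0 <= C & forall x,
    Normc.normc (bessel sigma (tens (fun=> bumpf)) x) <= C * poly_decay m.+1 x.
Proof.
move=> /andP[sg0 sg2]; pose s := 1 - sigma / 2.
have s0 : 0 < s by rewrite /s; lra.
have s1 : s <= 1 by rewrite /s; lra.
have bb := @bumpc_bump R.
have [f' bf' df] := bumpc_derive bb; have [f'' bf'' df'] := bumpc_derive bf'.
pose F0 (i : 'I_n) := @bumpf R.
(* The factors of the second derivative of the product in the direction j, which account for the
   term xi_j^2 of 1 + |xi|^2. *)
pose F (j i : 'I_n) := if i == j then f'' else @bumpf R.
have bF0 i : bumpc (F0 i) by [].
have bF j i : bumpc (F j i) by rewrite /F; case: ifP.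
have [C0 C00 h0] := negpow_term_decay s0 s1 m bF0.
have /choice[C hC] : forall j, exists C, 0 <= C /\ forall x,
    Normc.normc (cintegral (negpow_term s (F j) x)) <= C * poly_decay m.+1 x.
  by move=> j; have [C ? h] := negpow_term_decay s0 s1 m (bF j); exists C.
pose k : R := (2 * pi) ^- n.
have k0 : 0 <= k by rewrite invr_ge0 exprn_ge0// mulr_ge0// pi_ge0.
exists (k * (C0 + \sum_(j < n) C j)).
  by rewrite mulr_ge0// addr_ge0// sumr_ge0// => j _; have [] := hC j.
move=> x; rewrite /bessel /inv_fourier Normc.normcM normc_real ger0_norm// -mulrA ler_wpM2l//.
have E xi : (((1 + enorm xi ^+ 2) `^ (sigma / 2))%:C *
    fourier (fun y => (tens (fun=> @bumpf R) y)%:C) xi) * cis (dotv x xi) =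
    negpow_term s F0 x xi + (-1) * \sum_(j < n) negpow_term s (F j) x xi.
  rewrite fourier_tens//.
  have q0 : 0 < 1 + enorm xi ^+ 2 by rewrite (lt_le_trans ltr01)// q_ge1.
  have -> : (1 + enorm xi ^+ 2) `^ (sigma / 2) =
      (1 + enorm xi ^+ 2) `^ (- s) * (1 + enorm xi ^+ 2).
    rewrite -[X in _ = _ * X](powRr1 (ltW q0)) -powRD; last by apply/implyP => _; rewrite gt_eqF.
    by congr powR; rewrite /s; ring.
  rewrite /negpow_term; set A := (_ `^ (- s)); set B := \prod_(i < n) hat (F0 i) _.
  have BE j : \prod_(i < n) hat (F j i) (xi ord0 i) = - (xi ord0 j ^+ 2)%:C * B.
    rewrite /B (bigD1 j)//= [in RHS](bigD1 j)//= mulrA; congr (_ * _).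
      by rewrite /F eqxx (hat_derive2 _ bb bf' bf'' df df') rmorphN.
    by apply: eq_bigr => i /negPf ij; rewrite /F ij.
  under eq_bigr do rewrite BE.
  rewrite -mulr_suml -mulr_sumr -mulr_suml sumrN -rmorph_sum/= -enorm_sqr.
  rewrite -/B rmorphM/= rmorphD rmorph1; ring.
have [cs ics] := @cint_sum _ _ R (lebesgue_rV n) 'I_n (index_enum 'I_n) (fun j => negpow_term s (F j) x)
   (fun j => cintegrable_negpow_term s0 x (bF j)).
have -> : cintegral (fun xi => (((1 + enorm xi ^+ 2) `^ (sigma / 2))%:C *
    fourier (fun y => (tens (fun=> @bumpf R) y)%:C) xi) * cis (dotv x xi)) =
   cintegral (negpow_term s F0 x) + (-1) * \sum_(j < n) cintegral (negpow_term s (F j) x).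
  transitivity (cint (lebesgue_rV n) (fun xi => negpow_term s F0 x xi + (-1) * \sum_(j < n) negpow_term s (F j) x xi)).
    by congr cint; apply/funext => xi; exact: E.
  rewrite cintD ?cintZl ?cs//; first exact: cintegrable_negpow_term.
  exact: cintegrableZl.
apply: le_trans (le_normcD _ _) _; rewrite mulrDl lerD//.
rewrite mulN1r normcN; apply: le_trans (normc_sum _ _) _.
by rewrite mulr_suml ler_sum// => j _; have [_] := hC j; apply.
Qed.

End bessel_decay.

(** * Euclidean balls *)

Section euclidean_norm.
Context {R : realType} {n : nat}.
Implicit Types x y z : 'rV[R]_n.

Lemma enorm_eq0 x : enorm x = 0 -> x = 0.
Proof.
move=> x0; have : \sum_(i < n) x ord0 i ^+ 2 = 0 by rewrite -enorm_sqr x0 expr0n.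
move/eqP; rewrite psumr_eq0; last by move=> i _; exact: sqr_ge0.
move=> /allP h; apply/rowP => i; rewrite mxE.
by have := h i (mem_index_enum i); rewrite /= sqrf_eq0 => /eqP.
Qed.

(** Cauchy-Schwarz, by expanding the squared norm of |y| x - |x| y. *)
Lemma dotv_le_enorm x y : dotv x y <= enorm x * enorm y.
Proof.
have [/enorm_eq0->|x0] := eqVneq (enorm x) 0.
  rewrite /dotv big1 => [|i _]; last by rewrite mxE mul0r.
  by rewrite mulr_ge0// enorm_ge0.
have [/enorm_eq0->|y0] := eqVneq (enorm y) 0.
  rewrite /dotv big1 => [|i _]; last by rewrite mxE mulr0.
  by rewrite mulr_ge0// enorm_ge0.
have xy : 0 < enorm x * enorm y by rewrite mulr_gt0// lt0r ?x0 ?y0 enorm_ge0.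
have : 0 <= \sum_(i < n) (enorm y * x ord0 i - enorm x * y ord0 i) ^+ 2.
  by apply: sumr_ge0 => i _; exact: sqr_ge0.
rewrite (eq_bigr (fun i => (enorm y ^+ 2 * x ord0 i ^+ 2 + enorm x ^+ 2 * y ord0 i ^+ 2) -
   (2 * (enorm x * enorm y)) * (x ord0 i * y ord0 i))); last by move=> i _; ring.
rewrite big_split big_split/= sumrN -!mulr_sumr -!enorm_sqr -/(dotv x y) => h.
have : 0 <= (enorm x * enorm y) * (enorm x * enorm y - dotv x y) by nra.
by rewrite pmulr_rge0// subr_ge0.
Qed.

Lemma enormD x y : enorm (x + y) <= enorm x + enorm y.
Proof.
rewrite -(ler_sqr (enorm_ge0 _)) ?nnegrE ?addr_ge0 ?enorm_ge0//.
rewrite enorm_sqr.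
rewrite (eq_bigr (fun i => x ord0 i ^+ 2 + y ord0 i ^+ 2 + 2 * (x ord0 i * y ord0 i))); last first.
  by move=> i _; rewrite mxE; ring.
rewrite !big_split/= -mulr_sumr -!enorm_sqr -/(dotv x y).
have := dotv_le_enorm x y; nra.
Qed.

Lemma enormN x : enorm (- x) = enorm x.
Proof. by rewrite /enorm /dotv; congr Num.sqrt; apply: eq_bigr => i _; rewrite !mxE mulrNN. Qed.

Lemma enorm0 : enorm (0 : 'rV[R]_n) = 0.
Proof. by rewrite /enorm /dotv big1 ?sqrtr0// => i _; rewrite mxE mul0r. Qed.

Lemma enorm_distC x y : enorm (x - y) = enorm (y - x).
Proof. by rewrite -enormN opprB. Qed.

Lemma enorm_triangle z x y : enorm (x - y) <= enorm (x - z) + enorm (z - y).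
Proof. by rewrite -[x - y](subrKA z); exact: enormD. Qed.

Lemma coord_le_enorm x i : `|x ord0 i| <= enorm x.
Proof.
rewrite -(ler_sqr (normr_ge0 _)) ?nnegrE ?enorm_ge0// real_normK ?num_real//.
rewrite enorm_sqr (bigD1 i)//= lerDl; apply: sumr_ge0 => j _; exact: sqr_ge0.
Qed.

Lemma enorm_le_coord x (r : R) : 0 <= r -> (forall i, `|x ord0 i| <= r) ->
  enorm x <= n%:R * r.
Proof.
move=> r0 h; rewrite -(ler_sqr (enorm_ge0 _)) ?nnegrE ?mulr_ge0// enorm_sqr.
apply: (@le_trans _ _ (\sum_(i < n) r ^+ 2)).
  by apply: ler_sum => i _; rewrite -real_normK ?num_real// lerXn2r ?nnegrE.
rewrite sumr_const card_ord exprMn -[leLHS]mulr_natl ler_wpM2r ?sqr_ge0//.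
by rewrite -natrX ler_nat -mulnn; case: (n) => // m; rewrite leq_pmull.
Qed.

Lemma measurable_enormB z : measurable_fun setT (fun x => enorm (x - z)).
Proof.
apply: (measurableT_comp (continuous_measurable_fun (@sqrt_continuous R))).
by apply: measurable_sum => i; apply: measurable_funM;
  under eq_fun do rewrite mxE; apply: measurable_funD => //; exact: measurable_coord_real.
Qed.

Lemma measurable_eball z r : measurable (eball z r).
Proof.
rewrite (_ : eball z r = setT `&` (fun x => enorm (x - z)) @^-1` [set t | t < r]).
  by apply: measurable_enormB => //; rewrite -set_itvNyo; exact: measurable_itv.
by rewrite setTI.
Qed.

End euclidean_norm.

Section box.
Context {R : realType} {n : nat}.
Implicit Types c x : 'rV[R]_n.

(** Being products of intervals, cubes have a measure given by [ge0_integral_tens]; Euclidean balls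
    are only compared with them. *)
Definition box c (r : R) : set 'rV[R]_n := [set x | forall i, `|x ord0 i - c ord0 i| <= r].

Lemma indic_box c r x :
  \1_(box c r) x = tens (fun i => \1_(`[c ord0 i - r, c ord0 i + r]%classic : set R)) x :> R.
Proof.
rewrite indicE /tens; have [xb|xb] := boolP (x \in box c r).
  rewrite big1// => i _; rewrite indicE mem_set//=.
  by move: xb; rewrite inE => /(_ i); rewrite in_itv/= -ler_distl.
apply/esym/eqP/prodf_eq0; move: xb; rewrite notin_setE => /existsNP[i xi].
exists i => //; rewrite indicE memNset//=.
by rewrite in_itv/= -ler_distl; exact: xi.
Qed.

Lemma measurable_box c r : measurable (box c r).
Proof.
rewrite (_ : box c r = \bigcap_(i in [set: 'I_n]) ((fun x => x ord0 i) @^-1` `[c ord0 i - r, c ord0 i + r]%classic)).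
  apply: fin_bigcap_measurable => // i _; rewrite -[X in measurable X]setTI.
  by apply: measurable_coord_real => //; exact: measurable_itv.
apply/seteqP; split=> x /= h i; first by move=> _; rewrite /= in_itv/= -ler_distl; exact: h.
by have := h i Logic.I; rewrite /= in_itv/= -ler_distl.
Qed.

Lemma lebesgue_box c r : 0 <= r -> lebesgue_rV n (box c r) = ((2 * r) ^+ n)%:E.
Proof.
move=> r0; rewrite -[box c r]setIT -integral_indic//; last exact: measurable_box.
under eq_integral do rewrite indic_box.
rewrite ge0_integral_tens//.
rewrite (eq_bigr (fun=> (2 * r)%:E)); first by rewrite prodEFin prodr_const card_ord.
move=> i _; rewrite integral_indic//= setIT lebesgue_measure_itv/= lte_fin.
case: ltP => [_|h]; first by rewrite -EFinB; congr EFin; ring.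
by have -> : r = 0 by [lra]; rewrite mulr0.
Qed.

Lemma eball_sub_box c r : eball c r `<=` box c r.
Proof.
move=> x /= xr i; apply: ltW; apply: le_lt_trans xr.
by have := coord_le_enorm (x - c) i; rewrite !mxE.
Qed.

(** Dividing by n + 1 rather than n makes the inequality strict, as the ball is open, and covers n =
    0. *)
Lemma box_sub_eball c r : 0 < r -> box c (r / n.+1%:R) `<=` eball c r.
Proof.
move=> r0 x /= xb; have n0 : (0 : R) < n.+1%:R by rewrite ltr0n.
apply: (@le_lt_trans _ _ (n%:R * (r / n.+1%:R))).
  apply: enorm_le_coord; first by rewrite divr_ge0 ?ltW.
  by move=> i; rewrite !mxE; exact: xb.
by rewrite mulrCA gtr_pMr// ltr_pdivrMr// mul1r ltr_nat.
Qed.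

Lemma lebesgue_eball_le c r : 0 <= r -> (lebesgue_rV n (eball c r) <= ((2 * r) ^+ n)%:E)%E.
Proof.
move=> r0; rewrite -(lebesgue_box c r0); apply: le_measure; rewrite ?inE.
- exact: measurable_eball.
- exact: measurable_box.
- exact: eball_sub_box.
Qed.

Lemma lebesgue_eball_ge c r : 0 < r ->
  (((2 * r / n.+1%:R) ^+ n)%:E <= lebesgue_rV n (eball c r))%E.
Proof.
move=> r0; rewrite -mulrA -(lebesgue_box c); last by rewrite divr_ge0 ?ltW.
apply: le_measure; rewrite ?inE.
- exact: measurable_box.
- exact: measurable_eball.
- exact: box_sub_eball.
Qed.

Lemma lebesgue_eball_fin c r : 0 < r -> exists2 m : R, 0 < m & lebesgue_rV n (eball c r) = m%:E.
Proof.
move=> r0; have h1 := lebesgue_eball_le c (ltW r0); have h2 := lebesgue_eball_ge c r0.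
have f : lebesgue_rV n (eball c r) \is a fin_num.
  by rewrite ge0_fin_numE// (le_lt_trans h1)// ltry.
exists (fine (lebesgue_rV n (eball c r))); last by rewrite fineK.
rewrite -lte_fin fineK//; apply: lt_le_trans h2; rewrite lte_fin exprn_gt0//.
by rewrite divr_gt0// mulr_gt0.
Qed.

End box.

(** * Muckenhoupt weights *)

Section integral_scale_nonmeasurable.
Import HBNNSimple.

(** A simple function below k f becomes, after division by k, a simple function below f. *)
Lemma ge0_le_integralZl_nonmeas d (T : measurableType d) (R : realType)
    (mu : {measure set T -> \bar R}) (D : set T) (k : R) (f : T -> \bar R) :
  0 < k -> (forall x, D x -> (0 <= f x)%E) ->
  (\int[mu]_(x in D) (k%:E * f x) <= k%:E * \int[mu]_(x in D) f x)%E.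
Proof.
move=> k0 f0; rewrite !ge0_integralE//; last first.
  by move=> x Dx; rewrite mule_ge0 ?f0// lee_fin ltW.
apply: ge_ereal_sup => _ [h hf <-].
have k1 : (0 <= k^-1)%R by rewrite invr_ge0 ltW.
rewrite -lee_pdivrMl// -sintegralrM.
apply: ereal_sup_ubound; exists (scale_nnsfun h k1) => [x|]; last first.
  by apply: eq_sintegral.
rewrite /= EFinM lee_pdivrMl//; apply: le_trans (hf x) _; rewrite /patch.
by case: ifPn => // _; rewrite mule0.
Qed.

End integral_scale_nonmeasurable.

Lemma geometric_nneseries (R : realType) (A r : R) : 0 <= r -> r < 1 ->
  (\sum_(0 <= j <oo) (A * r ^+ j)%:E = (A / (1 - r))%:E)%E.
Proof.
move=> r0 r1; apply/cvg_lim => //.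
rewrite (_ : (fun _ => _) = EFin \o series (geometric A r)).
  by apply: cvg_EFin; [exact: nearW|apply: cvg_geometric_series; rewrite ger0_norm].
by apply/funext => N; rewrite /= sumEFin.
Qed.

Lemma powR_invr (R : realType) (x b : R) : 0 <= x -> x^-1 `^ b = (x `^ b)^-1.
Proof. by move=> x0; rewrite -powR_inv1// -powRrM mulN1r powRN. Qed.

Lemma powR_exprn (R : realType) (x b : R) k : 0 <= x -> (x ^+ k) `^ b = (x `^ b) ^+ k.
Proof. by move=> x0; rewrite -powR_mulrn// -powRrM mulrC powRrM powR_mulrn ?powR_ge0. Qed.

(** * Means of negative powers of the distance to a point *)

Section power_mean.
Context {R : realType} {n : nat}.
Implicit Types x y z : 'rV[R]_n.
Variable b : R.
Hypothesis b0 : 0 <= b.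
Hypothesis bn : b < n%:R.

(* The annulus containing y bounds the left-hand side; at y = z the series
   diverges, so that the bound also holds at the singularity. *)
Lemma inv_dist_le_dyadic z (rho : R) y : 0 < rho -> eball z rho y ->
  (((enorm (y - z) `^ b)%:E)^-1 <= \sum_(0 <= j <oo)
     ((((rho / 2 ^+ j.+1) `^ b)^-1 * \1_(eball z (rho / 2 ^+ j)) y)%R%:E))%E.
Proof.
move=> rho0 yB; pose c (j : nat) : R := ((rho / 2 ^+ j.+1) `^ b)^-1 * \1_(eball z (rho / 2 ^+ j)) y.
rewrite -[X in (_ <= X)%E]/(\sum_(0 <= j <oo) (c j)%:E)%E.
have c0 j : (0 <= (c j)%:E)%E.
  by rewrite lee_fin mulr_ge0// invr_ge0 powR_ge0.
have pj j : 0 < rho / 2 ^+ j by rewrite divr_gt0// exprn_gt0.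
have [d0|d0] := eqVneq (enorm (y - z)) 0.
  suff -> : (\sum_(0 <= j <oo) (c j)%:E = +oo)%E by rewrite leey.
  apply/eqyP => A A0; pose e : R := (rho `^ b)^-1.
  have e0 : 0 < e by rewrite invr_gt0 powR_gt0.
  have [N AN] : exists N : nat, A <= N%:R * e.
    exists (Num.truncn (A / e)).+1; rewrite -ler_pdivrMr//; exact: ltW (truncnS_gt _).
  apply: le_trans (nneseries_lim_ge N _); last by [].
  apply: (@le_trans _ _ (N%:R * e)%:E); first by rewrite lee_fin.
  rewrite sumEFin lee_fin mulr_natl -[X in _ *+ X]subn0 -sumr_const_nat.
  apply: ler_sum => j _; rewrite /c indicE mem_set; last by rewrite /eball/= d0.
  rewrite mulr1 lef_pV2 ?posrE ?powR_gt0//; apply: ge0_ler_powR => //.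
  - by rewrite nnegrE ltW.
  - by rewrite nnegrE ltW.
  by rewrite ler_pdivrMr ?exprn_gt0// ler_peMr ?(ltW rho0)// exprn_ege1// ler1n.
have d1 : 0 < enorm (y - z) by rewrite lt0r d0 enorm_ge0.
have ex : exists j : nat, rho / 2 ^+ j.+1 <= enorm (y - z).
  exists (Num.truncn (rho / enorm (y - z))); rewrite ler_pdivrMr ?exprn_gt0//.
  rewrite mulrC -ler_pdivrMr//; apply: ltW; apply: lt_le_trans (truncnS_gt _) _.
  by rewrite -natrX ler_nat ltnW// ltn_expl.
have [j jP jmin] := ex_minnP ex.
have yj : eball z (rho / 2 ^+ j) y.
  case: j jP jmin => [|j] jP jmin; first by rewrite expr0 divr1.
  by rewrite /eball/= ltNge; apply/negP => /jmin; rewrite ltnn.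
rewrite inver gt_eqF ?powR_gt0//.
apply: (@le_trans _ _ (c j)%:E).
  rewrite lee_fin /c indicE mem_set// mulr1 lef_pV2 ?posrE ?powR_gt0//.
  by apply: ge0_ler_powR => //; rewrite nnegrE ltW.
apply: le_trans (nneseries_lim_ge j.+1 _); last by [].
by rewrite big_nat_recr//= leeDr// sume_ge0.
Qed.

(** The j-th dyadic ball contributes a multiple of (2^b / 2^n)^j, and the geometric series converges
    because b < n. *)
Lemma integral_inv_dist_eball : exists2 C : R, 0 <= C & forall z rho, 0 < rho ->
  (\int[lebesgue_rV n]_(y in eball z rho) ((enorm (y - z) `^ b)%:E)^-1 <=
    (C * rho `^ (n%:R - b))%:E)%E.
Proof.
pose r : R := 2 `^ b / 2 ^+ n.
have r0 : 0 <= r by rewrite divr_ge0 ?powR_ge0 ?exprn_ge0.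
have r1 : r < 1.
  rewrite ltr_pdivrMr ?exprn_gt0// mul1r -powR_mulrn// /powR pnatr_eq0/= ltr_expR.
  by rewrite ltr_pM2r ?ln_gt0 ?ltr1n.
exists (2 `^ b * 2 ^+ n / (1 - r)).
  by rewrite divr_ge0 ?subr_ge0 ?(ltW r1)// mulr_ge0 ?powR_ge0 ?exprn_ge0.
move=> z rho rho0.
pose c (j : nat) : R := ((rho / 2 ^+ j.+1) `^ b)^-1.
have c0 j : 0 <= c j by rewrite invr_ge0 powR_ge0.
apply: (@le_trans _ _ (\int[lebesgue_rV n]_y \sum_(0 <= j <oo)
     (c j * \1_(eball z (rho / 2 ^+ j)) y)%R%:E)%E).
  apply: (@le_trans _ _ (\int[lebesgue_rV n]_(y in eball z rho) \sum_(0 <= j <oo)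
     (c j * \1_(eball z (rho / 2 ^+ j)) y)%R%:E)%E).
    apply: ge0_le_integral_nonmeas => y yB; last exact: inv_dist_le_dyadic.
    by rewrite inve_ge0 lee_fin powR_ge0.
  apply: ge0_integral_subset_nonmeas => // y _.
  by apply: nneseries_ge0 => j _ _; rewrite lee_fin mulr_ge0.
have mB j : measurable (eball z (rho / 2 ^+ j)) by exact: measurable_eball.
rewrite integral_nneseries//; last 2 first.
- by move=> j; apply/measurable_EFinP; apply: measurable_funM => //; exact: measurable_indic.
- by move=> j y _; rewrite lee_fin mulr_ge0.
rewrite (_ : 2 `^ b * 2 ^+ n / (1 - r) * rho `^ (n%:R - b) =
  (2 `^ b * 2 ^+ n * rho `^ (n%:R - b)) / (1 - r)); last by ring.
rewrite -geometric_nneseries//; apply: lee_nneseries => j _.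
  by move=> _; apply: integral_ge0 => y _; rewrite lee_fin mulr_ge0.
under eq_integral do rewrite EFinM.
rewrite ge0_integralZl_EFin//; last exact/measurable_EFinP/measurable_indic.
rewrite integral_indic// setIT.
have pj : 0 <= rho / 2 ^+ j by rewrite divr_ge0 ?exprn_ge0 ?ltW.
apply: le_trans (lee_wpmul2l _ (lebesgue_eball_le z pj)) _; first by rewrite lee_fin.
rewrite -EFinM lee_fin /c le_eqVlt; apply/orP; left; apply/eqP.
have E1 : (rho / 2 ^+ j.+1) `^ b = rho `^ b / (2 `^ b) ^+ j.+1.
  rewrite powRM ?invr_ge0 ?exprn_ge0 ?(ltW rho0)//; congr (_ * _).
  by rewrite powR_invr ?exprn_ge0// powR_exprn.
have E2 : rho `^ (n%:R - b) = rho ^+ n / rho `^ b.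
  rewrite powRD; last by apply/implyP => _; rewrite gt_eqF.
  by rewrite powRN powR_mulrn// ltW.
rewrite E1 E2 /r !exprMn !exprVn -!exprM exprS.
have P : (0 : R) < 2 `^ b by rewrite powR_gt0.
have P' : 0 < rho `^ b by rewrite powR_gt0.
rewrite invfM invrK [(j * n)%N]mulnC; field.
by rewrite !gt_eqF ?exprn_gt0.
Qed.

Section mean_bounds.
Variables (c : 'rV[R]_n) (r : R).
Hypothesis r0 : 0 < r.
Implicit Types (f g : 'rV[R]_n -> \bar R).

Lemma le_mean f g : (forall x, eball c r x -> (0 <= f x <= g x)%E) ->
  (mean c r f <= mean c r g)%E.
Proof.
move=> fg; rewrite /mean; apply: lee_wpmul2l; first by rewrite inve_ge0.
by apply: ge0_le_integral_nonmeas => x /fg /andP[].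
Qed.

Lemma mean_ge0 f : (forall x, eball c r x -> (0 <= f x)%E) -> (0 <= mean c r f)%E.
Proof.
by move=> f0; rewrite /mean mule_ge0 ?inve_ge0//; apply: integral_ge0 => x /f0.
Qed.

Lemma mean_le_integral f (K : R) :
  (\int[lebesgue_rV n]_(x in eball c r) f x <= K%:E * lebesgue_rV n (eball c r))%E ->
  (mean c r f <= K%:E)%E.
Proof.
rewrite /mean; have [m m0 ->] := lebesgue_eball_fin c r0 => h.
by rewrite inver gt_eqF// lee_pdivrMl// muleC.
Qed.

Lemma mean_le_cst f (K : R) :
  (forall x, eball c r x -> (0 <= f x <= K%:E)%E) -> (mean c r f <= K%:E)%E.
Proof.
move=> fK; apply: mean_le_integral => //.
rewrite -integral_cst; last exact: measurable_eball.
by apply: ge0_le_integral_nonmeas => x /fK /andP[].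
Qed.

Lemma le_meanZ (k : R) f : 0 < k -> (forall x, eball c r x -> (0 <= f x)%E) ->
  (mean c r (fun x => k%:E * f x) <= k%:E * mean c r f)%E.
Proof.
move=> k0 f0; rewrite /mean muleCA; apply: lee_wpmul2l; first by rewrite inve_ge0.
exact: ge0_le_integralZl_nonmeas.
Qed.

End mean_bounds.

(** If |x0 - z| >= 2 r, then |y - z| >= |x0 - z| / 2 on the ball and the function is bounded there
    by the required size. Otherwise the ball lies in the one of radius 3 r around z, and the
    integral over the latter has the right order r^(n - b). *)
Lemma mean_inv_dist : exists2 C : R, 0 <= C & forall z x0 r, 0 < r ->
  (mean x0 r (fun y => ((enorm (y - z) `^ b)%:E)^-1) <=
    (C * (Num.max (enorm (x0 - z)) r) `^ (- b))%:E)%E.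
Proof.
have [C C0 hC] := integral_inv_dist_eball.
pose C1 := C * 3 `^ (n%:R - b) * n.+1%:R ^+ n.
have C10 : 0 <= C1 by rewrite !mulr_ge0 ?powR_ge0 ?exprn_ge0.
exists (2 `^ b * (1 + C1)); first by rewrite mulr_ge0 ?powR_ge0 ?addr_ge0.
move=> z x0 r r0; set D := enorm (x0 - z); set s := Num.max D r.
have s0 : 0 < s by rewrite lt_max r0 orbT.
have [Dr|Dr] := leP (2 * r) D.
  have sD : s = D by apply: max_l; lra.
  have D0 : 0 < D by lra.
  apply: mean_le_cst => // y yB; rewrite inve_ge0 lee_fin powR_ge0/=.
  have yD : D / 2 <= enorm (y - z).
    have := enorm_triangle y x0 z; rewrite -/D [enorm (x0 - y)]enorm_distC.
    by move: yB; rewrite /eball/=; lra.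
  have y0 : 0 < enorm (y - z) by apply: lt_le_trans yD; rewrite divr_gt0.
  rewrite inver gt_eqF ?powR_gt0// lee_fin sD.
  apply: (@le_trans _ _ (2 `^ b * D `^ (- b))); last first.
    by rewrite ler_wpM2r ?powR_ge0// ler_peMr ?powR_ge0// lerDl.
  rewrite powRN -ler_pdivrMl ?powR_gt0// -invfM lef_pV2 ?posrE ?mulr_gt0 ?powR_gt0//.
  rewrite -powRM ?(ltW y0)//; apply: ge0_ler_powR => //; rewrite ?nnegrE ?mulr_ge0 ?(ltW y0) ?(ltW D0)//; lra.
have s2r : s <= 2 * r by rewrite /s ge_max; apply/andP; split; lra.
apply: mean_le_integral => //.
have r3 : 0 < 3 * r by rewrite mulr_gt0.
apply: (@le_trans _ _ (C * (3 * r) `^ (n%:R - b))%:E).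
  apply: le_trans (hC z _ r3); apply: ge0_integral_subset_nonmeas => [y _|y].
    by rewrite inve_ge0 lee_fin powR_ge0.
  rewrite /eball/= => yB; have := enorm_triangle x0 y z; rewrite -/D; lra.
apply: (@le_trans _ _ ((2 `^ b * (1 + C1) * s `^ (- b))%:E * ((2 * r / n.+1%:R) ^+ n)%:E)%E); last first.
  apply: lee_wpmul2l; last exact: lebesgue_eball_ge.
  by rewrite lee_fin !mulr_ge0 ?powR_ge0 ?addr_ge0.
rewrite -EFinM lee_fin.
apply: (@le_trans _ _ (2 `^ b * C1 * (2 * r) `^ (- b) * (r / n.+1%:R) ^+ n)); last first.
  apply: ler_pM; rewrite ?mulr_ge0 ?powR_ge0 ?exprn_ge0 ?divr_ge0 ?(ltW r0)//.
    apply: ler_pM; rewrite ?mulr_ge0 ?powR_ge0//.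
      by rewrite ler_wpM2l ?powR_ge0// lerDr.
    rewrite !powRN lef_pV2 ?posrE ?powR_gt0 ?mulr_gt0//.
    by apply: ge0_ler_powR => //; rewrite nnegrE ltW// mulr_gt0.
  apply: lerXn2r; rewrite ?nnegrE ?divr_ge0 ?mulr_ge0 ?(ltW r0)//.
  rewrite ler_wpM2r ?invr_ge0//; lra.
have E2 : r `^ (n%:R - b) = r ^+ n / r `^ b.
  rewrite powRD; last by apply/implyP => _; rewrite gt_eqF.
  by rewrite powRN powR_mulrn// ltW.
rewrite powRM ?(ltW r0)// powRN powRM ?(ltW r0)// E2 /C1 exprMn exprVn le_eqVlt.
apply/orP; left; apply/eqP; field.
by rewrite !gt_eqF ?exprn_gt0 ?powR_gt0// ltr0n.
Qed.

(** With s the maximum of |x0 - z| and r, every x in the ball satisfies |x - z| <= 2 s, so it is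
    enough to bound the mean by a multiple of (1 + 2 s)^(-b). For s < 1 the mean is at most 1 and 1
    + 2 s <= 3. For s >= 1 the function is below |y - z|^(-b), whose mean is of order s^(-b), and 1
    + 2 s <= 3 s. *)
Lemma bump_weight_A1 : exists2 C : R, 0 <= C & forall z x0 r x, 0 < r -> eball x0 r x ->
  (mean x0 r (fun y => ((1 + enorm (y - z)) `^ (- b))%:E) <=
    (C * (1 + enorm (x - z)) `^ (- b))%:E)%E.
Proof.
have [C C0 hC] := mean_inv_dist.
exists (3 `^ b * (1 + C)); first by rewrite mulr_ge0 ?powR_ge0 ?addr_ge0.
move=> z x0 r x r0 xB; pose s := Num.max (enorm (x0 - z)) r.
have s0 : 0 < s by rewrite lt_max r0 orbT.
have pos y : 0 < 1 + enorm (y - z) by rewrite ltr_pwDl ?enorm_ge0.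
have xs : enorm (x - z) <= 2 * s.
  have := enorm_triangle x0 x z; move: xB; rewrite /eball/=.
  have : enorm (x0 - z) <= s by rewrite le_max lexx.
  have : r <= s by rewrite le_max lexx orbT.
  lra.
have tx : (1 + 2 * s) `^ (- b) <= (1 + enorm (x - z)) `^ (- b).
  have s2 : 0 < 1 + 2 * s by rewrite addr_gt0// mulr_gt0.
  rewrite !powRN lef_pV2 ?posrE ?powR_gt0//.
  apply: ge0_ler_powR => //; rewrite ?nnegrE ?lerD2l ?(ltW (pos _))//.
  by rewrite addr_ge0// mulr_ge0// ltW.
suff : (mean x0 r (fun y => ((1 + enorm (y - z)) `^ (- b))%:E) <=
    (3 `^ b * (1 + C) * (1 + 2 * s) `^ (- b))%:E)%E.
  move=> h; apply: le_trans h _; rewrite lee_fin ler_wpM2l// mulr_ge0 ?powR_ge0 ?addr_ge0//.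
have P3 : (0 : R) < 3 `^ b by rewrite powR_gt0.
have [s1|s1] := ltP s 1.
  apply: (@le_trans _ _ 1%:E).
    apply: mean_le_cst => // y _; rewrite lee_fin powR_ge0/= lee_fin powRN invf_le1 ?powR_gt0//.
    rewrite -[leLHS](powRr0 (1 + enorm (y - z))) ler_powR// lerDl enorm_ge0//.
  rewrite lee_fin mulrAC -[leLHS]mulr1; apply: ler_pM => //; last by rewrite lerDl.
  rewrite powRN ler_pdivlMr ?powR_gt0 ?addr_gt0 ?mulr_gt0// mul1r.
  by apply: ge0_ler_powR => //; rewrite ?nnegrE ?addr_ge0 ?mulr_ge0 ?(ltW s0)//; lra.
apply: (@le_trans _ _ (C * s `^ (- b))%:E).
  apply: le_trans (hC z x0 r r0); apply: le_mean => // y _.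
  rewrite lee_fin powR_ge0/= inver; case: eqP => [_|/eqP y0]; first by rewrite leey.
  have {}y0 : 0 < enorm (y - z) `^ b by rewrite lt0r y0 powR_ge0.
  rewrite lee_fin powRN lef_pV2 ?posrE ?(powR_gt0 _ (pos _))//.
  by apply: ge0_ler_powR => //; rewrite ?nnegrE ?enorm_ge0 ?(ltW (pos _))// lerDr.
rewrite lee_fin mulrAC [leLHS]mulrC; apply: ler_pM; rewrite ?powR_ge0 ?lerDr//.
rewrite !powRN ler_pdivlMr ?powR_gt0 ?addr_gt0 ?mulr_gt0// mulrC ler_pdivrMr ?powR_gt0//.
rewrite -powRM ?(ltW s0)//; apply: ge0_ler_powR => //; rewrite ?nnegrE ?addr_ge0 ?mulr_ge0 ?(ltW s0)//; lra.
Qed.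

End power_mean.

(** * Products of a power of |x| and an A_1 weight *)

Section Ap_weights.
Context {R : realType} {n : nat}.
Implicit Types x y z : 'rV[R]_n.
Variables (p a A K C1 : R) (u : 'rV[R]_n -> R).
Hypothesis p1 : 1 < p.
Hypothesis a0 : 0 <= a.
Hypothesis an : a < n%:R * (p - 1).
Hypothesis A0 : 0 <= A.
Hypothesis mu : measurable_fun setT u.
Hypothesis u0 : forall x, 0 < u x.
Hypothesis uK : forall x, u x <= K * (1 + enorm x) `^ A.
Hypothesis A1 : forall c r x, 0 < r -> eball c r x ->
  (mean c r (EFin \o u) <= (C1 * u x)%:E)%E.

Local Notation w := (fun x : 'rV[R]_n => enorm x `^ a * u x).

Lemma weight_ge0 x : 0 <= w x.
Proof. by rewrite mulr_ge0 ?powR_ge0// ltW. Qed.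

Lemma weight_le x : w x <= K * (1 + enorm x) `^ (a + A).
Proof.
have e1 : 0 < 1 + enorm x by rewrite ltr_pwDl ?enorm_ge0.
rewrite powRD; last by apply/implyP => _; rewrite gt_eqF.
rewrite mulrCA; apply: ler_pM; rewrite ?powR_ge0 ?(ltW (u0 _))//.
by apply: ge0_ler_powR => //; rewrite ?nnegrE ?enorm_ge0 ?(ltW e1)// lerDr.
Qed.

Lemma measurable_weight : measurable_fun setT w.
Proof.
apply: measurable_funM => //.
exact: (measurableT_comp (measurable_powR a) (@measurable_enorm R n)).
Qed.

Lemma weight_locally_integrable (D : set 'rV[R]_n) : compact D ->
  (\int[lebesgue_rV n]_(x in D) `|w x|%:E < +oo)%E.
Proof.
move=> /compact_bounded [M [_ hM]].
pose M' := `|M| + 1; have M'0 : 0 <= M' by rewrite addr_ge0.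
have {}hM x : D x -> box 0 M' x.
  move=> Dx i; rewrite mxE subr0; apply: le_trans (hM M' _ x Dx).
    by rewrite /Num.norm/= mx_normrE; exact: (le_bigmax _ (fun ij => `|x ij.1 ij.2|) (ord0, i)).
  by rewrite (le_lt_trans (ler_norm M))// ltrDl.
pose N := K * (1 + n%:R * M') `^ (a + A).
have K0 : 0 <= K.
  by have := le_trans (ltW (u0 0)) (uK 0); rewrite enorm0 addr0 powR1 mulr1.
apply: (@le_lt_trans _ _ (\int[lebesgue_rV n]_(x in box 0 M') N%:E)%E); last first.
  have lb := lebesgue_box (0 : 'rV[R]_n) M'0.
  rewrite (integral_cst (lebesgue_rV n) (measurable_box 0 M') N%:E).
  have : (N%:E * ((2 * M') ^+ n)%:E < +oo)%E by rewrite -EFinM ltry.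
  by rewrite -lb.
have N0 : (0 <= N)%R by rewrite mulr_ge0 ?powR_ge0.
apply: (@le_trans _ _ (\int[lebesgue_rV n]_(x in D) N%:E)%E); last first.
  by apply: ge0_integral_subset_nonmeas.
apply: ge0_le_integral_nonmeas => x Dx; rewrite lee_fin// ger0_norm ?weight_ge0//.
apply: le_trans (weight_le x) _; rewrite ler_wpM2l//.
apply: ge0_ler_powR; rewrite ?nnegrE ?addr_ge0 ?enorm_ge0 ?mulr_ge0// lerD2l.
apply: enorm_le_coord => // i.
by have := hM _ Dx i; rewrite mxE subr0.
Qed.

(** Let s be the maximum of |c| and r. On the ball |x|^a <= (2 s)^a, which leaves the mean m of u in
    the first factor. In the second one A_1 gives u >= m / C1, which leaves the mean of |x|^(-a / (p
    - 1)), of order s^(-a / (p - 1)) since a / (p - 1) < n. After raising to the power p - 1, both s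
    and m cancel. *)
Lemma Ap_power_A1 : Ap p w.
Proof.
have p0 : 0 < p - 1 by rewrite subr_gt0.
pose q := (p - 1)^-1; have q0 : 0 < q by rewrite invr_gt0.
have aq0 : 0 <= a * q by rewrite mulr_ge0// ltW.
have aqn : a * q < n%:R by rewrite ltr_pdivrMr.
have [C C0 hC] := mean_inv_dist aq0 aqn.
split; [exact: measurable_weight|exact: weight_locally_integrable|exact: weight_ge0|].
apply: (@le_lt_trans _ _ (2 `^ a * C1 * C `^ (p - 1))%:E); last by rewrite ltry.
apply: ge_ereal_sup => _ [[c r] /= r0 <-].
pose s := Num.max (enorm (c - 0)) r.
have s0 : 0 < s by rewrite lt_max r0 orbT.
have u0' : forall x, eball c r x -> (0 <= (EFin \o u) x)%E by move=> x _; rewrite lee_fin ltW.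
have cB : eball c r c by rewrite /eball/= subrr enorm0.
have M0 := mean_ge0 u0'; have Mle := A1 r0 cB.
have /fineK ME : mean c r (EFin \o u) \is a fin_num.
  by rewrite ge0_fin_numE// (le_lt_trans Mle)// ltry.
set m := fine _ in ME; have m0 : 0 <= m by rewrite -lee_fin ME.
have k1 : 0 < (2 * s) `^ a by rewrite powR_gt0// mulr_gt0.
have M1 : (mean c r (EFin \o w) <= ((2 * s) `^ a * m)%:E)%E.
  rewrite EFinM ME; apply: le_trans (le_meanZ k1 u0'); apply: le_mean => // x xB.
  rewrite lee_fin weight_ge0/= lee_fin ler_wpM2r ?(ltW (u0 _))//.
  apply: ge0_ler_powR; rewrite ?nnegrE ?enorm_ge0 ?mulr_ge0 ?(ltW s0)//.
  have := enorm_triangle c x 0; move: xB; rewrite /eball/= subr0.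
  have : enorm (c - 0) <= s by rewrite le_max lexx.
  have : r <= s by rewrite le_max lexx orbT.
  lra.
have C10 : 0 <= C1.
  by rewrite -(pmulr_lge0 _ (u0 c)) -lee_fin (le_trans M0).
have w0 : (0 <= mean c r (EFin \o w))%E.
  by apply: mean_ge0 => // x _; rewrite lee_fin weight_ge0.
(* If the mean of [u] vanishes, so does the first factor, and the product is 0 by the convention 0 *
   +oo = 0. *)
have [mE|mN] := eqVneq m 0.
  have -> : mean c r (EFin \o w) = 0%E.
    by apply/eqP; rewrite eq_le w0 andbT; move: M1; rewrite mE mulr0.
  by rewrite mul0e lee_fin !mulr_ge0 ?powR_ge0.
have {mN m0}m0 : 0 < m by rewrite lt0r mN.
have {C10}C10 : 0 < C1.
  rewrite lt0r C10 andbT; apply/eqP => C1E; move: Mle.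
  by rewrite -ME C1E mul0r lee_fin leNgt m0.
pose k2 := ((m / C1) `^ q)^-1.
have mC : 0 < m / C1 by rewrite divr_gt0.
have k20 : 0 < k2 by rewrite invr_gt0 powR_gt0.
have M2 : (mean c r (fun x => ((w x `^ q)%R%:E)^-1) <= (k2 * (C * s `^ (- (a * q))))%:E)%E.
  rewrite EFinM; apply: le_trans (lee_wpmul2l _ (hC 0 c r r0)); last by rewrite lee_fin ltW.
  apply: le_trans (le_meanZ k20 _); last first.
    by move=> x _; rewrite inve_ge0 lee_fin powR_ge0.
  apply: le_mean => // x xB; rewrite inve_ge0 lee_fin powR_ge0/= subr0.
  (* Where the power of |x| vanishes, the right-hand side is +oo. *)
  have [e0|e0] := eqVneq (enorm x `^ (a * q)) 0.
    by rewrite e0 inve0 gt0_muley ?leey// lte_fin.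
  have {}e0 : 0 < enorm x `^ (a * q) by rewrite lt0r e0 powR_ge0.
  rewrite powRM ?powR_ge0 ?(ltW (u0 _))// -powRrM.
  have uq : 0 < u x `^ q by rewrite powR_gt0.
  rewrite !inver !gt_eqF ?mulr_gt0// -EFinM lee_fin invfM mulrC ler_wpM2r ?invr_ge0 ?(ltW e0)//.
  rewrite lef_pV2 ?posrE ?powR_gt0//; apply: ge0_ler_powR; rewrite ?nnegrE ?(ltW q0) ?(ltW mC) ?(ltW (u0 _))//.
  by rewrite ler_pdivrMr// mulrC -lee_fin ME; exact: A1.
have M20 : (0 <= mean c r (fun x => ((w x `^ q)%R%:E)^-1))%E.
  by apply: mean_ge0 => // x _; rewrite inve_ge0 lee_fin powR_ge0.
have k3 : 0 <= k2 * (C * s `^ (- (a * q))) by rewrite !mulr_ge0 ?powR_ge0 ?(ltW k20).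
apply: (@le_trans _ _ (((2 * s) `^ a * m)%:E * (k2 * (C * s `^ (- (a * q))))%:E `^ (p - 1))%E).
  apply: lee_pmul => //; first exact: poweR_ge0.
  by apply: gt0_ler_poweR => //; rewrite ?(ltW p0)// in_itv/= ?M20 ?leey// lee_fin k3.
rewrite poweR_EFin -EFinM lee_fin le_eqVlt; apply/orP; left; apply/eqP.
have qp : q * (p - 1) = 1 by rewrite mulVf// gt_eqF.
rewrite [(k2 * _) `^ _]powRM ?(ltW k20) ?mulr_ge0 ?powR_ge0// [(C * _) `^ _]powRM ?powR_ge0//.
have -> : (s `^ (- (a * q))) `^ (p - 1) = (s `^ a)^-1.
  by rewrite -powRrM mulNr -mulrA qp mulr1 powRN.
have -> : k2 `^ (p - 1) = (m / C1)^-1.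
  by rewrite /k2 powR_invr ?powR_ge0// -powRrM qp powRr1 ?(ltW mC).
rewrite [(2 * s) `^ _]powRM ?(ltW s0)//; field.
by rewrite !gt_eqF// powR_gt0.
Qed.

End Ap_weights.

(** * Series of spikes *)

Section series_weight.
Context {R : realType} {n : nat}.
Implicit Types x y : 'rV[R]_n.
Variables (b rho : R) (c : nat -> R) (z : nat -> 'rV[R]_n).
Hypothesis b0 : 0 <= b.
Hypothesis bn : b < n%:R.
Hypothesis rho0 : 0 <= rho.
Hypothesis rho1 : rho < 1.
Hypothesis c0 : forall k, 0 < c k.
Hypothesis cz : forall k x,
  c k * (1 + enorm (x - z k)) `^ (- b) <= (1 + enorm x) `^ b * rho ^+ k.

Let term k x := c k * (1 + enorm (x - z k)) `^ (- b).

(** The finite part of an extended sum, which is integrated term by term; the geometric domination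
    [cz] makes the sum finite everywhere and of polynomial growth. *)
Definition series_weight x : R :=
  fine (\sum_(0 <= k <oo) (c k * (1 + enorm (x - z k)) `^ (- b))%:E)%E.

Let term_gt0 k x : 0 < term k x.
Proof. by rewrite mulr_gt0 ?powR_gt0// ltr_pwDl ?enorm_ge0. Qed.

Let term_ge0 k x : (0 <= (term k x)%:E)%E.
Proof. by rewrite lee_fin ltW. Qed.

Let series_le x : (\sum_(0 <= k <oo) (term k x)%:E <= ((1 + enorm x) `^ b / (1 - rho))%:E)%E.
Proof.
rewrite -geometric_nneseries//; apply: lee_nneseries => k _ //.
by rewrite lee_fin; exact: cz.
Qed.

Lemma series_weightE x : (series_weight x)%:E = (\sum_(0 <= k <oo) (term k x)%:E)%E.
Proof.
rewrite /series_weight fineK// ge0_fin_numE; last by apply: nneseries_ge0 => k _ _; exact: term_ge0.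
exact: le_lt_trans (series_le x) (ltry _).
Qed.

Lemma series_weight_le x : series_weight x <= (1 - rho)^-1 * (1 + enorm x) `^ b.
Proof. by rewrite -lee_fin series_weightE mulrC; exact: series_le. Qed.

Lemma term_le_series_weight k x :
  c k * (1 + enorm (x - z k)) `^ (- b) <= series_weight x.
Proof.
rewrite -lee_fin series_weightE; apply: le_trans (nneseries_lim_ge k.+1 _); last by [].
by rewrite big_nat_recr//= leeDr// sume_ge0.
Qed.

Lemma series_weight_gt0 x : 0 < series_weight x.
Proof. exact: lt_le_trans (term_gt0 0%N x) (term_le_series_weight 0%N x). Qed.

Let measurable_term k : measurable_fun setT (term k).
Proof.
apply: measurable_funM => //.
apply: (measurableT_comp (measurable_powR (- b))).
by apply: measurable_funD => //; exact: measurable_enormB.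
Qed.

Lemma measurable_series_weight : measurable_fun setT series_weight.
Proof.
apply: measurableT_comp => //; apply: ge0_emeasurable_sum => [k x _ _|k _]; first exact: term_ge0.
by apply/measurable_EFinP; exact: measurable_term.
Qed.

Lemma series_weight_A1 : exists C : R, forall x0 r x, 0 < r -> eball x0 r x ->
  (mean x0 r (EFin \o series_weight) <= (C * series_weight x)%:E)%E.
Proof.
have [C C0 hC] := bump_weight_A1 b0 bn.
exists C => x0 r x r0 xB.
apply: mean_le_integral => //.
have mB : measurable (eball x0 r) by exact: measurable_eball.
under eq_integral do rewrite /= series_weightE.
rewrite integral_nneseries//; last first.
  by move=> k; apply/measurable_EFinP; apply: measurable_funTS; exact: measurable_term.
rewrite EFinM series_weightE -nneseriesZl//.
have [m m0 mE] := lebesgue_eball_fin x0 r0.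
rewrite [in X in (_ <= X)%E]muleC mE -nneseriesZl//; last first.
  by move=> k _; rewrite mule_ge0// lee_fin.
apply: lee_nneseries => k _; first by move=> _; apply: integral_ge0.
rewrite /term; under eq_integral do rewrite EFinM.
rewrite ge0_integralZl_EFin//; last 3 first.
- by move=> y _; rewrite lee_fin powR_ge0.
- apply/measurable_EFinP; apply: measurable_funTS.
  apply: (measurableT_comp (measurable_powR (- b))).
  by apply: measurable_funD => //; exact: measurable_enormB.
- exact: ltW.
have := hC (z k) x0 r x r0 xB; rewrite /mean mE inver gt_eqF// lee_pdivrMl// => h.
apply: le_trans (lee_wpmul2l _ h) _; first by rewrite lee_fin ltW.
by rewrite -!EFinM lee_fin le_eqVlt; apply/orP; left; apply/eqP; ring.
Qed.

End series_weight.

(** * The Levy operator on bump functions *)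

Section tensor_smooth.
Context {R : realType} {n : nat}.
Implicit Types (x : 'rV[R]_n) (F : 'I_n -> R -> R).

Lemma differentiable_tens F x : (forall i, bumpc (F i)) -> differentiable (tens F) x.
Proof.
move=> bF; rewrite /tens; elim: (index_enum _) => [|i s IH].
  under eq_fun do rewrite big_nil.
  exact: differentiable_cst.
rewrite (_ : (fun _ => _) = (fun y : 'rV[R]_n => F i (y ord0 i)) *
    (fun y : 'rV[R]_n => \prod_(j <- s) F j (y ord0 j))); last first.
  by apply/funext => y; rewrite big_cons.
apply: differentiableM => //.
apply: (@differentiable_comp _ _ _ _ (fun y : 'rV[R]_n => y ord0 i) (F i)).
  exact: differentiable_coord.
have [f' _ df] := bumpc_derive (bF i).
by apply/derivable1_diffP; have [] := df (x ord0 i).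
Qed.

Lemma partial_tens F (f' : R -> R) i : (forall t : R, is_derive t 1 (F i) (f' t)) ->
  partial i (tens F) = tens (fun j => if j == i then f' else F j).
Proof.
move=> df; apply/funext => x; rewrite /partial /tens (bigD1 i)//= eqxx.
set P := \prod_(j < n | j != i) _.
(* Along a line in the direction i only the i-th factor varies. *)
have PE (y : 'rV[R]_n) : (forall j, j != i -> y ord0 j = x ord0 j) ->
    \prod_(j < n) F j (y ord0 j) = F i (y ord0 i) * P.
  move=> yx; rewrite (bigD1 i)//=; congr (_ * _); apply: eq_bigr => j ji.
  by rewrite (negPf ji) yx.
have [] := is_derive_scalel P (df (x ord0 i)); rewrite mulrC => _ <-.
rewrite /derive; apply: (congr1 (fun g : R -> R => lim (g @ (0 : R)^'))); apply/funext => h; congr (_ *: _) => /=.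
rewrite !PE//; last first.
  by move=> j ji; rewrite !mxE (negPf ji) andbF mulr0 add0r.
by rewrite !mxE !eqxx /GRing.scale/= !mulr1 ![P * _]mulrC.
Qed.

Lemma foldr_partial_tens F (s : seq 'I_n) : (forall i, bumpc (F i)) ->
  exists2 G : 'I_n -> R -> R, (forall i, bumpc (G i)) & foldr partial (tens F) s = tens G.
Proof.
move=> bF; elim: s => [|i s [G bG E]] /=; first by exists F.
have [f' bf' df] := bumpc_derive (bG i).
exists (fun j => if j == i then f' else G j); first by move=> j; case: ifP.
by rewrite E; exact: partial_tens.
Qed.

Lemma tens_supp F x i : (forall j, bumpc (F j)) -> 1 <= `|x ord0 i| -> tens F x = 0.
Proof. by move=> bF xi; rewrite /tens (bigD1 i)//= (bumpc_supp (bF i))// mul0r. Qed.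

Lemma test_function_tens F : (forall i, bumpc (F i)) -> test_function (tens F).
Proof.
move=> bF; split.
  by move=> s x; have [G bG ->] := foldr_partial_tens s bF; exact: differentiable_tens.
pose B : set 'rV[R]_n := [set v | forall i, `[-1, 1]%classic (v ord0 i)].
have cB : compact B.
  by apply: (@rV_compact R n (fun=> `[-1, 1]%classic)) => i; exact: segment_compact.
apply: (subclosed_compact _ cB); first exact: closed_closure.
have BE : B = closure B by apply/closure_id; apply: compact_closed => //; exact: norm_hausdorff.
rewrite BE; apply: closure_subset => x /= /eqP x0 i; rewrite /= in_itv/= -ler_norml leNgt.
by apply/negP => /ltW xi; apply: x0; exact: tens_supp xi.
Qed.

(** The partial derivatives are again products of bumps and vanish on the same closed region,
    boundary included. *)
Lemma gradv_tens_eq0 F x i : (forall j, bumpc (F j)) -> 1 <= `|x ord0 i| ->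
  gradv (tens F) x = 0.
Proof.
move=> bF xi; apply/rowP => j; rewrite !mxE.
have [f' bf' df] := bumpc_derive (bF j).
have := congr1 (@^~ x) (partial_tens df); rewrite /partial => ->.
by apply: tens_supp xi => k; case: ifP.
Qed.

End tensor_smooth.

(** * Integration against the Levy measure *)

Section levy_measure.
Context {R : realType} (sigma : R) {n : nat}.

(** This part of the measure is carried by the hyperplane y_1 = 0, on which the integrand
    vanishes. *)
Lemma integral_levy_tail_part (f : 'rV[R]_n.+1 -> \bar R) :
  measurable_fun setT f -> (forall y, (0 <= f y)%E) ->
  (forall y : 'rV[R]_n, f (rv_cons (0, y)) = 0%E) ->
  (\int[(\d_(0%R : measurableTypeR R) \x^ levy_tail sigma n)%E]_z f (rv_cons z) = 0)%E.
Proof.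
move=> mf f0 fz.
pose N : set (measurableTypeR R * 'rV[R]_n)%type := (~` [set 0]) `*` setT.
have mN : measurable N by apply: measurableX => //; apply: measurableC; exact: measurable_set1.
have N0 : (\d_(0%R : measurableTypeR R) \x^ levy_tail sigma n)%E N = 0%E.
  rewrite /N product_measure2E//; last by apply: measurableC; exact: measurable_set1.
  have d0 : \d_(0%R : measurableTypeR R) (~` [set 0]) = 0%E :> \bar R.
    by rewrite diracE memNset//=; apply.
  by apply: etrans (mul0e _); congr (_ * _)%E; exact: d0.
rewrite (ge0_negligible_integral mN measurableT _ _ N0)//; last first.
  exact: measurableT_comp mf (@measurable_rv_cons R n).
apply: integral0_eq => -[t y] /= [_ tN].
have -> : t = 0 by apply: contrapT => t0; exact: tN.
exact: fz.
Qed.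

(** The product with the Dirac mass at 0 is the image of the first factor under t |-> (t, 0). *)
Lemma integral_levy_axis_part (f : 'rV[R]_n.+1 -> \bar R) :
  measurable_fun setT f -> (forall y, (0 <= f y)%E) ->
  (\int[(levy_axis sigma \x \d_(0%R : 'rV[R]_n))%E]_z f (rv_cons z) =
   \int[levy_axis sigma]_t f (rv_cons (t, 0%R)))%E.
Proof.
move=> mf f0.
pose phi (t : measurableTypeR R) : (measurableTypeR R * 'rV[R]_n)%type := (t, 0).
have mphi : measurable_fun setT phi.
  by apply/measurable_fun_pairP; split; [exact: measurable_id|exact: measurable_cst].
have mg : measurable_fun setT (f \o rv_cons) := measurableT_comp mf (@measurable_rv_cons R n).
have := @ge0_integral_pushforward _ _ _ _ R phi mphi (levy_axis sigma) setT (f \o rv_cons) measurableT mg.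
rewrite preimage_setT => <-; last by move=> y _; exact: f0.
apply: eq_measure_integral => A mA _.
rewrite /= /product_measure1 /pushforward.
have mA' : measurable (phi @^-1` A) by rewrite -[X in measurable X]setTI; exact: mphi.
rewrite -[X in _ = levy_axis sigma X]setIT -integral_indic//.
apply: eq_integral => t _ /=.
by rewrite diracE indicE; congr (_%:R)%:E; congr nat_of_bool; apply/idP/idP;
  rewrite !inE /xsection/= ?inE.
Qed.

Lemma integral_levy_measure (f : 'rV[R]_n.+1 -> \bar R) :
  measurable_fun setT f -> (forall y, (0 <= f y)%E) ->
  (forall y : 'rV[R]_n, f (rv_cons (0, y)) = 0%E) ->
  (\int[levy_measure sigma n]_y f y =
   \int[levy_axis sigma]_t f (rv_cons (t, 0%R)))%E.
Proof.
move=> mf f0 fz; rewrite /levy_measure /rv_measure.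
have := @ge0_integral_pushforward _ _ _ _ R _ (@measurable_rv_cons R n)
  (measure_add (levy_axis sigma \x \d_(0%R : 'rV[R]_n))%E
   (\d_(0%R : measurableTypeR R) \x^ levy_tail sigma n)%E) setT f measurableT mf.
rewrite preimage_setT => ->; last by move=> y _.
rewrite ge0_integral_measure_add//; last 2 first.
- by move=> y _; exact: f0.
- exact: measurableT_comp mf (@measurable_rv_cons R n).
rewrite -[RHS]adde0; congr (_ + _)%E; first exact: integral_levy_axis_part.
exact: integral_levy_tail_part.
Qed.

Lemma integral_levy_atom (f : R -> \bar R) (k : int) :
  @measurable_fun _ _ (measurableTypeR R) _ setT f -> (forall y, (0 <= f y)%E) ->
  (\int[levy_atom sigma k]_t f t = (2 `^ (- (k%:~R * sigma)))%:E *
    (f (2 ^ k)%R + f (- 2 ^ k)%R))%E.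
Proof.
move=> mf f0; rewrite /levy_atom ge0_integral_mscale// ge0_integral_measure_add//.
by rewrite !integral_dirac//= !diracT !mul1e.
Qed.

(** Every atom other than the one at - 2^k is killed by [fp] or [fn]. The surviving atom is a
    negative one because it has to carry x to x - 2^k e_1; as k >= 0, it belongs to the first of the
    two series. *)
Lemma integral_levy_axis_single (f : R -> \bar R) (k : nat) :
  @measurable_fun _ _ (measurableTypeR R) _ setT f -> (forall y, (0 <= f y)%E) ->
  (forall j : int, f (2 ^ j)%R = 0%E) ->
  (forall j : int, j != k -> f (- 2 ^ j)%R = 0%E) ->
  (\int[levy_axis sigma]_t f t = (2 `^ (- (k%:R * sigma)))%:E * f (- 2 ^+ k)%R)%E.
Proof.
move=> mf f0 fp fn; rewrite /levy_axis ge0_integral_measure_add//.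
rewrite !ge0_integral_measure_series//.
rewrite [X in (_ + X)%E]eseries0 ?adde0; last first.
  by move=> j _ _; rewrite integral_levy_atom// fp fn// adde0 mule0.
rewrite (@nneseriesD1 _ _ k)//; last by move=> j _; exact: integral_ge0.
rewrite eseries0 ?adde0 => [|j _ jk]; last first.
  by rewrite integral_levy_atom// fp fn ?adde0 ?mule0.
by rewrite integral_levy_atom// fp add0e.
Qed.

End levy_measure.

(** The expanded product contains these terms, and the others are nonnegative. This compares
    Euclidean growth of the weight with the coordinatewise decay [poly_decay]. *)
Lemma prod_1Dsqr_ge (R : realType) n (x : 'rV[R]_n) :
  1 + \sum_(i < n) x ord0 i ^+ 2 <= \prod_(i < n) (1 + x ord0 i ^+ 2).
Proof.
elim: (index_enum _) => [|i s IH]; first by rewrite !big_nil addr0.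
rewrite !big_cons; have h : 0 <= \sum_(j <- s) x ord0 j ^+ 2.
  by apply: sumr_ge0 => j _; exact: sqr_ge0.
have := sqr_ge0 (x ord0 i); nra.
Qed.

(** * The test function and its two norms *)

Section counterexample.
Context {R : realType} {n : nat} (sigma : R).
Hypothesis sigma02 : 0 < sigma < 2.
Implicit Types x y : 'rV[R]_n.+1.

Let v : 'rV[R]_n.+1 -> R := tens (fun=> @bumpf R).
Let L := levy_op sigma (levy_measure sigma n).

Definition axis_point (k : nat) : 'rV[R]_n.+1 := 2 ^+ k *: delta_mx ord0 ord0.

(** The half-side 1/2 gives measure one and keeps x - 2^k e_1 in the cube where the bumps are
    bounded below. *)
Definition axis_box k : set 'rV[R]_n.+1 := box (axis_point k) (1 / 2).

Lemma axis_point0 k : axis_point k ord0 ord0 = 2 ^+ k.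
Proof. by rewrite !mxE !eqxx mulr1. Qed.

Lemma axis_box_coord0 k x : axis_box k x -> `|x ord0 ord0 - 2 ^+ k| <= 1 / 2.
Proof. by move=> /(_ ord0); rewrite axis_point0. Qed.

Let bb (i : 'I_n.+1) : bumpc (@bumpf R). Proof. exact: bumpc_bump. Qed.

Lemma bump_tens_ge0 x : 0 <= v x.
Proof. by apply: prodr_ge0 => i _; exact: bump_ge0. Qed.

Lemma bump_tens_ge k x : axis_box k x -> expR (- 4) ^+ n.+1 <= v (x - axis_point k).
Proof.
move=> xk; rewrite -[X in _ ^+ X](card_ord n.+1) -prodr_const; apply: ler_prod => i _.
by rewrite expR_ge0/= bump_ge_expR//; have := xk i; rewrite !mxE.
Qed.

(** The closest other power is 2^(k - 1), at distance 2^(k - 1) >= 2. This exceeds 1 + 1/2, the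
    half-width of the support plus that of a box, so no two atoms interfere. *)
Lemma pow2_far (k j : nat) : (2 <= k)%N -> j != k -> (2 : R) <= `|2 ^+ k - 2 ^+ j|.
Proof.
move=> k2; rewrite neq_ltn => /orP[jk|kj].
  have k0 : (0 < k)%N by exact: leq_trans k2.
  have h1 : (2 : R) ^+ j <= 2 ^+ k.-1 by rewrite ler_eXn2l ?ltr1n// -ltnS prednK.
  have h2 : (2 : R) ^+ 1 <= 2 ^+ k.-1.
    by rewrite ler_eXn2l ?ltr1n// -ltnS prednK.
  have h3 : (2 : R) ^+ k = 2 * 2 ^+ k.-1 by rewrite -exprS prednK.
  by rewrite ger0_norm; rewrite expr1 in h2; lra.
have h1 : (2 : R) ^+ k.+1 <= 2 ^+ j by rewrite ler_eXn2l ?ltr1n.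
have h2 : (2 : R) ^+ 2 <= 2 ^+ k by rewrite ler_eXn2l ?ltr1n.
rewrite exprS in h1; rewrite distrC ger0_norm; lra.
Qed.

Lemma pow2_ge4 (k : nat) : (2 <= k)%N -> (4 : R) <= 2 ^+ k.
Proof.
move=> k2; have : (2 : R) ^+ 2 <= 2 ^+ k by rewrite ler_eXn2l ?ltr1n.
lra.
Qed.

Lemma bump_tens_eq0 x : 1 <= `|x ord0 ord0| -> v x = 0.
Proof. exact: tens_supp. Qed.

Lemma measurable_bump_shift x : measurable_fun setT (fun y => v (x + y)).
Proof.
rewrite (_ : (fun y => _) = tens (fun i t => bumpf (x ord0 i + t))).
  apply: measurable_tens => i.
  have h : @measurable_fun _ _ (measurableTypeR R) (measurableTypeR R) setT (fun t : R => x ord0 i + t).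
    exact: measurable_funD.
  exact: (measurableT_comp (bumpc_measurable (bb i)) h).
by apply/funext => y; rewrite /v /tens; apply: eq_bigr => i _; rewrite mxE.
Qed.

Lemma levy_op_bump k x : (2 <= k)%N -> axis_box k x ->
  L v x = 2 `^ (- (k%:R * sigma)) * v (x - axis_point k).
Proof.
move=> k2 xk; have x0 := axis_box_coord0 xk; have p4 := pow2_ge4 k2.
have /andP[x1 x2] : 2 ^+ k - 1 / 2 <= x ord0 ord0 <= 2 ^+ k + 1 / 2.
  by rewrite -ler_distl.
have xge : 1 <= `|x ord0 ord0| by rewrite ger0_norm; lra.
(* Both v and its gradient vanish at x, so only v(x + y) is left in the integrand. *)
have -> : L v x = fine (\int[levy_measure sigma n]_y (v (x + y))%:E)%E.
  apply: eq_Rintegral => y _; rewrite (bump_tens_eq0 xge) (gradv_tens_eq0 bb xge) /dotv big1 ?subr0//.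
  by move=> i _; rewrite mxE mul0r.
have mv := measurable_bump_shift x.
have mf : measurable_fun setT (fun y => (v (x + y))%:E) by exact/measurable_EFinP.
have f0 y : (0 <= (v (x + y))%:E)%E by rewrite lee_fin bump_tens_ge0.
have phi_m : measurable_fun setT (fun t : measurableTypeR R => rv_cons (t, 0 : 'rV[R]_n)).
  apply: (measurableT_comp (@measurable_rv_cons R n)).
  by apply/measurable_fun_pairP; split; [exact: measurable_id|exact: measurable_cst].
rewrite integral_levy_measure//; last first.
  by move=> y; congr EFin; apply: bump_tens_eq0; rewrite mxE rv_cons0 addr0.
rewrite (@integral_levy_axis_single _ _ (fun t => (v (x + rv_cons (t, 0)))%:E) k).
- rewrite -EFinM/=; congr (_ * v (_ + _)); apply/rowP => i.
  case: (unliftP ord0 i) => [j ->|->]; last by rewrite rv_cons0 !mxE !eqxx mulr1.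
  by rewrite rv_consS !mxE !eqxx /= mulr0 oppr0.
- exact: (measurableT_comp mf phi_m).
- by move=> t; exact: f0.
(* The atoms at 2^j move x further to the right. *)
- move=> j; congr EFin; apply: bump_tens_eq0; rewrite mxE rv_cons0.
  have : 0 < (2 : R) ^ j by rewrite exprz_gt0.
  by move=> j0; rewrite ger0_norm; lra.
- move=> j jk; congr EFin; apply: bump_tens_eq0; rewrite mxE rv_cons0.
  case: j jk => j jk.
    have := pow2_far k2 (jk : j != k); rewrite -exprnP => far.
    have := ler_distD (x ord0 ord0) (2 ^+ k) (2 ^+ j); rewrite [`|2 ^+ k - x ord0 ord0|]distrC; lra.
  (* For negative exponents the atom moves x to the left by at most 1, while x_1 >= 4 - 1/2. *)
  have : (2 : R) ^ Negz j <= 1 by rewrite NegzE -exprz_inv /= -exprnP exprVn invf_le1 ?exprn_gt0// exprn_ege1// ler1n.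
  by move=> j1; rewrite ger0_norm; lra.
Qed.

Lemma axis_box_trivIset : trivIset setT (fun k => axis_box k.+2).
Proof.
apply/trivIsetP => i j _ _ ij; apply/seteqP; split => // x [xi xj].
have h1 := axis_box_coord0 xi; have h2 := axis_box_coord0 xj.
have := @pow2_far i.+2 j.+2 isT; rewrite !eqSS eq_sym => /(_ ij).
have := ler_distD (x ord0 ord0) (2 ^+ i.+2) (2 ^+ j.+2).
rewrite [`|2 ^+ i.+2 - x ord0 ord0|]distrC => h3 h4; lra.
Qed.

Lemma lebesgue_bigcup_axis_box : lebesgue_rV n.+1 (\bigcup_k axis_box k.+2) = +oo%E.
Proof.
rewrite measure_bigcup//; last 2 first.
- by move=> k _; exact: measurable_box.
- exact: axis_box_trivIset.
apply/eqyP => A A0.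
pose N := (Num.truncn A).+1.
apply: le_trans (nneseries_lim_ge N _); last by [].
rewrite (eq_bigr (fun=> (1 : R)%:E)) => [|k _]; last first.
  have h : (0 : R) <= 1 / 2 by lra.
  apply: etrans (lebesgue_box (axis_point k.+2) h) _.
  by rewrite mulrC divfK// expr1n.
rewrite (eq_bigl xpredT); last by move=> k; rewrite in_setT.
by rewrite sumEFin sumr_const_nat subn0 lee_fin ltW// truncnS_gt.
Qed.

Section unbounded.
Variables (p c K B : R) (w : 'rV[R]_n.+1 -> R).
Hypothesis p1 : 1 < p.
Hypothesis c0 : 0 < c.
Hypothesis B0 : 0 <= B.
Hypothesis w0 : forall x, 0 <= w x.
Hypothesis wK : forall x, w x <= K * (1 + enorm x) `^ B.
Hypothesis wc : forall k x, (2 <= k)%N -> axis_box k x -> c * (2 ^+ k) `^ (sigma * p) <= w x.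

Let p0 : 0 < p. Proof. exact: lt_trans p1. Qed.

Lemma wLnorm_levy_bump : wLnorm p w (L v) = +oo%E.
Proof.
rewrite /wLnorm; set I := (\int[_]_x _)%E; suff -> : I = +oo%E.
  by rewrite poweRyr// gt_eqF// invr_gt0.
(* A lower bound for the integrand that is the same on all boxes: the power 2^(k sigma p) granted by
   [wc] cancels the one in |Lv|^p. *)
pose e : R := (expR (- 4) ^+ n.+1) `^ p * c.
have e0 : 0 < e by rewrite mulr_gt0// powR_gt0// exprn_gt0// expR_gt0.
apply/eqP; rewrite -leye_eq.
apply: (@le_trans _ _ (\int[lebesgue_rV n.+1]_(x in \bigcup_k axis_box k.+2) e%:E)%E).
  rewrite (integral_cst (lebesgue_rV n.+1) _ e%:E); last first.
    by apply: bigcup_measurable => k _; exact: measurable_box.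
  have -> : (e%:E * lebesgue_rV n.+1 (\bigcup_k axis_box k.+2) = e%:E * +oo)%E.
    by congr (_ * _)%E; exact: lebesgue_bigcup_axis_box.
  by rewrite gt0_muley.
apply: (@le_trans _ _ (\int[lebesgue_rV n.+1]_(x in \bigcup_k axis_box k.+2)
   (`|L v x| `^ p * w x)%:E)%E); last first.
  by apply: ge0_integral_subset_nonmeas => // x _; rewrite lee_fin mulr_ge0 ?powR_ge0.
apply: ge0_le_integral_nonmeas => x [k _ xk]; first by rewrite lee_fin ltW.
have v0 : 0 < expR (- 4) ^+ n.+1 :> R by rewrite exprn_gt0// expR_gt0.
have k0 : 0 < (2 : R) `^ (- (k.+2%:R * sigma)) by rewrite powR_gt0.
rewrite lee_fin (@levy_op_bump k.+2)// ger0_norm ?mulr_ge0 ?bump_tens_ge0 ?(ltW k0)//.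
apply: (@le_trans _ _ ((2 `^ (- (k.+2%:R * sigma)) * expR (- 4) ^+ n.+1) `^ p *
    (c * (2 ^+ k.+2) `^ (sigma * p)))); last first.
  apply: ler_pM; rewrite ?powR_ge0 ?mulr_ge0 ?powR_ge0 ?(ltW c0)//; last exact: wc.
  apply: ge0_ler_powR; rewrite ?nnegrE ?(ltW p0) ?mulr_ge0 ?bump_tens_ge0 ?(ltW k0) ?(ltW v0)//.
  by rewrite ler_wpM2l ?(ltW k0)//; exact: bump_tens_ge.
rewrite powRM ?(ltW k0) ?(ltW v0)//.
have -> : (2 `^ (- (k.+2%:R * sigma))) `^ p = ((2 ^+ k.+2) `^ (sigma * p))^-1.
  rewrite -powRrM -[2 ^+ k.+2]powR_mulrn// -powRrM -powRN.
  by congr powR; ring.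
rewrite /e le_eqVlt; apply/orP; left; apply/eqP; field.
by rewrite gt_eqF// powR_gt0// exprn_gt0.
Qed.

Lemma wHnorm_bump_lt_pinfty : (wHnorm sigma p w v < +oo)%E.
Proof.
rewrite /wHnorm /wLnorm; apply: poweR_lty.
(* With q the product of the 1 + x_i^2, the weight grows at most like q^m because B <= m. Decay of
   order m + 1 then leaves 1/q, which is integrable. *)
pose m := (Num.truncn B).+1.
have Bm : B <= m%:R by exact: ltW (truncnS_gt _).
have [C C0 hC] := @bessel_bump_decay R n.+1 sigma m sigma02.
have K0 : 0 <= K.
  by have := le_trans (w0 0) (wK 0); rewrite enorm0 addr0 powR1 mulr1.
pose K' := C `^ p * (K * 2 `^ B).
have K'0 : 0 <= K' by rewrite !mulr_ge0 ?powR_ge0.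
pose h : 'I_n.+1 -> R -> R := fun=> fun t => (1 + t ^+ 2)^-1.
have it : (lebesgue_rV n.+1).-integrable setT (EFin \o tens h).
  by apply: integrable_tens => i; exact: integrable_inv1Dsqr.
have iK := integrableZl measurableT K' it.
apply: (@le_lt_trans _ _ (\int[lebesgue_rV n.+1]_x (K' * tens h x)%:E)%E); last first.
  exact: (integrable_lty measurableT iK).
apply: ge0_le_integral_nonmeas => x _; first by rewrite lee_fin mulr_ge0 ?powR_ge0.
rewrite lee_fin ger0_norm ?normc_ge0//.
pose q : R := \prod_(i < n.+1) (1 + x ord0 i ^+ 2).
have q1 : 1 <= q.
  by apply: le_trans (prod_1Dsqr_ge x); rewrite lerDl sumr_ge0// => i _; exact: sqr_ge0.
have q0 : 0 < q by exact: lt_le_trans q1.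
have wd : poly_decay m.+1 x = (q ^+ m.+1)^-1 by rewrite /poly_decay prodfV prodrXl.
have hE : tens h x = q^-1 by rewrite /tens prodfV.
have eq : 1 + enorm x <= 2 * q.
  apply: (@le_trans _ _ (2 * (1 + enorm x ^+ 2))).
    by have := sqr_ge0 (enorm x - 1); have := enorm_ge0 x; nra.
  by rewrite ler_wpM2l// enorm_sqr; exact: prod_1Dsqr_ge.
have qm0 : 0 < q ^+ m.+1 by rewrite exprn_gt0.
apply: (@le_trans _ _ ((C `^ p * (q ^+ m.+1)^-1) * (K * (2 `^ B * q ^+ m)))).
  apply: ler_pM => //; first exact: powR_ge0.
    apply: (@le_trans _ _ ((C * (q ^+ m.+1)^-1) `^ p)).
      apply: ge0_ler_powR; rewrite ?nnegrE ?normc_ge0 ?mulr_ge0 ?invr_ge0 ?(ltW qm0) ?(ltW p0)//.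
      by rewrite -wd; exact: hC.
    rewrite powRM ?invr_ge0 ?(ltW qm0)// ler_wpM2l ?powR_ge0//.
    (* The base is at most 1 and p >= 1, so the power p can only improve the decay. *)
    apply: ge1r_powR; last exact: ltW.
    by rewrite invr_gt0 qm0 invf_le1//= exprn_ege1.
  apply: le_trans (wK x) _; rewrite ler_wpM2l//.
  apply: (@le_trans _ _ ((2 * q) `^ B)).
    by apply: ge0_ler_powR; rewrite ?nnegrE ?addr_ge0 ?enorm_ge0 ?mulr_ge0 ?(ltW q0).
  rewrite powRM ?(ltW q0)// ler_wpM2l ?powR_ge0// -powR_mulrn ?(ltW q0)//.
  exact: ler_powR.
rewrite hE le_eqVlt; apply/orP; left; apply/eqP; rewrite /K' exprS; field.
by rewrite !gt_eqF ?exprn_gt0.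
Qed.

Lemma levy_op_unbounded : ~ bounded_HL sigma p w L.
Proof.
case=> N /(_ v (test_function_tens bb)); rewrite wLnorm_levy_bump.
have h := wHnorm_bump_lt_pinfty.
have h0 : (0 <= wHnorm sigma p w v)%E by exact: poweR_ge0.
have /fineK <- : wHnorm sigma p w v \is a fin_num by rewrite ge0_fin_numE.
by rewrite -EFinM leye_eq.
Qed.

End unbounded.

End counterexample.

(** * Unboundedness *)

Section main_weights.
Context {R : realType} {n : nat} (sigma : R).
Hypothesis sigma02 : 0 < sigma < 2.
Hypothesis sigman : sigma < n.+1%:R.
Implicit Types x : 'rV[R]_n.+1.

Let L := levy_op sigma (levy_measure sigma n).

Let sigma0 : 0 < sigma. Proof. by case/andP: sigma02. Qed.

Lemma axis_box_enorm_ge k x : (2 <= k)%N -> axis_box k x -> 2 ^+ k / 2 <= enorm x.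
Proof.
move=> k2 xk; have p4 : (4 : R) <= 2 ^+ k := pow2_ge4 k2.
have := axis_box_coord0 xk; rewrite ler_distl => /andP[h1 h2].
apply: le_trans (coord_le_enorm x ord0); rewrite ger0_norm; lra.
Qed.

Lemma power_weight_unbounded (p l : R) : 1 < p -> sigma * p <= l < n.+1%:R * (p - 1) ->
  Ap p (fun x => enorm x `^ l) /\ ~ bounded_HL sigma p (fun x => enorm x `^ l) L.
Proof.
move=> p1 /andP[sl ln].
have p0 : 0 < p by exact: lt_trans p1.
have l0 : 0 <= l by apply: le_trans sl; rewrite mulr_ge0 ?ltW.
have wE : (fun x => enorm x `^ l) = (fun x => enorm x `^ l * (cst 1 : 'rV[R]_n.+1 -> R) x).
  by apply/funext => x; rewrite mulr1.
split.
  rewrite wE; apply: (@Ap_power_A1 R n.+1 p l 0 1 1 (cst 1)) => //.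
  - by move=> x; rewrite powRr0 mulr1.
  - move=> c r x r0 _; apply: mean_le_cst => // y _.
    by rewrite mulr1 !lee_fin ler01 lexx.
(* The constant 2^(-l) comes from |x| >= 2^k / 2 on the k-th box. *)
apply: (@levy_op_unbounded R n sigma sigma02 p ((2 `^ l)^-1) 1 l) => //.
- by move=> x; exact: powR_ge0.
- move=> x; rewrite mul1r; apply: ge0_ler_powR => //; rewrite ?nnegrE ?addr_ge0 ?enorm_ge0//.
  by rewrite lerDr.
move=> k x k2 xk; have xge := axis_box_enorm_ge k2 xk.
apply: (@le_trans _ _ ((2 ^+ k / 2) `^ l)); last first.
  by apply: ge0_ler_powR => //; rewrite ?nnegrE ?divr_ge0 ?exprn_ge0 ?enorm_ge0.
rewrite powRM ?exprn_ge0 ?invr_ge0// powR_invr// mulrC ler_wpM2r ?invr_ge0 ?powR_ge0//.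
by apply: ler_powR => //; rewrite exprn_ege1// ler1n.
Qed.

Lemma spiked_weight_unbounded (p : R) : 1 < p ->
  exists w : 'rV[R]_n.+1 -> R, Ap p w /\ ~ bounded_HL sigma p w L.
Proof.
move=> p1; have p0 : 0 < p - 1 by rewrite subr_gt0.
(* The midpoint of the admissible interval ]sigma, d[. *)
pose b := (sigma + n.+1%:R) / 2.
have N := sigman. have sb : sigma < b by rewrite /b; lra.
have bn : b < n.+1%:R by rewrite /b; lra.
have b0 : 0 <= b by rewrite ltW// (lt_trans sigma0).
(* Seen from a fixed point, the k-th spike has height 2^(k sigma) and has decayed by 2^(-k b),
   whence this ratio, smaller than 1 because sigma < b. *)
pose rho : R := 2 `^ (sigma - b).
have rho0 : 0 <= rho by exact: powR_ge0.
have rho1 : rho < 1.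
  rewrite /rho /powR pnatr_eq0/= expR_lt1 pmulr_llt0 ?subr_lt0//.
  by rewrite ln_gt0 ?ltr1n.
pose c (k : nat) : R := (2 ^+ k) `^ sigma.
have P2 (k : nat) : 0 < (2 : R) ^+ k by rewrite exprn_gt0.
have c0 k : 0 < c k by rewrite powR_gt0.
have e0 x : 0 < 1 + enorm x by rewrite ltr_pwDl ?enorm_ge0.
have cz k x : c k * (1 + enorm (x - axis_point k)) `^ (- b) <= (1 + enorm x) `^ b * rho ^+ k.
  (* The triangle inequality bounds 2^k by |x| + |x - 2^k e_1|. The b-th power of the product form
     is the claimed domination. *)
  have kE : 2 ^+ k <= (1 + enorm x) * (1 + enorm (x - axis_point k)).
    have h1 : 2 ^+ k <= enorm (axis_point k : 'rV[R]_n.+1).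
      apply: le_trans (coord_le_enorm _ ord0); rewrite axis_point0 ger0_norm// ltW//.
    have h2 := enorm_triangle x (axis_point k) 0; rewrite !subr0 enorm_distC in h2.
    have := enorm_ge0 x; have := enorm_ge0 (x - axis_point k); nra.
  have rE : rho ^+ k = (2 ^+ k) `^ sigma / (2 ^+ k) `^ b.
    rewrite -powR_exprn// -powRB; last by apply/implyP => _; rewrite gt_eqF.
    by rewrite powR_exprn// -powR_exprn.
  rewrite rE /c mulrCA ler_wpM2l ?powR_ge0// powRN ler_pdivlMr ?powR_gt0//.
  rewrite mulrC ler_pdivrMr ?powR_gt0// -powRM ?(ltW (e0 _))//.
  by apply: ge0_ler_powR => //; rewrite nnegrE ?mulr_ge0 ?(ltW (e0 _)) ?(ltW (P2 _)).
pose u := series_weight b c (axis_point : nat -> 'rV[R]_n.+1).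
have u0 := series_weight_gt0 rho0 rho1 c0 cz.
have uK := series_weight_le rho0 rho1 c0 cz.
have [C uA] := series_weight_A1 b0 bn rho0 rho1 c0 cz.
pose a := sigma * (p - 1).
have a0 : 0 <= a by rewrite mulr_ge0 ?ltW.
have an : a < n.+1%:R * (p - 1) by rewrite ltr_pM2r.
exists (fun x => enorm x `^ a * u x); split.
  apply: (@Ap_power_A1 R n.+1 p a b (1 - rho)^-1 C u) => //.
  exact: measurable_series_weight c0.
(* On the k-th box |x| >= 2^k / 2, and the distance to the centre is at most d / 2; the k-th spike
   alone then gives the lower bound. *)
pose cc : R := (2 `^ a)^-1 * (1 + n.+1%:R * (1 / 2)) `^ (- b).
have t0 : 0 < 1 + n.+1%:R * (1 / 2) :> R by rewrite ltr_pwDl// mulr_ge0//; lra.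
apply: (@levy_op_unbounded R n sigma sigma02 p cc (1 - rho)^-1 (a + b)) => //.
- by rewrite mulr_gt0 ?invr_gt0 ?powR_gt0.
- exact: addr_ge0.
- by move=> x; rewrite mulr_ge0 ?powR_ge0 ?ltW.
- by move=> x; apply: (weight_le a0 u0 uK).
move=> k x k2 xk; have xge := axis_box_enorm_ge k2 xk.
apply: (@le_trans _ _ ((2 ^+ k / 2) `^ a * (c k * (1 + n.+1%:R * (1 / 2)) `^ (- b)))); last first.
  apply: ler_pM; rewrite ?mulr_ge0 ?powR_ge0//.
    by apply: ge0_ler_powR => //; rewrite ?nnegrE ?divr_ge0 ?exprn_ge0 ?enorm_ge0.
  apply: le_trans (term_le_series_weight rho0 rho1 c0 cz k x); rewrite ler_wpM2l ?(ltW (c0 _))//.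
  rewrite !powRN lef_pV2 ?posrE ?(powR_gt0 _ (e0 _)) ?(powR_gt0 _ t0)//.
  apply: ge0_ler_powR => //; rewrite ?nnegrE ?(ltW (e0 _)) ?(ltW t0)// lerD2l.
  apply: enorm_le_coord; first lra.
  by move=> i; have := xk i; rewrite !mxE.
rewrite powRM ?exprn_ge0 ?invr_ge0// powR_invr// le_eqVlt; apply/orP; left; apply/eqP.
(* The power of |x| provides the exponent a = sigma (p - 1), and the height of the spike provides
   the remaining sigma. *)
have -> : sigma * p = a + sigma by rewrite /a; ring.
rewrite powRD; last by apply/implyP => _; rewrite gt_eqF.
by rewrite /cc /c; ring.
Qed.

Lemma power_range_nonempty :
  \forall p \near +oo, exists l : R, sigma * p <= l < n.+1%:R * (p - 1).
Proof.
(* The condition sigma p < d (p - 1) amounts to p > d / (d - sigma). *)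
exists (n.+1%:R / (n.+1%:R - sigma)); split; first exact: num_real.
move=> p; rewrite ltr_pdivrMr ?subr_gt0// => h.
by exists (sigma * p); rewrite lexx/=; lra.
Qed.

End main_weights.

Theorem mainTheorem3 (R : realType) (n : nat) (sigma : R)
    (hsigma : 0 < sigma < 2)
    (hd : (2 <= n.+1)%N \/ (n.+1 = 1%N /\ sigma < 1)) :
  let L := levy_op sigma (levy_measure sigma n) in
  [/\ forall p l : R, 1 < p -> sigma * p <= l < n.+1%:R * (p - 1) ->
        Ap p (fun x : 'rV[R]_n.+1 => enorm x `^ l) /\
        ~ bounded_HL sigma p (fun x : 'rV[R]_n.+1 => enorm x `^ l) L,
      \forall p \near +oo, exists l : R,
        sigma * p <= l < n.+1%:R * (p - 1) &
      forall p : R, 1 < p ->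
        exists w : 'rV[R]_n.+1 -> R, Ap p w /\ ~ bounded_HL sigma p w L].
Proof.
have sigman : sigma < n.+1%:R.
  case: hd => [n2|[-> //]]; case/andP: hsigma => _ s2.
  by apply: lt_le_trans s2 _; rewrite ler_nat.
split; [exact: power_weight_unbounded|exact: power_range_nonempty|exact: spiked_weight_unbounded].
Qed.
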